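(* Consider a triangular array of experiments indexed by $T\in\mathbb N$, each run with the Sigmoid-FTRL design using a fixed sigmoid $\phi$ satisfying the Sigmoid Condition, and suppose Assumptions 1, 2, 3 and 4 hold. Fix $\alpha\in(0,1)$ and let $\widehat{\mathrm{CI}}_\alpha$ be the interval $\hat\tau\pm\Phi^{-1}(1-\alpha/2)\sqrt{\widehat{\mathrm{VB}}}$, where $\Phi^{-1}$ is the quantile function of the standard normal distribution. Then $$\liminf_{T\to\infty}\Pr\big(\tau\in\widehat{\mathrm{CI}}_\alpha\big)\ge1-\alpha.$$
   Context: **Triangular array.** For each $T\in\mathbb N$ there are deterministic data: covariates $x_t\in\mathbb R^d$ and potential outcomes $y_t(1),y_t(0)\in\mathbb R$, $t\in[T]=\{1,\dots,T\}$ (all quantities, including $d$, may depend on $T$; the superscript $(T)$ is suppressed). The constants $c_0,c_1,c_2,c_3,\gamma_0$ below do not depend on $T$. Limits are as $T\to\infty$. **Setting.** $\tau=\frac1T\sum_{t=1}^T(y_t(1)-y_t(0))$. In round $t$ a random treatment $Z_t\in\{0,1\}$ is assigned and $Y_t=y_t(Z_t)$ is observed; treatment assignment is the only randomness. $\mathcal F_t=\sigma(Z_1,\dots,Z_t)$; the design selects $p_t=\Pr(Z_t=1\mid\mathcal F_{t-1})$ and linear predictors $\beta_t(1),\beta_t(0)\in\mathbb R^d$ from the past. The adaptive AIPW estimator is $$\hat\tau=\frac1T\sum_{t=1}^T\Big\{\langle x_t,\beta_t(1)\rangle-\langle x_t,\beta_t(0)\rangle+\frac{\mathbf 1[Z_t=1]}{p_t}(Y_t-\langle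 x_t,\beta_t(1)\rangle)-\frac{\mathbf 1[Z_t=0]}{1-p_t}(Y_t-\langle x_t,\beta_t(0)\rangle)\Big\}.$$ **Residual quantities.** $\mathcal E(k)=\min_{\beta\in\mathbb R^d}\big(\frac1T\sum_{t=1}^T(y_t(k)-\langle x_t,\beta\rangle)^2\big)^{1/2}$ for $k\in\{0,1\}$, with $\beta_{\mathrm{OLS}}(k)$ a minimizer, and $$\rho=\frac{\frac1T\sum_{t=1}^T(y_t(1)-\langle x_t,\beta_{\mathrm{OLS}}(1)\rangle)(y_t(0)-\langle x_t,\beta_{\mathrm{OLS}}(0)\rangle)}{\mathcal E(1)\mathcal E(0)}.$$ **Variance bound estimator.** Let $X$ be the $T\times d$ matrix with rows $x_t^\top$ and $Q=I-X(X^\top X)^{-1}X^\top$ ($X^\top X$ is invertible for all $T\ge\gamma_0^2$ by Assumption 2; only such $T$ are considered). Define $$\widehat A(1)=\frac1T\sum_{t=1}^TQ_{t,t}Y_t^2\frac{\mathbf1[Z_t=1]}{p_t}+\frac1T\sum_{t=1}^T\sum_{s\ne t}Q_{t,s}Y_tY_s\frac{\mathbf1[Z_t=1,Z_s=1]}{p_tp_s},$$ $$\widehat A(0)=\frac1T\sum_{t=1}^TQ_{t,t}Y_t^2\frac{\mathbf1[Z_t=0]}{1-p_t}+\frac1T\sum_{t=1}^T\sum_{s\ne t}Q_{t,s}Y_tY_s\frac{\mathbf1[Z_t=0,Z_s=0]}{(1-p_t)(1-p_s)},$$ $\widehat{\mathcal E}(k)=\max(\widehat A(k),0)^{1/2}$,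 and $\widehat{\mathrm{VB}}=\frac4T\,\widehat{\mathcal E}(1)\widehat{\mathcal E}(0)$. **Assumption 1 ($0<c_0\le c_1$).** For both $k\in\{0,1\}$: $c_0\le\mathcal E(k)\le\big(\frac1T\sum_{t=1}^Ty_t(k)^4\big)^{1/4}\le c_1$. **Assumption 2 ($c_2,\gamma_0>0$).** For all $t\in[T]$ with $t\ge T^{1/2}\gamma_0$: $\sigma_{\min}\big(\frac1t\sum_{s\le t}x_sx_s^{\top}\big)\ge 1/c_2$. **Assumption 3 ($c_3>0$).** $R=\max_{t\in[T]}\|x_t\|\le c_3T^{1/4}$. **Assumption 4.** $\liminf_{T\to\infty}\rho>-1$. **Sigmoid Condition (constants $b_1,b_2,b_3>0$).** $\phi:\mathbb R\to(0,1)$ satisfies: (1) $\phi$ is strictly increasing, $\phi(u)+\phi(-u)=1$, $\lim_{u\to+\infty}\phi(u)=1$; (2) $u\mapsto1/\phi(u)$ and $u\mapsto1/(1-\phi(u))$ are convex; (3a) $-(1/\phi(u))'\le b_1$ for all $u\in\mathbb R$; (3b) $(1/\phi(u))''\le b_2(1+|u|)^{-3}$ for all $u\in\mathbb R$ except finitely many points; (3c) $(1/\phi(u))''\ge b_3(1+u)^{-3}$ for all $u\ge0$ except finitely many points. **Sigmoid-FTRL design.** Input: sigmoid $\phi$. Let $\psi(u)=\frac12u^2+|u|^3$ and $\Psi=\psi\circ\phi^{-1}:(0,1)\to[0,\infty)$; $R_0=1$. For $t=1,\dots,T$: observe $x_t$; set $R_t=\max(R_{t-1},\|x_t\|)$,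 $\eta_t=T^{-1/2}R_t^{-1}$; $\beta_t(1)=\arg\min_{\beta}\sum_{s<t}\big(Y_s\frac{\mathbf1[Z_s=1]}{p_s}-\langle x_s,\beta\rangle\big)^2+\eta_t^{-1}\|\beta\|^2$, $\ \beta_t(0)=\arg\min_{\beta}\sum_{s<t}\big(Y_s\frac{\mathbf1[Z_s=0]}{1-p_s}-\langle x_s,\beta\rangle\big)^2+\eta_t^{-1}\|\beta\|^2$; $\widehat A_{t-1}(1)=\sum_{s<t}\frac{\mathbf1[Z_s=1]}{p_s}(Y_s-\langle x_s,\beta_s(1)\rangle)^2$, $\ \widehat A_{t-1}(0)=\sum_{s<t}\frac{\mathbf1[Z_s=0]}{1-p_s}(Y_s-\langle x_s,\beta_s(0)\rangle)^2$ (these subscripted quantities are distinct from $\widehat A(1),\widehat A(0)$ above); $p_t=\arg\min_{p\in(0,1)}\frac{\widehat A_{t-1}(1)}p+\frac{\widehat A_{t-1}(0)}{1-p}+\eta_t^{-1}\Psi(p)$; then draw $Z_t=1$ with (conditional) probability $p_t$ and $Z_t=0$ otherwise, and observe $Y_t$. *)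

(* Defs.v *)
From HB Require Import structures.
From mathcomp Require Import all_boot all_order all_algebra.
From mathcomp Require Import all_classical all_reals all_analysis.

Set Implicit Arguments.
Unset Strict Implicit.
Unset Printing Implicit Defensive.

Import Order.TTheory GRing.Theory Num.Theory.
Import numFieldNormedType.Exports.

Local Open Scope classical_set_scope.
Local Open Scope ring_scope.

(** Conventions.  Rounds are indexed from 0, so round [t] of [1, ..., T] is
    index [t - 1]; an experiment of horizon [T] only uses indices [t < T].  The
    two arms are booleans, [true] for treatment and [false] for control.  A
    treatment path is a function [z : nat -> bool]. *)

Section Generic.
Context {R : realType}.

(** A minimizer of [f] over [A], arbitrary when there is none. *)
Definition argmin {U : pointedType} (A : set U) (f : U -> R) : U :=
  get [set u | A u /\ forall v, A v -> f u <= f v].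

Definition inner {d : nat} (u v : 'cV[R]_d) : R := \sum_(i < d) u i 0 * v i 0.

(** The Euclidean norm; the norm [`|u|] of the library is the sup norm. *)
Definition enorm {d : nat} (u : 'cV[R]_d) : R := Num.sqrt (inner u u).

(** The singular values of [A] are the nonnegative square roots of the
    eigenvalues of [A^T A].  For [0 < d] the infimum is a minimum. *)
Definition sigma_min {d : nat} (A : 'M[R]_d) : R :=
  inf [set s | 0 <= s /\ eigenvalue (A^T *m A) (s ^+ 2)].

Definition normal_quantile (q : R) : R :=
  inf [set r : R | (q%:E <= normal_prob 0 1 `]-oo, r])%E].

Definition sigmoid_condition (b1 b2 b3 : R) (phi : R -> R) : Prop :=
  let f := fun u => (phi u)^-1 in
  (forall u, 0 < phi u < 1) /\
  [/\ {homo phi : u v / u < v},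
      (forall u, phi u + phi (- u) = 1) &
      phi u @[u --> +oo] --> (1 : R)] /\
  (convex_function [set: R^o] f /\
   convex_function [set: R^o] (fun u => (1 - phi u)^-1)) /\
  [/\ (forall u, derivable f u 1 /\ - derive1 f u <= b1),
      (exists2 S : set R, finite_set S &
         forall u, ~ S u ->
           derivable (derive1 f) u 1 /\ derive1n 2 f u <= b2 / (1 + `|u|) ^+ 3) &
      (exists2 S : set R, finite_set S &
         forall u, 0 <= u -> ~ S u ->
           derivable (derive1 f) u 1 /\ b3 / (1 + u) ^+ 3 <= derive1n 2 f u)].

End Generic.

(** Quantities of one experiment with horizon [T], covariates [x t] and
    potential outcomes [y k t]. *)
Section Population.
Context {R : realType} (T : nat) {d : nat}.
Context (x : nat -> 'cV[R]_d) (y : bool -> nat -> R).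

Definition ate : R := T%:R^-1 * \sum_(t < T) (y true t - y false t).

Definition rmse (k : bool) (beta : 'cV[R]_d) : R :=
  Num.sqrt (T%:R^-1 * \sum_(t < T) (y k t - inner (x t) beta) ^+ 2).

Definition beta_ols (k : bool) : 'cV[R]_d := argmin setT (rmse k).

(** The infimum is attained, at [beta_ols k]. *)
Definition resid (k : bool) : R := inf (range (rmse k)).

Definition rho : R :=
  T%:R^-1 * (\sum_(t < T) (y true t - inner (x t) (beta_ols true)) *
                          (y false t - inner (x t) (beta_ols false)))
  / (resid true * resid false).

Definition assumption1 (c0 c1 : R) : Prop :=
  forall k : bool,
    c0 <= resid k
       <= (T%:R^-1 * \sum_(t < T) y k t ^+ 4) `^ (4%:R^-1) /\
    (T%:R^-1 * \sum_(t < T) y k t ^+ 4) `^ (4%:R^-1) <= c1.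

(** Here [n] is a number of rounds, i.e. a 1-based time index. *)
Definition assumption2 (c2 gamma0 : R) : Prop :=
  forall n : nat, (0 < n <= T)%N -> Num.sqrt T%:R * gamma0 <= n%:R ->
    1 / c2 <= sigma_min (n%:R^-1 *: \sum_(s < n) (x s *m (x s)^T)).

Definition assumption3 (c3 : R) : Prop :=
  \big[Num.max/0]_(t < T) enorm (x t) <= c3 * T%:R `^ (4%:R^-1).

Definition design_mx : 'M[R]_(T, d) := \matrix_(t < T, j < d) x t j 0.

Definition resid_mx : 'M[R]_T :=
  1%:M - design_mx *m invmx (design_mx^T *m design_mx) *m design_mx^T.

End Population.

Section Estimators.
Context {R : realType} (T : nat) {d : nat}.
Context (x : nat -> 'cV[R]_d) (y : bool -> nat -> R).

(** The treatment path, the treatment probabilities [p t] and the linear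
    predictors [beta k t]. *)
Context (z : nat -> bool) (p : nat -> R) (beta : bool -> nat -> 'cV[R]_d).

Definition observed (t : nat) : R := y (z t) t.

(** [1[Z_t = 1] / p_t] for [k = true], [1[Z_t = 0] / (1 - p_t)] for
    [k = false]. *)
Definition ipw (k : bool) (t : nat) : R :=
  (z t == k)%:R / (if k then p t else 1 - p t).

Definition aipw : R :=
  T%:R^-1 * \sum_(t < T)
    (inner (x t) (beta true t) - inner (x t) (beta false t)
     + ipw true t * (observed t - inner (x t) (beta true t))
     - ipw false t * (observed t - inner (x t) (beta false t))).

Definition Ahat (k : bool) : R :=
  T%:R^-1 * (\sum_(t < T) resid_mx T x t t * observed t ^+ 2 * ipw k t)
  + T%:R^-1 * (\sum_(t < T) \sum_(s < T | s != t)
      resid_mx T x t s * observed t * observed s * (ipw k t * ipw k s)).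

Definition resid_hat (k : bool) : R := Num.sqrt (Num.max (Ahat k) 0).

Definition VB_hat : R := 4%:R / T%:R * (resid_hat true * resid_hat false).

Definition CI (alpha : R) : set R :=
  let w := normal_quantile (1 - alpha / 2%:R) * Num.sqrt VB_hat in
  `[aipw - w, aipw + w].

End Estimators.

Section SigmoidFTRL.
Context {R : realType} (T : nat) {d : nat} (phi : R -> R).
Context (x : nat -> 'cV[R]_d) (y : bool -> nat -> R).

(** The minimizers of [ridge] and [ftrl_step] below exist and are unique: the
    objectives are strictly convex (for [ftrl_step], as functions of [u] with
    [q = phi u]) and coercive. *)

Definition psi (u : R) : R := 2%:R^-1 * u ^+ 2 + `|u| ^+ 3.

Definition Psi (q : R) : R := psi ('pinv_(fun=> 0) [set: R] phi q).

(** [radius] and [eta] are indexed as [R_0 = 1, R_1, ...] and [eta_1, ...], so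
    the design uses [eta t.+1] in the round with index [t]. *)
Fixpoint radius (t : nat) : R :=
  if t is t'.+1 then Num.max (radius t') (enorm (x t')) else 1.

Definition eta (t : nat) : R := (Num.sqrt T%:R)^-1 * (radius t)^-1.

(** The quantities of round [t] as functions of the path [z] and of the
    treatment probabilities [p]; only rounds [s < t] matter. *)
Definition ridge (z : nat -> bool) (p : nat -> R) (k : bool) (t : nat) :
    'cV[R]_d :=
  argmin setT (fun beta : 'cV[R]_d =>
    (\sum_(s < t) (observed y z s * ipw z p k s - inner (x s) beta) ^+ 2)
    + (eta t.+1)^-1 * enorm beta ^+ 2).

Definition cum_loss (z : nat -> bool) (p : nat -> R) (k : bool) (t : nat) :
    R :=
  \sum_(s < t) ipw z p k s *
    (observed y z s - inner (x s) (ridge z p k s)) ^+ 2.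

Definition ftrl_step (z : nat -> bool) (p : nat -> R) (t : nat) : R :=
  argmin [set q : R | 0 < q < 1] (fun q : R =>
    cum_loss z p true t / q + cum_loss z p false t / (1 - q)
    + (eta t.+1)^-1 * Psi q).

(** The probabilities of the first [t] rounds along the path [z]. *)
Fixpoint ftrl_history (z : nat -> bool) (t : nat) : seq R :=
  if t is t'.+1 then
    let h := ftrl_history z t' in rcons h (ftrl_step z (nth 0 h) t')
  else [::].

Definition ftrl_prob (z : nat -> bool) (t : nat) : R :=
  ftrl_step z (nth 0 (ftrl_history z t)) t.

Definition ftrl_beta (z : nat -> bool) (k : bool) (t : nat) : 'cV[R]_d :=
  ridge z (ftrl_prob z) k t.

Definition ftrl_CI (alpha : R) (z : nat -> bool) : set R :=
  CI T x y z (ftrl_prob z) (ftrl_beta z) alpha.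

End SigmoidFTRL.

Section Randomization.
Context {R : realType} {disp : measure_display} {Omega : measurableType disp}.
Context (P : probability Omega R) (Z : nat -> {RV P >-> bool}).

(** The sigma-algebra generated by the treatments of the rounds [s < t]. *)
Definition past (t : nat) : set (set Omega) :=
  <<s \bigcup_(s in `I_t)
        preimage_set_system [set: Omega] (Z s) [set: set bool] >>.

(** [p (Z_0, Z_1, ...) t] is a version of [P(Z_t = 1 | past t)] for [t < T]. *)
Definition assigned_with (T : nat) (p : (nat -> bool) -> nat -> R) : Prop :=
  forall (t : nat) (A : set Omega), (t < T)%N -> past t A ->
    P (A `&` [set w | Z t w]) =
    (\int[P]_(w in A) (p (fun s => Z s w) t)%:E)%E.

End Randomization.

(* Main.v *)
Require Import Defs.
From HB Require Import structures.
From mathcomp Require Import all_boot all_order all_algebra.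
From mathcomp Require Import all_classical all_reals all_analysis.
From mathcomp Require Import ring lra.

Set Implicit Arguments.
Unset Strict Implicit.
Unset Printing Implicit Defensive.

Import Order.TTheory GRing.Theory Num.Theory.
Import numFieldNormedType.Exports.

Local Open Scope classical_set_scope.
Local Open Scope ring_scope.

(** Idea.  The estimation error is a martingale: [T (aipw - ate)] is the sum of
    [(Z_t - p_t) w_t] with [w_t = u_t(1) / p_t + u_t(0) / (1 - p_t)], where
    [u_t(k)] is the residual of the online ridge predictor.  Ridge regression is
    linear in the response, so [u_t(k)] is a deterministic residual minus a
    prediction of pure noise, and the latter has small energy because it is paid
    for by the leverages.  Upper and lower regret bounds for ridge regression and
    for FTRL show that the sum of [u_t(1)^2 / p_t + u_t(0)^2 / (1 - p_t)] is
    [(sqrt S_1 + sqrt S_0)^2 + o(T)] in L^1, where [S_k] is the residual sum of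
    squares of the least squares fit of [y(k)].  Hence the conditional variance of
    the error times [T] concentrates at [((sqrt S_1 + sqrt S_0)^2 - S) / T], with
    [S] the residual sum of squares of [y(1) - y(0)]; by the triangle inequality
    [sqrt S >= |sqrt S_1 - sqrt S_0|] this is at most [4 sqrt (S_1 S_0) / T], which
    is the limit of [T VB].  A central limit theorem, obtained by evolving the
    distribution function of the absolute value by the heat equation along the
    conditional variance, concludes. *)

(** * Expectation over treatment paths *)

(** The inverse treatment probabilities are not bounded in advance, so expectations are taken under
    a clipped design, whose logits are at most [q ^+ 33] where [T = q ^+ 192]. This exponent is a
    compromise. The cubic regularizer, of weight at least [q ^+ 96], confines the cube of a logit of
    the original design to the total loss over [q ^+ 96]; the loss has mean of order [q ^+ 192], so
    [q ^+ 32] is typical, and one more power of [q] makes clipping unlikely. Conversely, the clipped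
    inverse probabilities multiply the noise energy [q ^+ 121] twice, and 121 + 33 + 33 = 187 must
    stay below 192. Logarithms of [T] cost one power of [q]. The conditional variance need not
    converge along the array, so the central limit theorem is a bound at a fixed horizon, with a
    constant independent of the design. Treatment paths up to the horizon are finite in number:
    expectations are finite sums, and the given probability spaces intervene once, to identify the
    law of the paths. *)

Section PathExpectation.
Context {R : realType}.
Implicit Types (z : nat -> bool) (g : (nat -> bool) -> R).

Definition upd z n b : nat -> bool := fun s => if s == n then b else z s.

(** Measurability with respect to the first [n] treatments; since paths are total functions, the
    values from round [n] on are mere padding. *)
Definition adapted {U : Type} (n : nat) (g : (nat -> bool) -> U) :=
  forall z z', (forall s, (s < n)%N -> z s = z' s) -> g z = g z'.

Lemma adaptedW U m n (g : (nat -> bool) -> U) :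
  (m <= n)%N -> adapted m g -> adapted n g.
Proof.
by move=> mn ag z z' zz'; apply: ag => s sm; apply: zz'; exact: leq_trans mn.
Qed.

Lemma adapted_upd U n (g : (nat -> bool) -> U) z b :
  adapted n g -> g (upd z n b) = g z.
Proof. by move=> ag; apply: ag => s sn; rewrite /upd ltn_eqF. Qed.

Lemma updE z n b : upd z n b n = b.
Proof. by rewrite /upd eqxx. Qed.

Section Expectation.
Variable p : (nat -> bool) -> nat -> R.

Definition cexp (n : nat) g z : R :=
  p z n * g (upd z n true) + (1 - p z n) * g (upd z n false).

(** The tower property serves as definition: the last treatment is averaged out first, and [g] is
    read on paths padded with [false] from round [n] on. *)
Fixpoint pexp (n : nat) g : R :=
  if n is n'.+1 then pexp n' (cexp n' g) else g (fun=> false).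

Lemma cexpD n g g' : cexp n (fun z => g z + g' z) = fun z => cexp n g z + cexp n g' z.
Proof. by apply/funext => z; rewrite /cexp; ring. Qed.

Lemma cexpZ n (a : R) g : cexp n (fun z => a * g z) = fun z => a * cexp n g z.
Proof. by apply/funext => z; rewrite /cexp; ring. Qed.

Lemma pexpD n g g' : pexp n (fun z => g z + g' z) = pexp n g + pexp n g'.
Proof. by elim: n g g' => //= n IH g g'; rewrite cexpD IH. Qed.

Lemma pexpZ n (a : R) g : pexp n (fun z => a * g z) = a * pexp n g.
Proof. by elim: n g => //= n IH g; rewrite cexpZ IH. Qed.

Lemma pexpB n g g' : pexp n (fun z => g z - g' z) = pexp n g - pexp n g'.
Proof.
rewrite -[- pexp n g']mulN1r -pexpZ -pexpD; congr pexp.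
by apply/funext => z; rewrite mulN1r.
Qed.

Lemma pexp_cst n (a : R) : pexp n (fun=> a) = a.
Proof.
elim: n => //= n IH; rewrite -[RHS]IH; congr pexp; apply/funext => z.
by rewrite /cexp; ring.
Qed.

Lemma pexp_sum (I : Type) (r : seq I) (Q : pred I) n (G : I -> (nat -> bool) -> R) :
  pexp n (fun z => \sum_(i <- r | Q i) G i z) = \sum_(i <- r | Q i) pexp n (G i).
Proof.
elim: r => [|i r IH].
  rewrite big_nil -[RHS](pexp_cst n); congr pexp; apply/funext => z.
  by rewrite big_nil.
rewrite big_cons -IH; case: ifP => Qi; last first.
  by congr pexp; apply/funext => z; rewrite big_cons Qi.
by rewrite -pexpD; congr pexp; apply/funext => z; rewrite big_cons Qi.
Qed.

Lemma cexp_adapted n g : adapted n g -> cexp n g = g.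
Proof.
by move=> ag; apply/funext => z; rewrite /cexp !adapted_upd//; ring.
Qed.

Lemma pexp_adapted m n g : adapted m g -> (m <= n)%N -> pexp n g = pexp m g.
Proof.
move=> ag; elim: n => [|n IH]; first by rewrite leqn0 => /eqP ->.
rewrite leq_eqVlt => /predU1P[->//|]; rewrite ltnS => mn /=.
by rewrite cexp_adapted ?IH//; exact: adaptedW ag.
Qed.

Hypothesis pad : forall n, adapted n (p^~ n).

Lemma adapted_cexp n g : adapted n.+1 g -> adapted n (cexp n g).
Proof.
move=> ag z z' zz'; rewrite /cexp (pad zz') /=.
have E b : g (upd z n b) = g (upd z' n b).
  apply: ag => s; rewrite ltnS leq_eqVlt /upd => /predU1P[->|sn].
    by rewrite eqxx.
  by rewrite ltn_eqF// zz'.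
by rewrite !E.
Qed.

Lemma pexp_cexp m n g : adapted m.+1 g -> (m < n)%N ->
  pexp n g = pexp n (cexp m g).
Proof.
move=> ag mn; rewrite (pexp_adapted ag)//=; symmetry.
by apply: pexp_adapted; [exact: adapted_cexp|exact: ltnW].
Qed.

Hypothesis p01 : forall z n, 0 <= p z n <= 1.

Lemma cexp_le n g g' : (forall z, g z <= g' z) -> forall z, cexp n g z <= cexp n g' z.
Proof.
move=> gg' z; rewrite /cexp; have /andP[p0 p1] := p01 z n.
by apply: lerD; apply: ler_wpM2l => //; rewrite subr_ge0.
Qed.

Lemma pexp_le n g g' : (forall z, g z <= g' z) -> pexp n g <= pexp n g'.
Proof. by elim: n g g' => //= n IH g g' gg'; apply: IH; exact: cexp_le. Qed.

Lemma pexp_ge0 n g : (forall z, 0 <= g z) -> 0 <= pexp n g.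
Proof. by move=> g0; rewrite -(pexp_cst n 0); exact: pexp_le. Qed.

Definition pprob n (B : (nat -> bool) -> bool) : R := pexp n (fun z => (B z)%:R).

Lemma pprob_le n (B B' : (nat -> bool) -> bool) :
  (forall z, B z -> B' z) -> pprob n B <= pprob n B'.
Proof.
move=> BB'; apply: pexp_le => z; rewrite ler_nat.
by case Bz: (B z) => //; rewrite (BB' _ Bz).
Qed.

Lemma pprobU n (B B' : (nat -> bool) -> bool) :
  pprob n (fun z => B z || B' z) <= pprob n B + pprob n B'.
Proof.
rewrite -pexpD; apply: pexp_le => z; rewrite -natrD ler_nat.
by case: (B z); case: (B' z).
Qed.

Lemma markov_pexp n g (a b : R) : 0 < a -> (forall z, 0 <= g z) ->
  pexp n g <= b -> pprob n (fun z => a < g z) <= b / a.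
Proof.
move=> a0 g0 gb; rewrite ler_pdivlMr// mulrC -pexpZ; apply: le_trans gb.
apply: pexp_le => z; case: ltP => [/ltW|_]; first by rewrite mulr1.
by rewrite mulr0.
Qed.

Lemma chebyshev_pexp n g (a b : R) : 0 < a ->
  pexp n (fun z => g z ^+ 2) <= b -> pprob n (fun z => a < `|g z|) <= b / a ^+ 2.
Proof.
move=> a0 gb; have a20 : 0 < a ^+ 2 by rewrite exprn_gt0.
have := markov_pexp a20 (fun z => sqr_ge0 (g z)) gb.
apply: le_trans; apply: pprob_le => z az.
by rewrite -(real_normK (num_real (g z))) ltr_pXn2r// nnegrE ltW.
Qed.

(** Orthogonality of martingale differences: the product of the past sum with the last difference
    vanishes once the last treatment is averaged out. *)
Lemma pexp_mds n (g : nat -> (nat -> bool) -> R) :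
  (forall t, adapted t.+1 (g t)) -> (forall t z, cexp t (g t) z = 0) ->
  pexp n (fun z => (\sum_(t < n) g t z) ^+ 2) = \sum_(t < n) pexp n (fun z => g t z ^+ 2).
Proof.
move=> ag g0; elim: n => [|n IH].
  by rewrite !big_ord0 /= big_ord0 expr0n.
have sa : adapted n (fun z => \sum_(t < n) g t z).
  move=> z z' zz'; apply: eq_bigr => t _; apply: ag => s st; apply: zz'.
  by rewrite (leq_trans st).
have -> : (fun z => (\sum_(t < n.+1) g t z) ^+ 2) =
  (fun z => (\sum_(t < n) g t z) ^+ 2 + (2 * ((\sum_(t < n) g t z) * g n z) + g n z ^+ 2)).
  by apply/funext => z; rewrite big_ord_recr /=; ring.
rewrite !pexpD pexpZ big_ord_recr /= addrA; congr (_ + _).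
have -> : cexp n (fun z => (\sum_(t < n) g t z) * g n z) = fun=> 0.
  apply/funext => z; rewrite /cexp !(adapted_upd _ _ sa).
  by rewrite -[RHS](mulr0 (\sum_(t < n) g t z)) -(g0 n z) /cexp; ring.
rewrite pexp_cst mulr0 addr0 -/(pexp n.+1 _).
rewrite cexp_adapted; last by move=> z z' zz'; rewrite (sa z z').
rewrite IH; apply: eq_bigr => t _; rewrite cexp_adapted//.
by move=> z z' zz'; congr (_ ^+ 2); apply: ag => s st; apply: zz'; rewrite (leq_trans st).
Qed.

End Expectation.

(** Carries an event from the clipped design to the original one. Where the probabilities of the
    last round differ, both continuations are paths of disagreement, so [g] is zero on both and the
    one-step averages coincide. *)
Lemma pexp_coupling (p p' : (nat -> bool) -> nat -> R) n g :
  (forall m, adapted m (p^~ m)) -> (forall m, adapted m (p'^~ m)) ->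
  (forall z, (exists2 t, (t < n)%N & p z t != p' z t) -> g z = 0) ->
  pexp p n g = pexp p' n g.
Proof.
move=> pa pa'; elim: n g => //= n IH g g0.
have E : cexp p n g = cexp p' n g.
  apply/funext => z; rewrite /cexp; have [->//|ne] := eqVneq (p z n) (p' z n).
  rewrite !g0 ?mulr0//; exists n => //.
    by rewrite (adapted_upd _ _ (pa n)) (adapted_upd _ _ (pa' n)).
  by rewrite (adapted_upd _ _ (pa n)) (adapted_upd _ _ (pa' n)).
rewrite -E; apply: IH => z [t tn ne]; rewrite /cexp !g0 ?mulr0 ?addr0//.
  exists t; first exact: ltnW.
  by rewrite (adapted_upd _ _ (adaptedW (ltnW tn) (pa t)))
             (adapted_upd _ _ (adaptedW (ltnW tn) (pa' t))).
exists t; first exact: ltnW.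
by rewrite (adapted_upd _ _ (adaptedW (ltnW tn) (pa t)))
           (adapted_upd _ _ (adaptedW (ltnW tn) (pa' t))).
Qed.

Fixpoint paths (n : nat) : seq (nat -> bool) :=
  if n is n'.+1 then
    [seq upd c n' true | c <- paths n'] ++ [seq upd c n' false | c <- paths n']
  else [:: fun=> false].

Fixpoint path_weight (p : (nat -> bool) -> nat -> R) (n : nat) z : R :=
  if n is n'.+1 then
    path_weight p n' z * (if z n' then p z n' else 1 - p z n')
  else 1.

Lemma adapted_path_weight (p : (nat -> bool) -> nat -> R) n :
  (forall m, adapted m (p^~ m)) -> adapted n (path_weight p n).
Proof.
move=> pa; elim: n => //= n IH z z' zz'.
have zz1 s : (s < n)%N -> z s = z' s by move=> sn; apply: zz'; exact: ltnW.
by rewrite (IH _ _ zz1) zz'// (pa n _ _ zz1).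
Qed.

Lemma pexp_paths (p : (nat -> bool) -> nat -> R) n g :
  (forall m, adapted m (p^~ m)) ->
  pexp p n g = \sum_(c <- paths n) path_weight p n c * g c.
Proof.
move=> pa; elim: n g => [|n IH] g /=; first by rewrite big_seq1 mul1r.
rewrite IH big_cat /= !big_map -big_split /=; apply: eq_bigr => c _.
rewrite !updE !(adapted_upd _ _ (adapted_path_weight pa)).
by rewrite !(adapted_upd _ _ (pa n)) /cexp; ring.
Qed.

(** * The law of the treatments *)

Section Law.
Context {disp : measure_display} {Omega : measurableType disp}.
Context (P : probability Omega R) (Z : nat -> {RV P >-> bool}).
Context (n : nat) (p : (nat -> bool) -> nat -> R).
Hypothesis pa : forall m, adapted m (p^~ m).
Hypothesis hZ : assigned_with Z n p.

Definition path_atom m z : set Omega := [set w | forall s, (s < m)%N -> Z s w = z s].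

Let atomS m z : path_atom m.+1 z = path_atom m z `&` (Z m @^-1` [set z m]).
Proof.
apply/seteqP; split => w /= h; first by split => [s sm|]; apply: h => //; exact: ltnW.
by move=> s; rewrite ltnS leq_eqVlt => /predU1P[->|]; [exact: h.2|exact: h.1].
Qed.

Let mZ m b : measurable (Z m @^-1` [set b]).
Proof. exact: measurable_funPTI. Qed.

Let matom m z : measurable (path_atom m z).
Proof.
elim: m => [|m IH].
  by rewrite (_ : path_atom 0 z = setT)//; apply/seteqP; split.
by rewrite atomS; exact: measurableI.
Qed.

Let past_atom m z : past Z m (path_atom m z).
Proof.
suff : forall k, (k <= m)%N -> past Z m (path_atom k z) by apply.
elim=> [_|k IH km].
  rewrite (_ : path_atom 0 z = setT); last by apply/seteqP; split.
  by rewrite -setC0; apply: sigma_algebraC; exact: sigma_algebra0.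
rewrite atomS -(setCK (_ `&` _)); apply: sigma_algebraC; rewrite setCI.
(* An intersection is the complement of a union of complements; the countable union repeats the
   second set at every index other than 0. *)
have -> : ~` path_atom k z `|` ~` (Z k @^-1` [set z k]) =
  \bigcup_i (if i == 0%N then ~` path_atom k z else ~` (Z k @^-1` [set z k])).
  apply/seteqP; split => w; first by case=> h; [exists 0%N|exists 1%N].
  by case=> i _; case: ifP => _; [left|right].
apply: sigma_algebra_bigcup => i; case: ifP => _.
  by apply: sigma_algebraC; apply: IH; exact: ltnW.
apply: sigma_algebraC; apply: sub_sigma_algebra.
by exists k => //=; exists [set z k] => //; rewrite setTI.
Qed.

(** Since [p] is adapted, the conditional probability is constant on an atom of the past, and the
    integral that defines it factors. *)
Let prob_atom m z : (m <= n)%N -> P (path_atom m z) = (path_weight p m z)%:E.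
Proof.
elim: m => [_|m IH mn].
  rewrite (_ : path_atom 0 z = setT); last by apply/seteqP; split.
  by rewrite probability_setT.
have PT : P (path_atom m z `&` [set w | Z m w]) = (path_weight p m z * p z m)%:E.
  rewrite hZ//.
  under eq_integral => w wA.
    rewrite (_ : p (fun s => Z s w) m = p z m); last first.
      by move: wA; rewrite inE => wA; apply: pa => s sm; exact: wA.
    over.
  by rewrite integral_cst//= IH ?(ltnW mn)// -EFinM mulrC.
rewrite atomS /=; case zm : (z m).
  by rewrite (_ : _ @^-1` _ = [set w | Z m w])//; apply/seteqP; split.
have -> : Z m @^-1` [set false] = ~` [set w | Z m w].
  by apply/seteqP; split => w /=; case: (Z m w).
have mT : measurable [set w | Z m w].
  by rewrite (_ : [set w | Z m w] = Z m @^-1` [set true])//; apply/seteqP; split.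
rewrite -setDE measureD//; last by rewrite (le_lt_trans (probability_le1 _ _)) ?ltry.
rewrite [X in (_ - X)%E]PT [X in (X - _)%E](IH (ltnW mn)) -EFinB.
by congr (_%:E); ring.
Qed.

Let event (B : (nat -> bool) -> bool) := [set w | B (Z^~ w)].

Let mevent_atom B m z : (m <= n)%N -> adapted m B ->
  event B `&` path_atom m z = if B z then path_atom m z else set0.
Proof.
move=> mn aB; apply/seteqP; split => w /=.
  by case=> Bw wz; rewrite -(aB _ _ wz) Bw.
case: ifP => // Bz wz; split => //.
by rewrite /event /= (aB _ _ wz).
Qed.

(** The passage from the probability space to finite sums. An event read off the first [n]
    treatments is a finite union of atoms; this gives first its measurability, then its
    probability. *)
Lemma law_pprob (B : (nat -> bool) -> bool) : adapted n B ->
  P [set w | B (fun t => Z t w)] = (pprob p n B)%:E.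
Proof.
move=> aB; rewrite /pprob pexp_paths//.
have cov : forall m, (m <= n)%N ->
    event B = \big[setU/set0]_(c <- paths m) (event B `&` path_atom m c).
  elim=> [_|m IH mn].
    by rewrite /= big_seq1 (_ : path_atom 0 _ = setT) ?setIT//; apply/seteqP; split.
  rewrite {1}(IH (ltnW mn)) /= big_cat /= !big_map -big_split /=.
  apply: eq_bigr => c _; rewrite !atomS !updE.
  have aE b : path_atom m (upd c m b) = path_atom m c.
    by apply/seteqP; split => w /= h s sm; rewrite h// /upd ltn_eqF.
  rewrite !aE; apply/seteqP; split => w /=.
    by move=> [Bw wc]; case: (Z m w) (erefl (Z m w)) => e; [left|right].
  by case=> -[Bw [wc _]].
have add : forall m (A : set Omega), (m <= n)%N -> measurable A ->
    P A = (\sum_(c <- paths m) P (A `&` path_atom m c))%E.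
  elim=> [|m IH] A mn mA.
    by rewrite /= big_seq1 (_ : path_atom 0 _ = setT) ?setIT//; apply/seteqP; split.
  rewrite (IH _ (ltnW mn) mA) /= big_cat /= !big_map -big_split /=.
  apply: eq_bigr => c _; rewrite !atomS !updE.
  have aE b : path_atom m (upd c m b) = path_atom m c.
    by apply/seteqP; split => w /= h s sm; rewrite h// /upd ltn_eqF.
  rewrite !aE -measureU//; first 1 last.
  - by do 2 apply: measurableI => //.
  - by do 2 apply: measurableI => //.
  - by apply/seteqP; split => w //= -[[_ [_ h1]] [_ [_ h2]]]; move: h1; rewrite h2.
  congr (P _); apply/seteqP; split => w /=.
    by move=> [Bw wc]; case: (Z m w) (erefl (Z m w)) => e; [left|right].
  by case=> -[Bw [wc _]].
have mB : measurable (event B).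
  rewrite (cov n (leqnn n)); apply: bigsetU_measurable => c _.
  by rewrite mevent_atom//; case: ifP.
rewrite -[X in P X]/(event B) (add n)// -sumEFin; apply: eq_bigr => c _.
rewrite mevent_atom//; case: ifP => _; first by rewrite prob_atom// mulr1.
by rewrite measure0 mulr0.
Qed.

End Law.
End PathExpectation.

(** * Calculus and the normal distribution function *)

Section Calculus.
Context {R : realType}.
Implicit Types (f df ddf : R -> R).

(** The interval spanned by [a] and [b] in either order, so that expansions apply to increments of
    both signs. *)
Definition between (a b x : R) := Num.min a b <= x <= Num.max a b.

Lemma between_dist a b x : between a b x -> `|x - a| <= `|b - a|.
Proof.
rewrite /between => /andP[]; case: (lerP a b) => ab h1 h2.
  by rewrite !ger0_norm; lra.
by rewrite !ler0_norm; lra.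
Qed.

Lemma between_trans a b x y : between a b x -> between a x y -> between a b y.
Proof.
rewrite /between; case: (lerP a b) => ab; case: (lerP a x) => ax; lra.
Qed.

Lemma betweenl a b : between a b a.
Proof. by rewrite /between; case: (lerP a b) => ab; lra. Qed.

Lemma is_derive_continuous f (x l : R) : is_derive x 1 f l -> {for x, continuous f}.
Proof.
by move=> h; apply: differentiable_continuous; apply/derivable1_diffP; case: h.
Qed.

Lemma mean_value_le f df (a b C : R) :
  (forall x, between a b x -> is_derive x 1 f (df x)) ->
  (forall x, between a b x -> `|df x| <= C) ->
  `|f b - f a| <= C * `|b - a|.
Proof.
have main (u v : R) : u <= v -> (forall x : R, u <= x <= v -> is_derive x 1 f (df x)) ->
  (forall x : R, u <= x <= v -> `|df x| <= C) -> `|f v - f u| <= C * `|v - u|.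
  move=> uv fd dC.
  have [||c cin ->] := @MVT_segment R f df u v uv.
  - by move=> x; rewrite in_itv /= => /andP[ux xv]; apply: fd; rewrite !ltW.
  - apply: continuous_in_subspaceT => x; rewrite inE /= in_itv /= => xuv.
    exact: is_derive_continuous (fd x xuv).
  by move: cin; rewrite in_itv /= => cuv; rewrite normrM ler_wpM2r// dC.
move=> fd dC; have [ab|/ltW ba] := leP a b.
  by apply: (main _ _ ab) => x xab; [apply: fd|apply: dC]; rewrite /between min_l// max_r.
rewrite (distrC (f b)) (distrC b).
by apply: (main _ _ ba) => x xab; [apply: fd|apply: dC]; rewrite /between min_r// max_l.
Qed.

(** The mean value inequality applied to [f] minus its linear part. This loses the factor 1/2 of the
    sharp remainder, which is harmless. *)
Lemma taylor1_le f df ddf (a b C : R) :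
  (forall x, between a b x -> is_derive x 1 f (df x)) ->
  (forall x, between a b x -> is_derive x 1 df (ddf x)) ->
  (forall x, between a b x -> `|ddf x| <= C) ->
  `|f b - f a - df a * (b - a)| <= C * (b - a) ^+ 2.
Proof.
move=> fd dfd dC.
have C0 : 0 <= C by apply: le_trans (dC a (betweenl _ _)).
pose g x := f x - df a * x.
have -> : f b - f a - df a * (b - a) = g b - g a by rewrite /g; ring.
rewrite -real_normK ?num_real// expr2 mulrA.
apply: (@mean_value_le g (fun x => df x - df a)) => x xab.
  have := fd x xab => h; rewrite /g.
  by apply: is_derive_eq; rewrite /= /GRing.scale /= ; ring.
apply: le_trans (_ : C * `|x - a| <= _); last first.
  by rewrite ler_wpM2l// between_dist.
apply: (@mean_value_le df ddf) => y yax; [apply: dfd|apply: dC];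
  exact: between_trans yax.
Qed.

Lemma taylor2_le f df ddf dddf (a b C : R) :
  (forall x, between a b x -> is_derive x 1 f (df x)) ->
  (forall x, between a b x -> is_derive x 1 df (ddf x)) ->
  (forall x, between a b x -> is_derive x 1 ddf (dddf x)) ->
  (forall x, between a b x -> `|dddf x| <= C) ->
  `|f b - f a - df a * (b - a) - ddf a * (b - a) ^+ 2 / 2| <= C * `|b - a| ^+ 3.
Proof.
move=> fd dfd ddfd dC.
have C0 : 0 <= C by apply: le_trans (dC a (betweenl _ _)).
pose g x := f x - df a * x - (ddf a / 2) * (x - a) ^+ 2.
have -> : f b - f a - df a * (b - a) - ddf a * (b - a) ^+ 2 / 2 = g b - g a.
  by rewrite /g; ring.
rewrite exprSr mulrA.
apply: (@mean_value_le g (fun x => df x - df a - ddf a * (x - a))) => x xab.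
  have := fd x xab => h; rewrite /g.
  by apply: is_derive_eq; rewrite /= /GRing.scale /= ; field.
apply: le_trans (_ : C * (x - a) ^+ 2 <= _); last first.
  rewrite ler_wpM2l// -real_normK ?num_real// ler_pXn2r ?nnegrE//.
  exact: between_dist.
apply: (@taylor1_le df ddf dddf) => y yax; [apply: dfd|apply: ddfd|apply: dC];
  exact: between_trans yax.
Qed.

End Calculus.

(** * The standard normal distribution function *)

Section NormalCdf.
Context {R : realType}.
Local Notation mu := lebesgue_measure.

Definition ncdf (r : R) : R := fine (normal_prob 0 1 `]-oo, r]).

Lemma ncdfE r : (ncdf r)%:E = normal_prob 0 1 `]-oo, r].
Proof. by rewrite /ncdf fineK//; exact: fin_num_measure. Qed.

Lemma ncdf_ge0 r : 0 <= ncdf r.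
Proof. by rewrite -lee_fin ncdfE. Qed.

Lemma ncdf_le1 r : ncdf r <= 1.
Proof. by rewrite -lee_fin ncdfE; exact: probability_le1. Qed.

Lemma ncdf_le r s : r <= s -> ncdf r <= ncdf s.
Proof.
move=> rs; rewrite -lee_fin !ncdfE; apply: le_measure; rewrite ?inE//.
exact: subitvPr.
Qed.

Lemma is_derive_ncdf (r : R) : is_derive r 1 ncdf (normal_pdf 0 1 r).
Proof.
have int y : mu.-integrable `]-oo, y] (fun x => (normal_pdf 0 1 x : R)%:E).
  by apply: integrableS (integrable_normal_pdf 0 1).
have [] := @continuous_FTC1 R (normal_pdf 0 1) -oo%O r (r + 1).
- by rewrite ltrDl.
- exact: int.
- by rewrite ltNyr.
- by apply: continuous_normal_pdf; rewrite oner_eq0.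
by move=> d1 d2; split; [exact: d1 | rewrite -derive1E; exact: d2].
Qed.

Lemma normal_pdf01E (x : R) :
  normal_pdf 0 1 x = normal_peak 1 * expR (- (x ^+ 2 / 2)).
Proof.
rewrite normal_pdfE ?oner_eq0// /normal_fun subr0 expr1n.
by congr (_ * expR _); rewrite mulNr.
Qed.

(** The identity as a random variable under the normal law: the limits of its distribution function
    become available. *)
Let idTR : measurableTypeR R -> R := idfun.

#[local] HB.instance Definition _ :=
  @isMeasurableFun.Build _ _ _ _ idTR (@measurable_id _ _ setT).

Let X : {RV (normal_prob (0:R) 1) >-> R} := idTR.

Let cdfE : cdf X = EFin \o ncdf.
Proof. by apply/funext => s /=; rewrite ncdfE. Qed.

Let ncdf_cvg1 : ncdf s @[s --> +oo] --> (1 : R).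
Proof.
by have := @cvg_cdfy1 _ _ _ _ X; rewrite cdfE; move/fine_cvgP => [].
Qed.

(** The density being even, [ncdf (- s) + ncdf s] has zero derivative; its constant value is read
    off at infinity. *)
Lemma ncdfN r : ncdf (- r) = 1 - ncdf r.
Proof.
pose g s := ncdf (- s) + ncdf s.
have gd (s : R) : is_derive s 1 g 0.
  have h1 := is_derive_ncdf s.
  have h2 := is_derive_ncdf (- s).
  have h3 : is_derive s 1 (ncdf \o -%R) (- normal_pdf 0 1 s).
    apply: (is_derive_eq (@is_derive1_comp R ncdf -%R s _ _ h2 (is_deriveNid s 1))).
    by rewrite !normal_pdf01E sqrrN mulrN1.
  have -> : g = (ncdf \o -%R) + ncdf by [].
  by apply: (is_derive_eq (is_deriveD h3 h1)); rewrite addNr.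
have gc (s s' : R) : g s = g s'.
  apply/eqP; rewrite -subr_eq0 -normr_le0.
  by have := @mean_value_le R g (fun=> 0) s' s 0; rewrite mul0r; apply => // x _; rewrite normr0.
have l0 : ncdf (- s) @[s --> +oo] --> (0 : R).
  have := @cvg_cdfNy0 _ _ _ _ X; rewrite cdfE => /fine_cvgP [_].
  by rewrite cvgNy_compNP.
have l : g s @[s --> +oo] --> (0 + 1 : R) by apply: cvgD.
have l' : g s @[s --> +oo] --> g r.
  by rewrite (_ : g = fun=> g r); [exact: cvg_cst|apply/funext => s; exact: gc].
have := cvg_unique _ l l'; rewrite add0r /g => ->//.
by rewrite addrK.
Qed.

Lemma ncdf_tail (e : R) : 0 < e -> exists2 r, 0 < r & ncdf (- r) < e.
Proof.
move=> e0; have /cvgrPdist_lt /(_ _ e0) [M [_ hM]] := ncdf_cvg1.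
exists (Num.max M 0 + 1); first by rewrite ltr_wpDl// le_max lexx orbT.
have /hM : M < Num.max M 0 + 1 by rewrite ltr_pwDr// le_max lexx.
by rewrite /= ncdfN; apply: le_lt_trans; exact: ler_norm.
Qed.

Lemma ncdf0 : ncdf 0 = 1 / 2.
Proof. by have := ncdfN 0; rewrite oppr0; lra. Qed.

(** The infimum belongs to the set by continuity: a value below [q] would persist on a
    neighbourhood, while points of the set come arbitrarily close. *)
Lemma normal_quantile_ge (q : R) : 0 < q < 1 -> q <= ncdf (normal_quantile q).
Proof.
move=> /andP[q0 q1].
pose A := [set r : R | (q%:E <= normal_prob 0 1 `]-oo, r])%E].
have AE r : A r = (q <= ncdf r) by rewrite /A /= -ncdfE lee_fin.
have q1' : 0 < 1 - q by rewrite subr_gt0.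
have [r r0 hr] := ncdf_tail q1'.
have A0 : A !=set0 by exists r; rewrite AE; move: hr; rewrite ncdfN; lra.
have [r' r'0 hr'] := ncdf_tail q0.
have Alb : has_lbound A.
  exists (- r') => s; rewrite AE => qs; rewrite leNgt; apply/negP => /ltW /ncdf_le.
  by lra.
rewrite leNgt; apply/negP => lt.
pose i := normal_quantile q.
have [d d0 hd] : exists2 d : R, 0 < d & forall s, `|i - s| < d -> ncdf s < q.
  have /cvgrPdist_lt /(_ (q - ncdf i)) := is_derive_continuous (is_derive_ncdf i).
  rewrite subr_gt0 => /(_ lt) [d d0 hd]; exists d => // s /hd.
  rewrite ltr_distlC => /andP[_]; lra.
have [s As sd] := inf_adherent d0 (conj A0 Alb).
have isle : i <= s by apply: ge_inf.
by move: As; rewrite AE leNgt hd// distrC ger0_norm ?subr_ge0// ltrBlDl.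
Qed.

Lemma normal_quantile_gt0 (q : R) : 1 / 2 < q < 1 -> 0 < normal_quantile q.
Proof.
move=> /andP[q2 q1]; rewrite ltNge; apply/negP => /ncdf_le; rewrite ncdf0.
have : q <= ncdf (normal_quantile q) by apply: normal_quantile_ge; lra.
lra.
Qed.

End NormalCdf.

(* Otherwise conversion tests between values of [ncdf] unfold the measure. *)
#[global] Opaque ncdf.

Section DeriveRules.
Context {R : realType}.
Implicit Types (f g : R -> R) (x df dg : R).

Lemma is_derive_mul f g x df dg : is_derive x 1 f df -> is_derive x 1 g dg ->
  is_derive x 1 (fun y => f y * g y) (f x * dg + g x * df).
Proof. exact: is_deriveM. Qed.

Lemma is_derive_scale (c : R) f x df : is_derive x 1 f df ->
  is_derive x 1 (fun y => c * f y) (c * df).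
Proof. exact: is_deriveZ. Qed.

Lemma is_derive_idfun (x : R) : is_derive x 1 (fun y : R => y) 1.
Proof. exact: is_derive_id. Qed.

Lemma is_derive_expR_comp f x df : is_derive x 1 f df ->
  is_derive x 1 (fun y => expR (f y)) (expR (f x) * df).
Proof. by move=> fl; exact: (@is_derive1_comp R expR f x). Qed.

Lemma is_derive_inv f x df : f x != 0 -> is_derive x 1 f df ->
  is_derive x 1 (fun y => (f y)^-1) (- f x ^- 2 * df).
Proof. by move=> f0 fd; exact: is_deriveV. Qed.

End DeriveRules.

(** * Gaussian smoothing and the heat equation *)

Section HeatKernel.
Context {R : realType}.
Implicit Types (v x : R).

(** The standard normal density at [x / sqrt v]. Then [hcdf v] is the distribution function of a
    centred normal variable of variance [v], and suffixes record partial derivatives; the first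
    derivative in [v] is [hcdf_xx / 2]. *)
Definition gauss_at v x : R := normal_peak 1 * expR (- (x ^+ 2 / (2 * v))).
Definition hcdf v x : R := ncdf (x / Num.sqrt v).
Definition hcdf_x v x : R := gauss_at v x / Num.sqrt v.
Definition hcdf_xx v x : R := - (x / (v * Num.sqrt v)) * gauss_at v x.
Definition hcdf_xxx v x : R := (x ^+ 2 / v - 1) / (v * Num.sqrt v) * gauss_at v x.
Definition hcdf_vv v x : R :=
  x / (v ^+ 2 * Num.sqrt v) * (3 / 4 - x ^+ 2 / (4 * v)) * gauss_at v x.

Lemma sqrt_neq0 v : 0 < v -> Num.sqrt v != 0.
Proof. by move=> v0; rewrite gt_eqF// sqrtr_gt0. Qed.

Lemma is_derive_gauss_at_x v x : 0 < v ->
  is_derive x 1 (gauss_at v) (- (x / v) * gauss_at v x).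
Proof.
move=> v0; rewrite /gauss_at.
have h := is_derive_mul (is_derive_idfun x) (is_derive_idfun x).
have := is_derive_scale (normal_peak 1)
  (is_derive_expR_comp (is_derive_scale (- (2 * v)^-1) h)).
have -> : (fun y : R => normal_peak 1 * expR (- (2 * v)^-1 * (y * y))) =
          (fun y => normal_peak 1 * expR (- (y ^+ 2 / (2 * v)))).
  by apply/funext => y; congr (_ * expR _); ring.
move=> d; apply: (is_derive_eq d).
have -> : - (2 * v)^-1 * (x * x) = - (x ^+ 2 / (2 * v)) by ring.
by field; rewrite gt_eqF.
Qed.

Lemma is_derive_gauss_at_v v x : 0 < v ->
  is_derive v 1 (gauss_at^~ x) (x ^+ 2 / (2 * v ^+ 2) * gauss_at v x).
Proof.
move=> v0; rewrite /gauss_at.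
have v1 : v != 0 by rewrite gt_eqF.
have := is_derive_scale (normal_peak 1) (is_derive_expR_comp
  (is_derive_scale (- (x ^+ 2 / 2)) (is_derive_inv v1 (is_derive_idfun v)))).
have -> : (fun y : R => normal_peak 1 * expR (- (x ^+ 2 / 2) * y^-1)) =
          (fun y => normal_peak 1 * expR (- (x ^+ 2 / (2 * y)))).
  by apply/funext => y; congr (_ * expR _); rewrite invfM; ring.
move=> d; apply: (is_derive_eq d).
have -> : - (x ^+ 2 / 2) * v^-1 = - (x ^+ 2 / (2 * v)) by rewrite invfM; ring.
by field.
Qed.

Lemma is_derive_invsqrt v : 0 < v ->
  is_derive v 1 (fun w => (Num.sqrt w)^-1) (- (2 * (v * Num.sqrt v))^-1).
Proof.
move=> v0; have s0 := sqrt_neq0 v0.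
apply: (is_derive_eq (is_derive_inv s0 (is_derive1_sqrt v0))).
rewrite -{3}(sqr_sqrtr (ltW v0)); set s := Num.sqrt v in s0 *.
by field.
Qed.

Lemma gauss_at_pdf v x : 0 < v -> normal_pdf 0 1 (x / Num.sqrt v) = gauss_at v x.
Proof.
move=> v0; rewrite normal_pdf01E /gauss_at exprMn exprVn sqr_sqrtr ?ltW//.
by congr (_ * expR (- _)); rewrite invfM; ring.
Qed.

Lemma is_derive_hcdf_x v x : 0 < v -> is_derive x 1 (hcdf v) (hcdf_x v x).
Proof.
move=> v0; rewrite /hcdf /hcdf_x -gauss_at_pdf//.
have h := is_derive_scale (Num.sqrt v)^-1 (is_derive_idfun x).
have e : (fun y : R => ncdf (y / Num.sqrt v)) =
   ncdf \o (fun y : R => (Num.sqrt v)^-1 * y).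
  by apply/funext => y /=; rewrite mulrC.
rewrite e; have := @is_derive_ncdf R ((Num.sqrt v)^-1 * x) => h'.
by apply: (is_derive_eq (is_derive1_comp h' h)); rewrite mulr1 [x / _]mulrC.
Qed.

Lemma is_derive_hcdf_v v x : 0 < v -> is_derive v 1 (hcdf^~ x) (hcdf_xx v x / 2).
Proof.
move=> v0; rewrite /hcdf_xx -gauss_at_pdf//.
have -> : hcdf^~ x = ncdf \o (fun w => x * (Num.sqrt w)^-1) by [].
have h := is_derive_scale x (is_derive_invsqrt v0).
have h' := @is_derive_ncdf R (x / Num.sqrt v).
apply: (is_derive_eq (@is_derive1_comp R _ (fun w => x * (Num.sqrt w)^-1) _ _ _ h' h)).
by have := sqrt_neq0 v0; set s := Num.sqrt v => s0; field; rewrite s0 gt_eqF.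
Qed.

Lemma is_derive_hcdf_xx v x : 0 < v -> is_derive x 1 (hcdf_x v) (hcdf_xx v x).
Proof.
move=> v0; have e : hcdf_x v = (fun y => (Num.sqrt v)^-1 * gauss_at v y).
  by apply/funext => y; rewrite /hcdf_x mulrC.
rewrite e; apply: (is_derive_eq (is_derive_scale _ (is_derive_gauss_at_x x v0))).
rewrite /hcdf_xx.
by have := sqrt_neq0 v0; set s := Num.sqrt v => s0; field; rewrite s0 gt_eqF.
Qed.

Lemma is_derive_hcdf_xxx v x : 0 < v -> is_derive x 1 (hcdf_xx v) (hcdf_xxx v x).
Proof.
move=> v0; have e : hcdf_xx v = (fun y => - (v * Num.sqrt v)^-1 * (y * gauss_at v y)).
  by apply/funext => y; rewrite /hcdf_xx; ring.
rewrite e; apply: (is_derive_eq (is_derive_scale _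
  (is_derive_mul (is_derive_idfun x) (is_derive_gauss_at_x x v0)))).
rewrite /hcdf_xxx.
by have := sqrt_neq0 v0; set s := Num.sqrt v => s0; field; rewrite s0 gt_eqF.
Qed.

Lemma is_derive_hcdf_vv v x : 0 < v ->
  is_derive v 1 (fun w => hcdf_xx w x / 2) (hcdf_vv v x).
Proof.
move=> v0; have v1 : v != 0 by rewrite gt_eqF.
have e : (fun w => hcdf_xx w x / 2) =
    (fun w => - (x / 2) * (w^-1 * ((Num.sqrt w)^-1 * gauss_at w x))).
  by apply/funext => w; rewrite /hcdf_xx invfM; ring.
rewrite e; apply: (is_derive_eq (is_derive_scale _ (is_derive_mul
  (is_derive_inv v1 (is_derive_idfun v)) (is_derive_mul (is_derive_invsqrt v0)
     (is_derive_gauss_at_v x v0))))).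
rewrite /hcdf_vv.
by have := sqrt_neq0 v0; set s := Num.sqrt v => s0; field; rewrite s0 v1.
Qed.

(* The three moments below follow from [1 + t <= exp t]. *)
Lemma expRN_sqr_le (u : R) : let E := expR (- (u ^+ 2 / 2)) in
  [/\ E <= 1, u ^+ 2 * E <= 2 & `|u| ^+ 3 * E <= 4 /\ `|u| * E <= 1].
Proof.
move=> E; have E0 : 0 <= E by exact: expR_ge0.
have bound (t : R) : expR (- t) * (1 + t) <= 1.
  rewrite -[leRHS](expRxMexpNx_1 t) mulrC ler_wpM2r ?expR_ge0//; exact: expR_ge1Dx.
have h1 := bound (u ^+ 2 / 2).
pose F := expR (- (u ^+ 2 / 4)).
have F0 : 0 <= F by exact: expR_ge0.
have EF : E = F ^+ 2.
  by rewrite -expRM_natl; congr expR; field.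
have h2 : F * (1 + u ^+ 2 / 4) <= 1 by exact: bound.
have nu : u ^+ 2 = `|u| ^+ 2 by rewrite real_normK ?num_real.
have u0 : 0 <= `|u| by [].
rewrite -/E !nu in h1 h2 *; set n := `|u| in h1 h2 u0 *.
have g1 : n * E <= 1.
  apply: le_trans h1; rewrite mulrC ler_wpM2l//.
  by have := sqr_ge0 (n - 1); nra.
have g2 : n * F <= 1.
  apply: le_trans h2; rewrite mulrC ler_wpM2l//.
  by have := sqr_ge0 (n / 2 - 1); nra.
have g3 : n ^+ 2 * F <= 4 by nra.
split; [nra|nra|split => //].
rewrite EF (_ : n ^+ 3 * F ^+ 2 = (n ^+ 2 * F) * (n * F)); last by ring.
have : 0 <= n * F by rewrite mulr_ge0.
have : 0 <= n ^+ 2 * F by rewrite mulr_ge0 ?sqr_ge0.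
by move: g2 g3; set a := n * F; set b := n ^+ 2 * F; nra.
Qed.

(** In the variable [u = x / sqrt v] both derivatives are a negative power of [sqrt v] times a
    polynomial in [u] times [exp (- u ^ 2 / 2)], hence bounded while [v] stays away from 0. *)
Lemma hcdf_bounds v0 : 0 < v0 -> exists2 C, 0 <= C &
  forall v x, v0 <= v -> `|hcdf_xxx v x| <= C /\ `|hcdf_vv v x| <= C.
Proof.
move=> v00; set c := @normal_peak R 1; have c0 : 0 <= c by exact: normal_peak_ge0.
pose s0 := Num.sqrt v0; have s00 : 0 < s0 by rewrite sqrtr_gt0.
exists (3 * c * (s0 ^- 3 + s0 ^- 4)).
  by rewrite !mulr_ge0// addr_ge0// invr_ge0 exprn_ge0// ltW.
move=> v x v0v; have vp : 0 < v by exact: lt_le_trans v0v.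
pose s := Num.sqrt v; have sp : 0 < s by rewrite sqrtr_gt0.
have sn : s != 0 by rewrite gt_eqF.
have s0s : s0 <= s by rewrite ler_wsqrtr.
have vE : v = s ^+ 2 by rewrite sqr_sqrtr// ltW.
pose u := x / s; have xE : x = u * s by rewrite /u divfK.
have := expRN_sqr_le u; set E := expR _ => -[E1 E2 [E3 E4]].
have E0 : 0 <= E by exact: expR_ge0.
have gE : gauss_at v x = c * E.
  rewrite /gauss_at; congr (_ * expR (- _)).
  by rewrite vE xE; field.
have iv k : s ^- k <= s0 ^- k.
  rewrite lef_pV2 ?posrE ?exprn_gt0//.
  by apply: lerXn2r => //; rewrite nnegrE ltW.
have i3 := iv 3%N; have i4 := iv 4%N.
have p3 : 0 < s ^- 3 by rewrite invr_gt0 exprn_gt0.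
have p4 : 0 < s ^- 4 by rewrite invr_gt0 exprn_gt0.
have q3 : 0 < s0 ^- 3 by rewrite invr_gt0 exprn_gt0.
have q4 : 0 < s0 ^- 4 by rewrite invr_gt0 exprn_gt0.
rewrite /hcdf_xxx /hcdf_vv gE -/s.
have -> : (x ^+ 2 / v - 1) / (v * s) * (c * E) = c * s ^- 3 * (u ^+ 2 * E - E).
  by rewrite vE xE; field.
have -> : x / (v ^+ 2 * s) * (3 / 4 - x ^+ 2 / (4 * v)) * (c * E) =
    c * s ^- 4 * (3 / 4 * (u * E) - (u ^+ 3 * E) / 4).
  by rewrite vE xE; field.
rewrite !normrM !(ger0_norm c0) !(gtr0_norm p3) !(gtr0_norm p4).
have b1 : `|u ^+ 2 * E - E| <= 3.
  apply: le_trans (ler_normB _ _) _.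
  have uE : 0 <= u ^+ 2 * E by rewrite mulr_ge0 ?sqr_ge0.
  by rewrite (ger0_norm uE) (ger0_norm E0); lra.
have b2 : `|3 / 4 * (u * E) - u ^+ 3 * E / 4| <= 3.
  have : `|u * E| <= 1 by rewrite normrM (ger0_norm E0).
  have : `|u ^+ 3 * E| <= 4 by rewrite (normrM (u ^+ 3)) normrX (ger0_norm E0).
  by rewrite !ler_norml; lra.
split.
  rewrite -mulrA [X in _ <= X](_ : _ = c * ((s0 ^- 3 + s0 ^- 4) * 3)); last by ring.
  rewrite ler_wpM2l// ler_pM// ?ltW//; lra.
rewrite -mulrA [X in _ <= X](_ : _ = c * ((s0 ^- 3 + s0 ^- 4) * 3)); last by ring.
rewrite ler_wpM2l// ler_pM// ?ltW//; lra.
Qed.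

(* [hcdf] solves the heat equation [d/dv = (1/2) d^2/dx^2], so a centred step
   of variance [v'] in [x] is compensated by a decrease [v'] of [v]. *)
Lemma heat_step v0 : 0 < v0 -> exists2 C, 0 <= C &
  forall v x p w e, 0 <= p <= 1 -> `|w| <= e -> e <= 1 ->
    let dv := p * (1 - p) * w ^+ 2 in v0 <= v - dv ->
    `|p * hcdf (v - dv) (x + (1 - p) * w) + (1 - p) * hcdf (v - dv) (x - p * w)
      - hcdf v x| <= C * e * dv.
Proof.
move=> v00; have [C C0 hC] := hcdf_bounds v00; exists (3 * C); first by lra.
move=> v x p w e p01 we e1 dv vdv.
have e0 : 0 <= e by exact: le_trans we.
have dv0 : 0 <= dv by apply: mulr_ge0; [apply: mulr_ge0; lra|exact: sqr_ge0].
have w2 : w ^+ 2 <= e ^+ 2.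
  by rewrite -real_normK ?num_real// ler_pXn2r ?nnegrE.
have dve : dv <= e.
  apply: le_trans (_ : 1 * w ^+ 2 <= _); last by nra.
  by rewrite ler_wpM2r ?sqr_ge0//; nra.
(* Second order in the displacement and first order in the variance, the derivative in [v] being
   written by the heat equation. The average of [main] over the two outcomes is exactly
   [hcdf v x]. *)
pose main D := hcdf v x + hcdf_x v x * D + hcdf_xx v x * (D ^+ 2 - dv) / 2.
have step D : `|D| <= e ->
    `|hcdf (v - dv) (x + D) - main D| <= C * (e * D ^+ 2 + e * dv + dv * e).
  move=> De.
  have vp y : between v (v - dv) y -> v0 <= y.
    by rewrite /between min_r ?max_l; [lra|lra|lra].
  have A1 := @taylor1_le R (hcdf^~ (x + D)) (fun w => hcdf_xx w (x + D) / 2)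
    (hcdf_vv^~ (x + D)) v (v - dv) C.
  have {}A1 := A1 (fun y h => is_derive_hcdf_v _ (lt_le_trans v00 (vp y h)))
    (fun y h => is_derive_hcdf_vv _ (lt_le_trans v00 (vp y h)))
    (fun y h => (hC y (x + D) (vp y h)).2).
  have v0v : v0 <= v by lra.
  have vpos : 0 < v by lra.
  have A2 := @taylor2_le R (hcdf v) (hcdf_x v) (hcdf_xx v) (hcdf_xxx v) x (x + D) C.
  have {}A2 := A2 (fun y h => is_derive_hcdf_x y vpos)
    (fun y h => is_derive_hcdf_xx y vpos) (fun y h => is_derive_hcdf_xxx y vpos)
    (fun y h => (hC v y v0v).1).
  have A3 := @mean_value_le R (hcdf_xx v) (hcdf_xxx v) x (x + D) C.
  have {}A3 := A3 (fun y h => is_derive_hcdf_xxx y vpos) (fun y h => (hC v y v0v).1).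
  have xD : x + D - x = D by ring.
  have vD : v - dv - v = - dv by ring.
  rewrite xD in A2 A3; rewrite vD in A1.
  (* Three errors: the change of variance at the displaced point, the displacement at fixed
     variance, and the change of [hcdf_xx] under the displacement. *)
  have -> : hcdf (v - dv) (x + D) - main D =
    (hcdf (v - dv) (x + D) - hcdf v (x + D) - hcdf_xx v (x + D) / 2 * - dv)
    + (hcdf v (x + D) - hcdf v x - hcdf_x v x * D - hcdf_xx v x * D ^+ 2 / 2)
    + (hcdf_xx v (x + D) - hcdf_xx v x) * (- dv / 2).
    by rewrite /main; field.
  apply: le_trans (ler_normD _ _) _; apply: le_trans (lerD (ler_normD _ _) (lexx _)) _.
  rewrite normrM [`|- dv / 2|]ler0_norm; last by lra.
  have D3 : `|D| ^+ 3 <= e * D ^+ 2.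
    by rewrite exprS real_normK ?num_real// ler_wpM2r ?sqr_ge0.
  have q1 : C * `|D| ^+ 3 <= C * (e * D ^+ 2) by rewrite ler_wpM2l.
  have q2 : C * (- dv) ^+ 2 <= C * (dv * e).
    by rewrite ler_wpM2l// sqrrN expr2 ler_wpM2l.
  have q3 : `|hcdf_xx v (x + D) - hcdf_xx v x| * - (- dv / 2) <= C * (e * dv).
    apply: le_trans (_ : (C * e) * - (- dv / 2) <= _).
      apply: ler_wpM2r; first by lra.
      by apply: le_trans A3 _; rewrite ler_wpM2l.
    have := mulr_ge0 (mulr_ge0 C0 e0) dv0.
    by lra.
  by lra.
have [p0 p1] : 0 <= p /\ p <= 1 by lra.
have s1 : `|(1 - p) * w| <= e.
  by rewrite normrM ger0_norm; [|lra]; apply: le_trans we; rewrite ler_piMl//; lra.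
have s2 : `|- (p * w)| <= e.
  by rewrite normrN normrM ger0_norm//; apply: le_trans we; rewrite ler_piMl.
have S1 := step _ s1; have S2 := step _ s2.
have -> : p * hcdf (v - dv) (x + (1 - p) * w) + (1 - p) * hcdf (v - dv) (x - p * w)
   - hcdf v x = p * (hcdf (v - dv) (x + (1 - p) * w) - main ((1 - p) * w)) +
   (1 - p) * (hcdf (v - dv) (x - p * w) - main (- (p * w))).
  by rewrite /main /dv; field.
apply: le_trans (ler_normD _ _) _;
rewrite !normrM (ger0_norm p0) (@ger0_norm _ (1 - p)); last by lra.
have t1 := ler_wpM2l p0 S1.
have p1' : 0 <= 1 - p by lra.
have t2 := ler_wpM2l p1' S2.
apply: le_trans (lerD t1 t2) _.
rewrite le_eqVlt; apply/orP; left; apply/eqP.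
by rewrite /dv; ring.
Qed.

End HeatKernel.

(** * A martingale central limit theorem *)

Lemma partial_sum_le (R : numDomainType) (F : nat -> R) (m n : nat) :
  (forall t, (t < n)%N -> 0 <= F t) -> (m <= n)%N ->
  \sum_(t < m) F t <= \sum_(t < n) F t.
Proof.
move=> F0 mn; rewrite -(subnKC mn) big_split_ord /= lerDl.
by apply: sumr_ge0 => t _; apply: F0; rewrite -[leqRHS](subnKC mn) ltn_add2l.
Qed.

Section MartingaleCLT.
Context {R : realType}.
Variables (p : (nat -> bool) -> nat -> R) (w : (nat -> bool) -> nat -> R).
Implicit Types z : nat -> bool.

Definition mdiff z t : R := ((z t)%:R - p z t) * w z t.
Definition mvar z t : R := p z t * (1 - p z t) * w z t ^+ 2.

(* The pair (conditional variance, martingale), frozen as soon as the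
   conditional variance would exceed [B]. *)
Fixpoint stopped (B : R) z (t : nat) : R * R :=
  if t is t'.+1 then
    let s := stopped B z t' in
    if s.1 + mvar z t' <= B then (s.1 + mvar z t', s.2 + mdiff z t') else s
  else (0, 0).

Hypothesis pa : forall t, adapted t (p^~ t).
Hypothesis wa : forall t, adapted t (w^~ t).
Hypothesis p01 : forall z t, 0 <= p z t <= 1.

Lemma mvar_ge0 z t : 0 <= mvar z t.
Proof.
have := p01 z t; rewrite /mvar => h.
by apply: mulr_ge0; [apply: mulr_ge0; lra|exact: sqr_ge0].
Qed.

Lemma adapted_mvar t : adapted t (mvar^~ t).
Proof. by move=> z z' h; rewrite /mvar (pa h) (wa h). Qed.

Lemma adapted_stopped B t : adapted t (fun z => stopped B z t).
Proof.
elim: t => //= t IH z z' h.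
have h' s : (s < t)%N -> z s = z' s by move=> st; apply: h; exact: ltnW.
by rewrite (IH z z' h') (adapted_mvar h') /mdiff (pa h') (wa h') h.
Qed.

Lemma stopped_le B z t : 0 <= B -> 0 <= (stopped B z t).1 <= B.
Proof.
move=> B0; elim: t => /= [|t IH]; first by rewrite lexx.
by case: ifP => //= le; rewrite le andbT; have := mvar_ge0 z t; lra.
Qed.

Lemma stopped_sum B z n t : \sum_(s < n) mvar z s <= B -> (t <= n)%N ->
  stopped B z t = (\sum_(s < t) mvar z s, \sum_(s < t) mdiff z s).
Proof.
move=> sB; elim: t => [|t IH] tn /=; first by rewrite !big_ord0.
rewrite IH ?(ltnW tn)//= !big_ord_recr /= ifT//; apply: le_trans sB.
rewrite -(big_ord_recr t (fun s => mvar z s)).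
by apply: (@partial_sum_le _ (mvar z)) => // s _; exact: mvar_ge0.
Qed.

End MartingaleCLT.

Section CLTBound.
Context {R : realType}.

(** The constant [C] depends on [a] alone, so both can be fixed before the horizon, the design and
    the weights. The extra variance [a] smooths the indicator, [del] is the margin for undoing the
    smoothing, and [s2] is the approximate conditional variance. *)
Definition clt_bound (a C : R) : Prop :=
  forall (p w : (nat -> bool) -> nat -> R) (n : nat) (e s2 zeta del : R),
    (forall t, adapted t (p^~ t)) -> (forall t, adapted t (w^~ t)) ->
    (forall z t, 0 <= p z t <= 1) -> (forall z t, (t < n)%N -> `|w z t| <= e) ->
    e <= 1 -> 0 <= e -> 0 <= s2 -> 0 <= zeta -> 0 < del ->
    2 * ncdf (zeta / Num.sqrt (s2 + a)) - 1 - C * e * (s2 + a)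
      - pprob p n (fun z => a / 2 < `|\sum_(t < n) mvar p w z t - s2|)
      - ncdf (- (del / Num.sqrt (2 * a)))
    <= pprob p n (fun z => `|\sum_(t < n) mdiff p w z t| <= zeta + del).

(** [Phi] is the probability that the martingale plus an independent normal variable of the
    remaining variance lies within [zeta] of 0. It starts at the normal probability, and each round
    exchanges normal variance for martingale variance at the small cost given by [heat_step]. *)
Lemma martingale_clt (a : R) : 0 < a -> exists2 C, 0 <= C & clt_bound a C.
Proof.
move=> a0; have a20 : 0 < a / 2 by lra.
have [C C0 hC] := heat_step a20; exists (2 * C); first lra.
move=> p w n e s2 zeta del pa wa p01 we e1 e0 s20 z0 del0.
(* Freezing at this level keeps the remaining variance [v] at least [a / 2], where the derivatives
   of [hcdf] are bounded. *)
pose B := s2 + a / 2; have B0 : 0 <= B by rewrite /B; lra.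
pose V t z := (stopped p w B z t).1; pose M t z := (stopped p w B z t).2.
pose v t z := s2 + a - V t z.
pose Phi t z := hcdf (v t z) (M t z + zeta) - hcdf (v t z) (M t z - zeta).
(* The added multiple of the conditional variance pays for the errors of both ends of the interval
   and makes [F] a submartingale. *)
pose F t z := Phi t z + 2 * C * e * V t z.
have Vle t z : 0 <= V t z <= B by exact: stopped_le.
have step t z : (t < n)%N -> F t z <= cexp p t (F t.+1) z.
  move=> tn; rewrite /cexp.
  have updS b : stopped p w B (upd z t b) t = stopped p w B z t.
    exact: (adapted_upd z b (adapted_stopped pa wa B (t := t))).
  have updv b : mvar p w (upd z t b) t = mvar p w z t.
    exact: (adapted_upd z b (adapted_mvar pa wa (t := t))).
  have updd b : mdiff p w (upd z t b) t = (b%:R - p z t) * w z t.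
    by rewrite /mdiff updE (adapted_upd _ _ (pa t)) (adapted_upd _ _ (wa t)).
  rewrite /F /Phi /v /V /M /= !updS !updv !updd; case: ifP => le; last first.
    by rewrite -mulrDl (_ : p z t + (1 - p z t) = 1) ?mul1r//; ring.
  set V0 := (stopped p w B z t).1; set M0 := (stopped p w B z t).2.
  have V01 : V0 <= B by have /andP[] := Vle t z.
  have H x := hC (s2 + a - V0) x (p z t) (w z t) e (p01 z t) (we z t tn) e1.
  rewrite /= -/(mvar p w z t) in H.
  have lev : a / 2 <= s2 + a - V0 - mvar p w z t.
    by move: le; rewrite -/V0 /B; lra.
  have H1 := H (M0 + zeta) lev; have H2 := H (M0 - zeta) lev.
  have -> : s2 + a - (V0 + mvar p w z t) = s2 + a - V0 - mvar p w z t by ring.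
  have e1' : M0 + (1%:R - p z t) * w z t + zeta = M0 + zeta + (1 - p z t) * w z t by ring.
  have e2' : M0 + (0%:R - p z t) * w z t + zeta = M0 + zeta - p z t * w z t by ring.
  have e3' : M0 + (1%:R - p z t) * w z t - zeta = M0 - zeta + (1 - p z t) * w z t by ring.
  have e4' : M0 + (0%:R - p z t) * w z t - zeta = M0 - zeta - p z t * w z t by ring.
  rewrite e1' e2' e3' e4'; move: H1 H2; rewrite !ler_norml => /andP[H1 _] /andP[_ H2] /=.
  move: H1 H2; set h := hcdf (s2 + a - V0 - mvar p w z t).
  move: (h (M0 + zeta + (1 - p z t) * w z t)) (h (M0 + zeta - p z t * w z t))
    (h (M0 - zeta + (1 - p z t) * w z t)) (h (M0 - zeta - p z t * w z t))
    (hcdf _ (M0 + zeta)) (hcdf _ (M0 - zeta)) (mvar p w z t) (p z t) => h1 h2 h3 h4 h5 h6 u r.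
  by clear; lra.
have mono t : (t <= n)%N -> F 0%N (fun=> false) <= pexp p t (F t).
  elim: t => // t IH tn; apply: le_trans (IH (ltnW tn)) _ => /=.
  by apply: pexp_le => // z; exact: step.
have F0 : F 0%N (fun=> false) = 2 * ncdf (zeta / Num.sqrt (s2 + a)) - 1.
  rewrite /F /Phi /v /V /M /= /hcdf !subr0 mulr0 addr0 !add0r mulNr ncdfN.
  by ring.
have := mono n (leqnn n); rewrite F0 => h.
suff : pexp p n (F n) <=
   pprob p n (fun z => `|\sum_(t < n) mdiff p w z t| <= zeta + del) +
   pprob p n (fun z => a / 2 < `|\sum_(t < n) mvar p w z t - s2|) +
   (ncdf (- (del / Num.sqrt (2 * a))) + 2 * C * e * (s2 + a)) by lra.
rewrite -[X in _ <= _ + X](pexp_cst p n) /pprob -!pexpD.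
apply: pexp_le => // z; rewrite /F addrA; apply: lerD; last first.
  by apply: ler_wpM2l; [rewrite !mulr_ge0|have := Vle n z; rewrite /B; lra].
have t0 : 0 <= ncdf (- (del / Num.sqrt (2 * a))) := ncdf_ge0 _.
have Phi1 : Phi n z <= 1.
  rewrite /Phi /hcdf -[leRHS]subr0; apply: lerB; [exact: ncdf_le1 | exact: ncdf_ge0].
case: (ltP (a / 2) `|\sum_(t < n) mvar p w z t - s2|) => [_|good].
  by case: (leP `|\sum_(t < n) mdiff p w z t| (zeta + del)) => _ /=; lra.
case: (leP `|\sum_(t < n) mdiff p w z t| (zeta + del)) => [_|big]; first by rewrite /=; lra.
rewrite /= !mulr0n addr0 add0r.
(* On the remaining event nothing has been frozen and the remaining variance is at most [2 * a], so
   a martingale beyond [zeta + del] leaves [Phi] no more than a normal tail. *)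
have sB : \sum_(t < n) mvar p w z t <= B.
  by move: good; rewrite ler_norml /B; lra.
have := stopped_sum p01 sB (leqnn n) => E.
have vlo : a / 2 <= v n z by have := Vle n z; rewrite /v /B; lra.
have vhi : v n z <= 2 * a.
  by rewrite /v /V E /=; move: good; rewrite ler_norml; lra.
have sv0 : 0 < Num.sqrt (v n z) by rewrite sqrtr_gt0; lra.
have sa0 : 0 < Num.sqrt (2 * a) by rewrite sqrtr_gt0; lra.
have dle : del / Num.sqrt (2 * a) <= del / Num.sqrt (v n z).
  by rewrite ler_pM2l// lef_pV2 ?posrE// ler_wsqrtr.
have ME : M n z = \sum_(t < n) mdiff p w z t by rewrite /M E.
rewrite -ME in big; rewrite /Phi /hcdf.
have n1 := ncdf_ge0 ((M n z - zeta) / Num.sqrt (v n z)).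
have n2 := ncdf_le1 ((M n z + zeta) / Num.sqrt (v n z)).
move: big; rewrite lter_normr => /orP[big|big].
  have : ncdf (del / Num.sqrt (2 * a)) <= ncdf ((M n z - zeta) / Num.sqrt (v n z)).
    apply: ncdf_le; apply: le_trans dle _; rewrite ler_pM2r ?invr_gt0//.
    by clear -big; lra.
  by move=> le; rewrite ncdfN; clear -le n2; lra.
have : ncdf ((M n z + zeta) / Num.sqrt (v n z)) <= ncdf (- (del / Num.sqrt (2 * a))).
  apply: ncdf_le; rewrite lerNr; apply: le_trans dle _.
  by rewrite -mulNr ler_pM2r ?invr_gt0//; clear -big; lra.
by move=> le; clear -le n1; lra.
Qed.

End CLTBound.

(** * Ridge regression *)

Section InnerProduct.
Context {R : realType} {d : nat}.
Implicit Types (u v w : 'cV[R]_d) (A B : 'M[R]_d).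

Lemma innerE u v : inner u v = (u^T *m v) 0 0.
Proof. by rewrite mxE; apply: eq_bigr => i _; rewrite mxE. Qed.

Lemma innerC u v : inner u v = inner v u.
Proof. by apply: eq_bigr => i _; rewrite mulrC. Qed.

Lemma innerDr u v w : inner u (v + w) = inner u v + inner u w.
Proof. by rewrite !innerE mulmxDr mxE. Qed.

Lemma innerZr (a : R) u v : inner u (a *: v) = a * inner u v.
Proof. by rewrite !innerE -scalemxAr mxE. Qed.

Lemma innerDl u v w : inner (u + v) w = inner u w + inner v w.
Proof. by rewrite innerC innerDr !(innerC w). Qed.

Lemma innerZl (a : R) u v : inner (a *: u) v = a * inner u v.
Proof. by rewrite innerC innerZr innerC. Qed.

Lemma inner0r u : inner u 0 = 0.
Proof. by rewrite -[0](scale0r (0 : 'cV[R]_d)) innerZr mul0r. Qed.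

Lemma innerNr u v : inner u (- v) = - inner u v.
Proof. by rewrite -scaleN1r innerZr mulN1r. Qed.

Lemma innerBr u v w : inner u (v - w) = inner u v - inner u w.
Proof. by rewrite innerDr innerNr. Qed.

Lemma inner_suml (I : Type) (r : seq I) (Q : pred I) (F : I -> 'cV[R]_d) v :
  inner (\sum_(i <- r | Q i) F i) v = \sum_(i <- r | Q i) inner (F i) v.
Proof.
elim/big_rec2: _ => [|i a b _ <-]; first by rewrite innerC inner0r.
by rewrite innerDl.
Qed.

Lemma inner_ge0 u : 0 <= inner u u.
Proof. by apply: sumr_ge0 => i _; rewrite -expr2 sqr_ge0. Qed.

Lemma inner_eq0 u : inner u u = 0 -> u = 0.
Proof.
move=> u0; apply/colP => i; rewrite mxE; apply/eqP; rewrite -sqrf_eq0 eq_le sqr_ge0 andbT.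
rewrite -u0 /inner (bigD1 i)//= expr2 lerDl.
by apply: sumr_ge0 => j _; rewrite -expr2 sqr_ge0.
Qed.

Lemma inner_mulmx A u v : inner (A *m u) v = inner u (A^T *m v).
Proof. by rewrite !innerE trmx_mul mulmxA. Qed.

Lemma inner_outer u v w : inner ((u *m u^T) *m v) w = inner u v * inner u w.
Proof.
rewrite -mulmxA innerC innerE mulmxA mxE big_ord1 -!innerE mulrC innerC.
by congr (_ * _); rewrite innerC innerE.
Qed.

(** The discriminant of a nonnegative quadratic polynomial. When [c = 0] the polynomial is affine,
    and [b] must vanish since otherwise it takes the value -1. *)
Lemma sqr_le_discr (a b c : R) :
  0 <= c -> (forall t, 0 <= a + 2 * t * b + t ^+ 2 * c) -> b ^+ 2 <= a * c.
Proof.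
move=> c0 h; move: c0; rewrite le_eqVlt => /predU1P[c0|c0]; last first.
  have cn : c != 0 by rewrite gt_eqF.
  have := h (- (b / c)); rewrite -(ler_pM2r c0) mul0r.
  have -> : (a + 2 * - (b / c) * b + (- (b / c)) ^+ 2 * c) * c = a * c - b ^+ 2.
    by field.
  by rewrite subr_ge0.
rewrite -c0 mulr0; have [->|b0] := eqVneq b 0; first by rewrite expr0n.
have := h (- ((a + 1) / (2 * b))); rewrite -c0 mulr0 addr0.
have -> : a + 2 * - ((a + 1) / (2 * b)) * b = - 1 by field.
by lra.
Qed.

Definition psd A := A^T = A /\ forall v, 0 <= inner (A *m v) v.

Lemma psd_cauchy_schwarz A u v : psd A ->
  inner (A *m u) v ^+ 2 <= inner (A *m u) u * inner (A *m v) v.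
Proof.
move=> [At A0]; apply: sqr_le_discr => // t.
have := A0 (u + t *: v).
rewrite mulmxDr -scalemxAr innerDl !innerDr !innerZl !innerZr.
have -> : inner (A *m v) u = inner (A *m u) v by rewrite inner_mulmx At innerC.
by congr (0 <= _); ring.
Qed.

Lemma psd1 : psd 1%:M.
Proof. by split=> [|v]; rewrite ?trmx1// mul1mx inner_ge0. Qed.

Lemma cauchy_schwarz u v : inner u v ^+ 2 <= inner u u * inner v v.
Proof. by have := psd_cauchy_schwarz u v psd1; rewrite !mul1mx. Qed.

Lemma inner_mulmx_bound A : exists2 K, 0 < K &
  forall v, inner v (A *m v) <= K * inner v v.
Proof.
exists (1 + \sum_i \sum_j `|A i j|).
  by rewrite ltr_pwDl// sumr_ge0// => i _; apply: sumr_ge0.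
move=> v; have vi i : `|v i 0| ^+ 2 <= inner v v.
  rewrite real_normK ?num_real// /inner (bigD1 i)//= expr2 lerDl.
  by apply: sumr_ge0 => j _; rewrite -expr2 sqr_ge0.
have vij i j : `|v i 0| * `|v j 0| <= inner v v.
  have := vi i; have := vi j; have := sqr_ge0 (`|v i 0| - `|v j 0|); lra.
apply: le_trans (_ : (\sum_i \sum_j `|A i j|) * inner v v <= _); last first.
  by rewrite ler_wpM2r ?inner_ge0// lerDr.
rewrite /inner mulr_suml; apply: ler_sum => i _.
rewrite mxE mulr_sumr mulr_suml; apply: ler_sum => j _.
by apply: le_trans (ler_norm _) _; rewrite !normrM mulrCA ler_wpM2l.
Qed.

(** Cauchy-Schwarz for the form of [A] at [A^-1 v] and [v] bounds [|v|^4] by [<v, A^-1 v> <A v, v>],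
    and the first factor is at most [K |v|^2]. *)
Lemma psd_unit_coercive A : psd A -> A \in unitmx ->
  exists2 e, 0 < e & forall v, e * inner v v <= inner (A *m v) v.
Proof.
move=> pA uA; have [K K0 hK] := inner_mulmx_bound (invmx A).
exists K^-1; first by rewrite invr_gt0.
move=> v; rewrite mulrC ler_pdivrMr//.
have [v0|v0] := eqVneq (inner v v) 0; first by rewrite v0 mulr_ge0 ?pA.2// ltW.
have vp : 0 < inner v v by rewrite lt_neqAle eq_sym v0 inner_ge0.
have := psd_cauchy_schwarz (invmx A *m v) v pA.
rewrite mulmxA mulmxV// mul1mx => h.
rewrite -(ler_pM2l vp) -expr2; apply: le_trans h _.
apply: le_trans (ler_wpM2r (pA.2 v) (hK v)) _.
by rewrite le_eqVlt; apply/orP; left; apply/eqP; ring.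
Qed.

(* The largest [l] with [l |v|^2 <= <A v, v>] is an eigenvalue of [A]:
   otherwise [A - l] would be invertible, hence coercive. *)
Lemma sigma_min_le A v : psd A -> sigma_min A * inner v v <= inner (A *m v) v.
Proof.
move=> pA; pose L := [set l : R | 0 <= l /\ forall v, l * inner v v <= inner (A *m v) v].
have [v0|v0] := eqVneq (inner v v) 0; first by rewrite v0 mulr0 pA.2.
have vp : 0 < inner v v by rewrite lt_neqAle eq_sym v0 inner_ge0.
have L0 : L 0 by split => // u; rewrite mul0r pA.2.
have supL : has_sup L.
  split; first by exists 0.
  by exists (inner (A *m v) v / inner v v) => l [_ /(_ v)]; rewrite ler_pdivlMr.
pose l := sup L.
have l0 : 0 <= l by apply: ub_le_sup => //; exact: supL.2.
have lL u : l * inner u u <= inner (A *m u) u.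
  have [u0|u0] := eqVneq (inner u u) 0; first by rewrite u0 mulr0 pA.2.
  have up : 0 < inner u u by rewrite lt_neqAle eq_sym u0 inner_ge0.
  rewrite -ler_pdivlMr//; apply: ge_sup; first by exists 0.
  by move=> m [_ /(_ u)]; rewrite ler_pdivlMr.
suff sl : sigma_min A <= l.
  by apply: le_trans (lL v); rewrite ler_wpM2r ?inner_ge0.
apply: ge_inf; first by exists 0 => s [].
split=> //; rewrite pA.1.
have BE u : inner ((A - l%:M) *m u) u = inner (A *m u) u - l * inner u u.
  by rewrite mulmxBl mul_scalar_mx innerDl -scaleN1r innerZl innerZl mulN1r.
have pB : psd (A - l%:M).
  split; first by rewrite linearB /= tr_scalar_mx pA.1.
  by move=> u; rewrite BE subr_ge0.
have nB : A - l%:M \notin unitmx.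
  apply/negP => uB; have [e e0 he] := psd_unit_coercive pB uB.
  have : L (l + e).
    split=> [|u]; first by rewrite addr_ge0// ltW.
    by have := he u; rewrite BE mulrDl; lra.
  by move=> /(ub_le_sup supL.2); rewrite -/l gerDl leNgt e0.
have : kermx (A - l%:M) != 0 by rewrite kermx_eq0 row_free_unit.
move=> /rowV0Pn[r /sub_kermxP rB r0].
have rA : r *m A = l *: r.
  by apply/eqP; rewrite -subr_eq0 -mul_mx_scalar -mulmxBr rB.
apply/eigenvalueP; exists r => //.
by rewrite mulmxA rA -scalemxAl rA scalerA expr2.
Qed.

End InnerProduct.

(** * Sequential ridge regression *)

Section Ridge.
Context {R : realType} {d : nat}.
Variables (x : nat -> 'cV[R]_d) (kap : nat -> R).
Implicit Types (u v : 'cV[R]_d) (w : nat -> R) (t n : nat).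

Definition gram t : 'M[R]_d := \sum_(s < t) (x s *m (x s)^T) + (kap t)%:M.

Definition gform t u v : R :=
  \sum_(s < t) inner (x s) u * inner (x s) v + kap t * inner u v.

Definition ridge_obj w t u : R :=
  \sum_(s < t) (w s - inner (x s) u) ^+ 2 + kap t * inner u u.

Definition ridge_sol w t : 'cV[R]_d :=
  invmx (gram t) *m (\sum_(s < t) w s *: x s).

Definition ridge_min w t : R := ridge_obj w t (ridge_sol w t).

Definition ridge_res w t : R := w t - inner (x t) (ridge_sol w t).

Lemma gformE t u v : inner (gram t *m u) v = gform t u v.
Proof.
rewrite /gram mulmxDl innerDl mul_scalar_mx innerZl mulmx_suml inner_suml.
by congr (_ + _); apply: eq_bigr => s _; rewrite inner_outer.
Qed.

Lemma gform_ge t v : kap t * inner v v <= gform t v v.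
Proof. by rewrite lerDr; apply: sumr_ge0 => s _; rewrite -expr2 sqr_ge0. Qed.

Lemma ridge_solD w w' t :
  ridge_sol (fun s => w s + w' s) t = ridge_sol w t + ridge_sol w' t.
Proof.
rewrite /ridge_sol -mulmxDr -big_split /=; congr (_ *m _).
by apply: eq_bigr => s _; rewrite scalerDl.
Qed.

Lemma ridge_solN w t : ridge_sol (fun s => - w s) t = - ridge_sol w t.
Proof.
rewrite /ridge_sol -mulmxN -sumrN; congr (_ *m _).
by apply: eq_bigr => s _; rewrite scaleNr.
Qed.

Lemma eq_ridge_sol w w' t : (forall s, (s < t)%N -> w s = w' s) ->
  ridge_sol w t = ridge_sol w' t.
Proof. by move=> ww; congr (_ *m _); apply: eq_bigr => s _; rewrite ww. Qed.

Section At.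
Variables (t : nat) (e : R).
Hypothesis kap_ge0 : 0 <= kap t.
Hypothesis e0 : 0 < e.
Hypothesis he : forall v, e * inner v v <= gform t v v.

Lemma gform_ge0 v : 0 <= gform t v v.
Proof. by apply: le_trans (he v); rewrite mulr_ge0 ?inner_ge0// ltW. Qed.

Lemma gram_sym : (gram t)^T = gram t.
Proof.
rewrite /gram linearD /= tr_scalar_mx raddf_sum; congr (_ + _).
by apply: eq_bigr => s _ /=; rewrite trmx_mul trmxK.
Qed.

(** Coercivity is assumed with a free constant [e]: this covers the regularized problem, where [e]
    is [kap t], as well as least squares, where [kap] is 0 and coercivity comes from the
    covariates. *)
Lemma gram_unit : gram t \in unitmx.
Proof.
rewrite -row_free_unit -kermx_eq0; apply/negPn/negP => /rowV0Pn[r /sub_kermxP rG r0].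
have : gram t *m r^T = 0 by rewrite -gram_sym -trmx_mul rG trmx0.
move=> /(congr1 (fun u => inner u r^T)); rewrite gformE innerC inner0r => g0.
have : inner r^T r^T = 0.
  apply/eqP; rewrite eq_le inner_ge0 andbT -(ler_pM2l e0) mulr0 -g0.
  exact: he.
by move=> /inner_eq0 /(congr1 trmx); rewrite trmxK trmx0 => /eqP; rewrite (negPf r0).
Qed.

Lemma ridge_normal w v :
  gform t (ridge_sol w t) v = \sum_(s < t) w s * inner (x s) v.
Proof.
rewrite -gformE /ridge_sol mulmxA mulmxV ?gram_unit// mul1mx inner_suml.
by apply: eq_bigr => s _; rewrite innerZl.
Qed.

(** The normal equations cancel the cross term, so the objective is its minimum plus an exact
    quadratic form. *)
Lemma ridge_objD w v :
  ridge_obj w t (ridge_sol w t + v) = ridge_min w t + gform t v v.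
Proof.
rewrite /ridge_min /ridge_obj; set b := ridge_sol w t.
have := ridge_normal w v; rewrite -/b /gform => N.
have -> : \sum_(s < t) (w s - inner (x s) (b + v)) ^+ 2 =
  \sum_(s < t) (w s - inner (x s) b) ^+ 2 - 2 * (\sum_(s < t) w s * inner (x s) v
   - \sum_(s < t) inner (x s) b * inner (x s) v)
   + \sum_(s < t) inner (x s) v * inner (x s) v.
  rewrite -sumrB mulr_sumr -sumrB -big_split /=; apply: eq_bigr => s _.
  by rewrite innerDr; ring.
rewrite -N innerDl !innerDr (innerC v b); ring.
Qed.

Lemma ridge_minP w u : ridge_obj w t u = ridge_min w t
   + gform t (u - ridge_sol w t) (u - ridge_sol w t).
Proof. by rewrite -ridge_objD addrC subrK. Qed.

Lemma ridge_min_le w u : ridge_min w t <= ridge_obj w t u.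
Proof. by rewrite ridge_minP lerDl gform_ge0. Qed.

Lemma argmin_ridge w : argmin setT (ridge_obj w t) = ridge_sol w t.
Proof.
rewrite /argmin; set S := [set u | _].
have SP : S (ridge_sol w t) by split => // v _; exact: ridge_min_le.
have : S (get S) by apply: getPex; exists (ridge_sol w t).
move: (get S) => u [_ /(_ (ridge_sol w t) I)]; rewrite ridge_minP -/(ridge_min w t).
rewrite gerDl => g0; apply/eqP; rewrite -subr_eq0; apply/eqP/inner_eq0/eqP.
rewrite eq_le inner_ge0 andbT -(ler_pM2l e0) mulr0.
by apply: le_trans g0; exact: he.
Qed.

(** The objective at 0 exceeds the minimum by exactly the energy of the solution. *)
Lemma ridge_sol_gform w :
  gform t (ridge_sol w t) (ridge_sol w t) <= \sum_(s < t) w s ^+ 2.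
Proof.
have -> : \sum_(s < t) w s ^+ 2 = ridge_obj w t 0.
  rewrite /ridge_obj inner0r mulr0 addr0.
  by apply: eq_bigr => s _; rewrite inner0r subr0.
rewrite ridge_minP sub0r -scaleN1r -!gformE -scalemxAr innerZl innerZr gformE.
rewrite !mulN1r opprK lerDr.
by apply: addr_ge0; [apply: sumr_ge0 => s _; exact: sqr_ge0|
  rewrite mulr_ge0 ?inner_ge0].
Qed.

End At.

Hypothesis kap0 : forall t, 0 < kap t.

Let ge0 t v : 0 <= gform t v v.
Proof. exact: (gform_ge0 (kap0 t) (gform_ge t)). Qed.

Let kapW t : 0 <= kap t := ltW (kap0 t).

Lemma ridge_min_pos_le w t u : ridge_min w t <= ridge_obj w t u.
Proof. exact: (ridge_min_le (kap0 t) (gform_ge t)). Qed.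

Lemma argmin_ridge_pos w t : argmin setT (ridge_obj w t) = ridge_sol w t.
Proof. exact: (argmin_ridge (kap0 t) (gform_ge t)). Qed.

Lemma ridge_sol_pos_gform w t :
  gform t (ridge_sol w t) (ridge_sol w t) <= \sum_(s < t) w s ^+ 2.
Proof. exact: (ridge_sol_gform (kapW t) (kap0 t) (gform_ge t)). Qed.

Hypothesis kap_le : forall t, kap t <= kap t.+1.
Variable h : nat -> R.
Hypothesis h0 : forall t, 0 <= h t.
Variable N : nat.
Hypothesis hx : forall t v, (t < N)%N -> inner (x t) v ^+ 2 <= h t * gform t v v.

Lemma ridge_objS w t u : ridge_obj w t.+1 u =
  ridge_obj w t u + (w t - inner (x t) u) ^+ 2 + (kap t.+1 - kap t) * inner u u.
Proof. by rewrite /ridge_obj big_ord_recr /=; ring. Qed.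

(** Moving the predictor by [u - b] shifts its prediction by some [s] and costs at least
    [s ^ 2 / h t] in the old objective. The best compromise with the new residual leaves the
    fraction [1 / (1 + h t)] of its square. *)
Lemma ridge_min_upper w t : (t < N)%N ->
  ridge_min w t + ridge_res w t ^+ 2 / (1 + h t) <= ridge_min w t.+1.
Proof.
move=> tN; set b := ridge_sol w t; set u := ridge_sol w t.+1.
have -> : ridge_min w t.+1 = ridge_min w t +
    (gform t (u - b) (u - b) + (w t - inner (x t) u) ^+ 2)
    + (kap t.+1 - kap t) * inner u u.
  have -> : ridge_min w t.+1 = ridge_obj w t.+1 u by [].
  rewrite ridge_objS (ridge_minP (kap0 t) (gform_ge t)); congr (_ + _).
  exact: (esym (addrA _ _ _)).
have k0 : 0 <= (kap t.+1 - kap t) * inner u u by rewrite mulr_ge0 ?inner_ge0 ?subr_ge0.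
apply: ler_wpDr => //; rewrite lerD2l.
have -> : w t - inner (x t) u = ridge_res w t - inner (x t) (u - b).
  by rewrite /ridge_res -/b innerBr; ring.
have := hx (u - b) tN; have := ge0 t (u - b).
move: (ridge_res w t) (inner (x t) _) (gform _ _ _) (h0 t) => e s g h00 g0 sg.
rewrite ler_pdivrMr; last by lra.
have -> : (g + (e - s) ^+ 2) * (1 + h t) = (1 + h t) * (e - s) ^+ 2 + g + h t * g by ring.
have : 0 <= h t * (e - s) ^+ 2 by rewrite mulr_ge0 ?sqr_ge0.
have [h1|hn] := eqVneq (h t) 0.
  move: sg; rewrite h1 mul0r => sg; have /eqP : s ^+ 2 == 0 by rewrite eq_le sg sqr_ge0.
  by move=> /eqP; rewrite sqrf_eq0 => /eqP ->; lra.
have hp : 0 < h t by rewrite lt_neqAle eq_sym hn h0.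
have hg : s ^+ 2 / h t <= g by rewrite ler_pdivrMr// mulrC.
(* The square vanishes at the optimal shift, where [s = h t * (e - s)]. *)
have : 0 <= (h t * (e - s) - s) ^+ 2 / h t by rewrite mulr_ge0 ?sqr_ge0// invr_ge0 ltW.
have -> : (h t * (e - s) - s) ^+ 2 / h t = h t * (e - s) ^+ 2 - 2 * s * (e - s) + s ^+ 2 / h t.
  by field.
by lra.
Qed.

Lemma ridge_regret w n u : (n <= N)%N ->
  \sum_(t < n) ridge_res w t ^+ 2 / (1 + h t) <= ridge_obj w n u.
Proof.
move=> nN; apply: le_trans (ridge_min_pos_le w n u); elim: n nN => [_|n IH nN].
  rewrite big_ord0 /ridge_min /ridge_obj big_ord0 add0r.
  by rewrite mulr_ge0 ?inner_ge0// ltW.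
by rewrite big_ord_recr /=; apply: le_trans (ridge_min_upper w nN); rewrite lerD2r IH// ltnW.
Qed.

(** The old predictor competes in the new problem; the growth of the regularization is charged to
    its norm. *)
Lemma ridge_min_lower w t : ridge_min w t.+1 <=
  ridge_min w t + ridge_res w t ^+ 2
    + (kap t.+1 - kap t) * inner (ridge_sol w t) (ridge_sol w t).
Proof. by rewrite -ridge_objS ridge_min_pos_le. Qed.

Lemma ridge_pred_sqr w t : (t < N)%N ->
  inner (x t) (ridge_sol w t) ^+ 2 <= h t * \sum_(s < t) w s ^+ 2.
Proof.
by move=> tN; apply: le_trans (hx _ tN) _; rewrite ler_wpM2l// ridge_sol_pos_gform.
Qed.

End Ridge.

(** * Deterministic regret of the online ridge predictors *)

Section RealSums.
Context {R : realType}.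

Lemma le_of_sqr (a b : R) : 0 <= b -> a ^+ 2 <= b ^+ 2 -> a <= b.
Proof.
move=> b0 ab; rewrite leNgt; apply/negP => ba; move: ab; rewrite leNgt.
by rewrite ltr_pXn2r ?nnegrE// ?ba// ltW// (le_lt_trans b0).
Qed.

Lemma sum_cauchy_schwarz n (a b : nat -> R) :
  (\sum_(i < n) a i * b i) ^+ 2 <= (\sum_(i < n) a i ^+ 2) * (\sum_(i < n) b i ^+ 2).
Proof.
apply: sqr_le_discr => [|t]; first by apply: sumr_ge0 => i _; exact: sqr_ge0.
have -> : \sum_(i < n) a i ^+ 2 + 2 * t * (\sum_(i < n) a i * b i) +
    t ^+ 2 * (\sum_(i < n) b i ^+ 2) = \sum_(i < n) (a i + t * b i) ^+ 2.
  by rewrite !mulr_sumr -!big_split /=; apply: eq_bigr => i _; ring.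
by apply: sumr_ge0 => i _; exact: sqr_ge0.
Qed.

Lemma ln_le_subr1 (r : R) : 0 < r -> ln r <= r - 1.
Proof.
move=> r0; have -> : ln r = ln (1 + (r - 1)) by congr ln; ring.
by apply: le_ln1Dx; lra.
Qed.

Lemma harmonic_le_ln n : \sum_(i < n.+1) (i.+1%:R^-1 : R) <= 1 + ln n.+1%:R.
Proof.
elim: n => [|n IH]; first by rewrite big_ord_recr big_ord0 /= add0r invr1 ln1 addr0.
rewrite big_ord_recr /=; apply: le_trans (lerD IH (lexx _)) _.
rewrite -addrA lerD2l -lerBrDl.
have p1 : (0 : R) < n.+1%:R by rewrite ltr0n.
have p2 : (0 : R) < n.+2%:R by rewrite ltr0n.
rewrite -ln_div ?posrE//.
have -> : (n.+2%:R : R) / n.+1%:R = (n.+1%:R / n.+2%:R)^-1 by rewrite invf_div.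
rewrite lnV ?posrE ?divr_gt0// lerNr.
apply: le_trans (ln_le_subr1 _) _; first by rewrite divr_gt0.
rewrite le_eqVlt; apply/orP; left; apply/eqP.
have -> : (n.+1%:R : R) = n.+2%:R - 1 by rewrite -[n.+2%:R]natr1 addrK.
by field; rewrite gt_eqF.
Qed.

End RealSums.

(* Throughout, [q = T ^ (1/192)], so that every rate is a power of [q]; the
   constant [B] dominates all the constants of the assumptions. *)
Section Experiment.
Context {R : realType} (T d : nat) (x : nat -> 'cV[R]_d) (B q : R).
Hypothesis B2 : 2 <= B.
Hypothesis Bq : B <= q.
Hypothesis Tq : T%:R = q ^+ 192.
Hypothesis hx3 : forall t, (t < T)%N -> enorm (x t) <= B * q ^+ 48.
Hypothesis hx2 : forall n v, (n <= T)%N -> B * q ^+ 96 <= n%:R ->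
  n%:R / B * inner v v <= \sum_(s < n) inner (x s) v ^+ 2.

Lemma B1 : 1 <= B. Proof. by have := B2; lra. Qed.
Lemma q_ge1 : 1 <= q. Proof. exact: le_trans B1 Bq. Qed.
Lemma q_gt0 : 0 < q. Proof. exact: lt_le_trans ltr01 q_ge1. Qed.
Lemma B_gt0 : 0 < B. Proof. exact: lt_le_trans ltr01 B1. Qed.
Lemma qX_gt0 k : 0 < q ^+ k. Proof. by rewrite exprn_gt0// q_gt0. Qed.
Lemma q_neq0 : q != 0. Proof. by rewrite gt_eqF// q_gt0. Qed.
Lemma qX_le m n : (m <= n)%N -> q ^+ m <= q ^+ n.
Proof. by move=> mn; rewrite ler_weXn2l// q_ge1. Qed.
Lemma qX_ge0 k : 0 <= q ^+ k. Proof. exact: ltW (qX_gt0 k). Qed.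
Lemma qX_ge1 k : 1 <= q ^+ k. Proof. exact: (@qX_le 0 k). Qed.
Lemma BX_ge1 k : 1 <= B ^+ k. Proof. by apply: exprn_ege1; exact: B1. Qed.

Lemma sqrtT : Num.sqrt T%:R = q ^+ 96.
Proof. by rewrite Tq (_ : 192 = 96 * 2)%N// exprM sqrtr_sqr ger0_norm// ltW// qX_gt0. Qed.

Lemma T_gt0 : (0 < T)%N.
Proof. by rewrite -(ltr_nat R) Tq qX_gt0. Qed.

(** The round with index [t] uses the radius [R_{t+1}]. Freezing it at the horizon keeps
    monotonicity and the upper bound valid for every [t]. *)
Definition crad t := Defs.radius x (minn t.+1 T).

Definition ikap t : R := Num.sqrt T%:R * crad t.

Lemma ikapE t : ikap t = q ^+ 96 * crad t. Proof. by rewrite /ikap sqrtT. Qed.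

Lemma eta_ikap t : (t < T)%N -> (Defs.eta T x t.+1)^-1 = ikap t.
Proof.
by move=> tT; rewrite /Defs.eta /ikap /crad (minn_idPl tT) invfM !invrK mulrC.
Qed.

Lemma radius_ge1 t : 1 <= Defs.radius x t.
Proof. by elim: t => //= t IH; rewrite le_max IH. Qed.

Lemma crad_ge1 t : 1 <= crad t. Proof. exact: radius_ge1. Qed.

Lemma crad_gt0 t : 0 < crad t. Proof. exact: lt_le_trans (crad_ge1 t). Qed.

Lemma crad_leS t : crad t <= crad t.+1.
Proof.
have [tT|tT] := ltnP t.+1 T; last by rewrite /crad !(minn_idPr _)// (leq_trans tT).
rewrite /crad (minn_idPl tT) (minn_idPl (ltnW tT)) /=.
by rewrite le_max lexx.
Qed.

Lemma crad_le_q t : crad t <= B * q ^+ 48.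
Proof.
rewrite /crad; have : (minn t.+1 T <= T)%N by rewrite geq_minr.
elim: (minn _ _) => [_|n IH nT] /=; first by apply: mulr_ege1 B1 (qX_ge1 _).
by rewrite ge_max IH ?(ltnW nT)//= hx3.
Qed.

Lemma enorm_sqr (v : 'cV[R]_d) : enorm v ^+ 2 = inner v v.
Proof. by rewrite sqr_sqrtr// inner_ge0. Qed.

Lemma inner_le_rad t : (t < T)%N -> inner (x t) (x t) <= crad t ^+ 2.
Proof.
move=> tT; rewrite -enorm_sqr ler_pXn2r ?nnegrE ?sqrtr_ge0 ?(ltW (crad_gt0 t))//.
by rewrite /crad (minn_idPl tT) /= le_max lexx orbT.
Qed.

Lemma ikap_gt0 t : 0 < ikap t.
Proof. by rewrite ikapE mulr_gt0 ?qX_gt0 ?crad_gt0. Qed.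

Lemma ikap_ge t : q ^+ 96 <= ikap t.
Proof. by rewrite ikapE ler_peMr ?crad_ge1// ltW ?qX_gt0. Qed.

Lemma ikap_leS t : ikap t <= ikap t.+1.
Proof. by rewrite !ikapE ler_wpM2l ?crad_leS// ltW// qX_gt0. Qed.

Lemma ikap_le_q t : ikap t <= B * q ^+ 144.
Proof.
rewrite ikapE (_ : B * q ^+ 144 = q ^+ 96 * (B * q ^+ 48)); last by ring.
by rewrite ler_wpM2l ?crad_le_q// ltW// qX_gt0.
Qed.

(** An upper bound for the leverage of [x t]. The regularization alone gives the first expression;
    once the Gram matrix of the first [t] covariates is known to be of order [t], the second is
    available too. *)
Definition lev t : R :=
  if (t < T)%N && (B * q ^+ 96 <= t%:R) then
    Num.min (crad t / q ^+ 96) (B * crad t ^+ 2 / t%:R)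
  else crad t / q ^+ 96.

Lemma lev_le_rad t : lev t <= crad t / q ^+ 96.
Proof. by rewrite /lev; case: ifP => // _; rewrite ge_min lexx. Qed.

Lemma lev_ge0 t : 0 <= lev t.
Proof.
have a0 : 0 <= crad t / q ^+ 96 by rewrite divr_ge0// ltW ?crad_gt0// qX_gt0.
rewrite /lev; case: ifP => // _; rewrite le_min a0 /=.
by rewrite divr_ge0// mulr_ge0 ?sqr_ge0// ltW ?B_gt0.
Qed.

Lemma lev_le t : lev t <= B * q ^- 48.
Proof.
apply: le_trans (lev_le_rad t) _; rewrite ler_pdivrMr ?qX_gt0//.
have -> : B * q ^- 48 * q ^+ 96 = B * q ^+ 48.
  by rewrite (_ : 96 = 48 + 48)%N// exprD mulrA divfK// gt_eqF// qX_gt0.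
exact: crad_le_q.
Qed.

Lemma lev_big t : (t < T)%N -> B * q ^+ 96 <= t%:R -> lev t <= B * crad t ^+ 2 / t%:R.
Proof. by move=> tT big; rewrite /lev tT big /= ge_min lexx orbT. Qed.

Lemma big_gt0 t : B * q ^+ 96 <= t%:R -> (0 : R) < t%:R.
Proof. by apply: lt_le_trans; rewrite mulr_gt0 ?B_gt0 ?qX_gt0. Qed.

Lemma crad_sqr_le t : crad t ^+ 2 <= B ^+ 2 * q ^+ 96.
Proof.
rewrite (_ : 96 = 48 * 2)%N// (exprM _ 48) -exprMn.
rewrite ler_pXn2r ?nnegrE ?crad_le_q ?(ltW (crad_gt0 _))//.
by rewrite mulr_ge0 ?(ltW B_gt0) ?(ltW (qX_gt0 _)).
Qed.

Lemma lev_mul_le t : (t < T)%N -> lev t * t%:R <= B ^+ 3 * q ^+ 96.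
Proof.
move=> tT; have [big|/ltW small] := leP (B * q ^+ 96) t%:R.
  have tp := big_gt0 big.
  apply: le_trans (ler_wpM2r (ltW tp) (lev_big tT big)) _.
  by rewrite divfK ?gt_eqF// exprS -mulrA ler_wpM2l ?(ltW B_gt0)// crad_sqr_le.
apply: le_trans (ler_pM (lev_ge0 t) _ (lev_le t) small) _ => //.
have -> : B * q ^- 48 * (B * q ^+ 96) = B ^+ 2 * q ^+ 48 by field; exact: q_neq0.
apply: ler_pM; rewrite ?exprn_ge0 ?(ltW B_gt0) ?(ltW q_gt0) ?qX_le//.
by rewrite (ler_weXn2l B1).
Qed.

Lemma lev_kap_le t : lev t / ikap t <= q ^- 192.
Proof.
rewrite ler_pdivrMr ?ikap_gt0//; apply: le_trans (lev_le_rad t) _.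
have -> : q ^- 192 * ikap t = crad t / q ^+ 96; last by [].
by rewrite ikapE; field; exact: q_neq0.
Qed.

Lemma lev_kap_mul_le t : (t < T)%N -> lev t / ikap t * t%:R <= B ^+ 2 * q ^- 48.
Proof.
move=> tT; have [big|/ltW small] := leP (B * q ^+ 96) t%:R.
  have tp := big_gt0 big.
  rewrite mulrAC ler_pdivrMr ?ikap_gt0//.
  apply: le_trans (ler_wpM2r (ltW tp) (lev_big tT big)) _.
  rewrite divfK ?gt_eqF// ikapE.
  have -> : B ^+ 2 * q ^- 48 * (q ^+ 96 * crad t) = B * crad t * (B * q ^+ 48).
    by field; exact: q_neq0.
  rewrite expr2 mulrA ler_wpM2l ?crad_le_q// mulr_ge0 ?(ltW B_gt0) ?(ltW (crad_gt0 _))//.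
have l0 : 0 <= lev t / ikap t by rewrite divr_ge0 ?lev_ge0// ltW// ikap_gt0.
apply: le_trans (ler_pM l0 _ (lev_kap_le t) small) _ => //.
have -> : q ^- 192 * (B * q ^+ 96) = B * q ^- 96.
  by field; exact: q_neq0.
rewrite expr2 -mulrA ler_wpM2l ?(ltW B_gt0)//.
apply: le_trans (_ : q ^- 48 <= _); last by rewrite ler_peMl ?B1// invr_ge0 ltW ?qX_gt0.
by rewrite lef_pV2 ?posrE ?qX_gt0// qX_le.
Qed.

Lemma lev_gform t v : (t < T)%N -> inner (x t) v ^+ 2 <= lev t * gform x ikap t v v.
Proof.
move=> tT; apply: le_trans (cauchy_schwarz _ _) _.
have vv0 := inner_ge0 v.
apply: le_trans (ler_wpM2r vv0 (inner_le_rad tT)) _.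
have g0 : 0 <= gform x ikap t v v.
  exact: (gform_ge0 (ikap_gt0 t) (gform_ge x ikap t)).
have b1 : crad t ^+ 2 * inner v v <= crad t / q ^+ 96 * gform x ikap t v v.
  have := gform_ge x ikap t v; rewrite ikapE => h.
  have -> : crad t ^+ 2 * inner v v = crad t / q ^+ 96 * (q ^+ 96 * crad t * inner v v).
    by field; exact: q_neq0.
  by rewrite ler_wpM2l// divr_ge0 ?(ltW (crad_gt0 _)) ?(ltW (qX_gt0 _)).
rewrite /lev; case: ifP => // /andP[_ big].
rewrite minr_pMl// le_min b1 /=.
have tp := big_gt0 big.
have -> : crad t ^+ 2 * inner v v = B * crad t ^+ 2 / t%:R * (t%:R / B * inner v v).
  by field; rewrite !gt_eqF// B_gt0.
rewrite ler_wpM2l//.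
  by apply: divr_ge0 (ltW tp); apply: mulr_ge0 (sqr_ge0 _); exact: ltW B_gt0.
apply: le_trans (hx2 v (ltnW tT) big) _.
by rewrite /gform -[leLHS]addr0 lerD// mulr_ge0 ?(ltW (ikap_gt0 _)).
Qed.

(** * Residuals of a fixed response *)

Section Response.
Variables (w : nat -> R) (W : R).
Hypothesis W1 : 1 <= W.
Hypothesis hw : \sum_(t < T) w t ^+ 4 <= W ^+ 2 * q ^+ 192.

Local Notation res := (ridge_res x ikap w).
Local Notation sol := (ridge_sol x ikap w).

Lemma W_ge0 : 0 <= W. Proof. exact: le_trans ler01 W1. Qed.

(** Cauchy-Schwarz against the fourth moments: the partial sums are of order [sqrt (T t)] rather
    than [T], which compensates the large leverages of the early rounds. *)
Lemma sumsq_le t : (t <= T)%N -> \sum_(s < t) w s ^+ 2 <= W * q ^+ 96 * Num.sqrt t%:R.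
Proof.
move=> tT; apply: le_of_sqr.
  exact: mulr_ge0 (mulr_ge0 W_ge0 (qX_ge0 _)) (sqrtr_ge0 _).
have := sum_cauchy_schwarz t (fun=> 1) (fun s => w s ^+ 2).
under eq_bigr do rewrite mul1r.
under [X in _ <= X * _ -> _]eq_bigr do rewrite expr1n.
rewrite sumr_const card_ord => /le_trans; apply.
under eq_bigr do rewrite -exprM.
have -> : (W * q ^+ 96 * Num.sqrt t%:R) ^+ 2 = W ^+ 2 * q ^+ 192 * Num.sqrt t%:R ^+ 2 by ring.
rewrite sqr_sqrtr ?ler0n// mulrC ler_wpM2r ?ler0n//.
apply: le_trans hw; apply: (@partial_sum_le _ (fun s => w s ^+ 4)) => // s _.
by rewrite exprn_even_ge0.
Qed.

Lemma sumsqT_le : \sum_(s < T) w s ^+ 2 <= W * q ^+ 192.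
Proof.
apply: le_trans (sumsq_le (leqnn T)) _.
by rewrite sqrtT -mulrA -exprD lexx.
Qed.

Lemma sqr_le_W t : (t < T)%N -> w t ^+ 2 <= W * q ^+ 96.
Proof.
move=> tT; apply: le_of_sqr; first exact: mulr_ge0 W_ge0 (qX_ge0 _).
have -> : (w t ^+ 2) ^+ 2 = w t ^+ 4 by ring.
have -> : (W * q ^+ 96) ^+ 2 = W ^+ 2 * q ^+ 192 by ring.
apply: le_trans hw; rewrite (bigD1 (Ordinal tT))//= lerDl.
by apply: sumr_ge0 => s _; rewrite exprn_even_ge0.
Qed.

(** The geometric mean of [lev_le] and [lev_mul_le]. *)
Lemma sqrt_lev_le t : (t < T)%N -> lev t * Num.sqrt t%:R <= B ^+ 2 * q ^+ 24.
Proof.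
move=> tT; apply: le_of_sqr; first by rewrite mulr_ge0 ?exprn_ge0 ?(ltW B_gt0) ?(ltW q_gt0).
have -> : (lev t * Num.sqrt t%:R) ^+ 2 = lev t * (lev t * Num.sqrt t%:R ^+ 2) by ring.
rewrite sqr_sqrtr ?ler0n//.
apply: le_trans (ler_pM (lev_ge0 t) _ (lev_le t) (lev_mul_le tT)) _.
  by rewrite mulr_ge0 ?lev_ge0.
by rewrite le_eqVlt; apply/orP; left; apply/eqP; field; exact: q_neq0.
Qed.

Lemma sqrt_lev_kap_le t : (t < T)%N ->
  lev t / ikap t * Num.sqrt t%:R <= B * q ^- 120.
Proof.
move=> tT; apply: le_of_sqr; first by rewrite mulr_ge0 ?(ltW B_gt0) ?invr_ge0 ?(ltW (qX_gt0 _)).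
have l0 : 0 <= lev t / ikap t by rewrite divr_ge0 ?lev_ge0// ltW// ikap_gt0.
have -> : (lev t / ikap t * Num.sqrt t%:R) ^+ 2 =
  lev t / ikap t * (lev t / ikap t * Num.sqrt t%:R ^+ 2) by ring.
rewrite sqr_sqrtr ?ler0n//.
apply: le_trans (ler_pM l0 _ (lev_kap_le t) (lev_kap_mul_le tT)) _.
  by rewrite mulr_ge0.
by rewrite le_eqVlt; apply/orP; left; apply/eqP; field; exact: q_neq0.
Qed.

Lemma pred_sqr_le t : (t < T)%N ->
  inner (x t) (sol t) ^+ 2 <= B ^+ 2 * W * q ^+ 120.
Proof.
move=> tT.
apply: le_trans (ridge_pred_sqr ikap_gt0 lev_ge0 (fun t v => @lev_gform t v) w tT) _.
apply: le_trans (ler_wpM2l (lev_ge0 t) (sumsq_le (ltnW tT))) _.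
rewrite mulrCA; apply: le_trans (ler_wpM2l _ (sqrt_lev_le tT)) _.
  exact: mulr_ge0 W_ge0 (qX_ge0 _).
by rewrite le_eqVlt; apply/orP; left; apply/eqP; ring.
Qed.

Lemma res_sqr_le t : (t < T)%N -> res t ^+ 2 <= 4 * B ^+ 2 * W * q ^+ 120.
Proof.
move=> tT; have h1 := sqr_le_W tT; have h2 := pred_sqr_le tT.
have h3 : W * q ^+ 96 <= B ^+ 2 * W * q ^+ 120.
  rewrite -mulrA; apply: le_trans (ler_peMl _ (BX_ge1 2)); last first.
    exact: mulr_ge0 W_ge0 (qX_ge0 _).
  by rewrite ler_wpM2l ?W_ge0// qX_le.
have := sqr_ge0 (w t + inner (x t) (sol t)); rewrite /ridge_res.
move: (w t) (inner _ _) h1 h2 h3 => a b h1 h2 h3 h4.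
have -> : 4 * B ^+ 2 * W * q ^+ 120 = 4 * (B ^+ 2 * W * q ^+ 120) by ring.
by lra.
Qed.

Definition ols := ridge_sol x (fun=> 0) w T.
Definition ols_min := \sum_(t < T) (w t - inner (x t) ols) ^+ 2.

Lemma T_big : B * q ^+ 96 <= T%:R.
Proof.
rewrite Tq; apply: le_trans (_ : q * q ^+ 96 <= _); first by rewrite ler_wpM2r ?qX_ge0.
by rewrite -exprS qX_le.
Qed.

Lemma ols_coercive (v : 'cV[R]_d) : q ^+ 192 / B * inner v v <= gform x (fun=> 0) T v v.
Proof.
rewrite -Tq; apply: le_trans (hx2 v (leqnn T) T_big) _.
by rewrite /gform mul0r addr0 lexx.
Qed.

Let c0 : 0 < q ^+ 192 / B. Proof. by rewrite divr_gt0 ?B_gt0 ?qX_gt0. Qed.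

Lemma ols_min_le u : ols_min <= \sum_(t < T) (w t - inner (x t) u) ^+ 2.
Proof.
have := ridge_min_le c0 ols_coercive w u.
by rewrite /ridge_min /ridge_obj !mul0r !addr0.
Qed.

Lemma ols_min_ge0 : 0 <= ols_min.
Proof. by apply: sumr_ge0 => t _; exact: sqr_ge0. Qed.

Lemma ols_min_le_W : ols_min <= W * q ^+ 192.
Proof.
apply: le_trans (ols_min_le 0) _; apply: le_trans sumsqT_le.
by apply: ler_sum => t _; rewrite inner0r subr0.
Qed.

Lemma ols_norm : inner ols ols <= B * W.
Proof.
rewrite -(ler_pM2l c0); apply: le_trans (ols_coercive _) _.
apply: le_trans (ridge_sol_gform (lexx 0) c0 ols_coercive w) _.
have -> : q ^+ 192 / B * (B * W) = W * q ^+ 192; last exact: sumsqT_le.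
by field; rewrite gt_eqF// B_gt0.
Qed.

Lemma Bq48 : B * q ^- 48 <= 1.
Proof.
rewrite ler_pdivrMr ?qX_gt0// mul1r; apply: le_trans Bq _.
exact: (@qX_le 1 48).
Qed.

(** Regret against the least squares predictor. The factor [1 + lev t] and the regularization of the
    comparator each cost order [T ^ (3/4)]. *)
Lemma res_sum_upper : \sum_(t < T) res t ^+ 2 <= ols_min + 3 * B ^+ 2 * W * q ^+ 144.
Proof.
have := ridge_regret ikap_gt0 ikap_leS lev_ge0 (fun t v => @lev_gform t v) w ols (leqnn T).
rewrite /ridge_obj -/ols_min => reg.
have b0 : 0 <= B * q ^- 48 by apply: mulr_ge0; rewrite ?invr_ge0 ?qX_ge0// ltW ?B_gt0.
apply: le_trans (_ : (1 + B * q ^- 48) *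
   (\sum_(t < T) res t ^+ 2 / (1 + lev t)) <= _).
  rewrite mulr_sumr; apply: ler_sum => t _.
  have l0 := lev_ge0 t; have l1 := lev_le t.
  rewrite mulrA ler_pdivlMr; last by lra.
  by rewrite mulrC ler_wpM2r ?sqr_ge0// lerD2l.
have b1 : 0 <= 1 + B * q ^- 48 by lra.
apply: le_trans (ler_wpM2l b1 reg) _.
have kn : ikap T * inner ols ols <= B ^+ 2 * W * q ^+ 144.
  have -> : B ^+ 2 * W * q ^+ 144 = (B * q ^+ 144) * (B * W) by ring.
  by apply: ler_pM; rewrite ?inner_ge0 ?ols_norm ?ikap_le_q ?(ltW (ikap_gt0 _)).
have h1 : B * q ^- 48 * ols_min <= B ^+ 2 * W * q ^+ 144.
  apply: le_trans (ler_wpM2l b0 ols_min_le_W) _.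
  have -> : B * q ^- 48 * (W * q ^+ 192) = B * W * q ^+ 144 by field; exact: q_neq0.
  have -> : B ^+ 2 * W * q ^+ 144 = B * (B * W * q ^+ 144) by ring.
  apply: ler_peMl B1; apply: mulr_ge0 (qX_ge0 _).
  by apply: mulr_ge0 W_ge0; exact: ltW B_gt0.
have h2 : B * q ^- 48 * (ikap T * inner ols ols) <= B ^+ 2 * W * q ^+ 144.
  apply: le_trans kn; apply: ler_piMl Bq48.
  by rewrite mulr_ge0 ?inner_ge0 ?(ltW (ikap_gt0 _)).
lra.
Qed.

Lemma res_sum_le : \sum_(t < T) res t ^+ 2 <= 4 * B ^+ 2 * W * q ^+ 192.
Proof.
apply: le_trans res_sum_upper _.
have h : B ^+ 2 * W * q ^+ 144 <= B ^+ 2 * W * q ^+ 192.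
  by rewrite ler_wpM2l ?qX_le// mulr_ge0 ?W_ge0// exprn_ge0// ltW ?B_gt0.
have h' : W * q ^+ 192 <= B ^+ 2 * W * q ^+ 192.
  have -> : B ^+ 2 * W * q ^+ 192 = B ^+ 2 * (W * q ^+ 192) by ring.
  by apply: ler_peMl (BX_ge1 2); exact: mulr_ge0 W_ge0 (qX_ge0 _).
have := ols_min_le_W; lra.
Qed.

(* The regret of the regularized leader is bounded below as well; the first
   [T ^ (3/4)] rounds, where the predictors may be large, cost little. *)
Lemma res_sum_lower :
  ols_min <= \sum_(t < T) res t ^+ 2 + 3 * B ^+ 2 * W * q ^+ 168.
Proof.
(* The cut at [T ^ (3/4)] balances two errors of order [q ^+ 168]: the [m] first rounds cost
   [sqrt (T m)], and later predictors, of squared norm at most about [sqrt (T / m)], are multiplied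
   by the total growth [q ^+ 144] of [ikap]. *)
pose m := (Num.truncn (q ^+ 144)).+1.
have qm : q ^+ 144 <= m%:R by apply: ltW; exact: truncnS_gt.
have mq : m%:R <= 2 * q ^+ 144.
  have : (Num.truncn (q ^+ 144))%:R <= q ^+ 144 by rewrite truncn_le ?qX_ge0.
  by rewrite /m -natr1; have := qX_ge1 144; lra.
have mT : (m <= T)%N.
  rewrite -(ler_nat R) Tq; apply: le_trans mq _.
  apply: le_trans (_ : q * q ^+ 144 <= _); last by rewrite -exprS qX_le.
  by rewrite ler_wpM2r ?qX_ge0//; exact: le_trans B2 Bq.
have big t : (m <= t)%N -> B * q ^+ 96 <= t%:R.
  move=> mt; apply: le_trans (_ : m%:R <= _); last by rewrite ler_nat.
  apply: le_trans qm; apply: le_trans (_ : q * q ^+ 96 <= _).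
    by rewrite ler_wpM2r ?qX_ge0.
  by rewrite -exprS qX_le.
have beta_le t : (m <= t)%N -> (t <= T)%N -> inner (sol t) (sol t) <= B * W * q ^+ 24.
  move=> mt tT; have tp := big_gt0 (big t mt).
  have h1 : t%:R / B * inner (sol t) (sol t) <= W * q ^+ 96 * Num.sqrt t%:R.
    apply: le_trans (hx2 _ tT (big t mt)) _; apply: le_trans (sumsq_le tT).
    apply: le_trans (@ridge_sol_pos_gform _ _ x _ ikap_gt0 w t).
    rewrite /gform -[leLHS]addr0; apply: lerD => //.
    by rewrite mulr_ge0 ?inner_ge0 ?(ltW (ikap_gt0 _)).
  have s0 : 0 < Num.sqrt (t%:R : R) by rewrite sqrtr_gt0.
  have sE : (t%:R : R) = Num.sqrt t%:R * Num.sqrt t%:R by rewrite -expr2 sqr_sqrtr// ltW.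
  have sq : q ^+ 72 <= Num.sqrt t%:R.
    rewrite -(@ger0_norm _ (q ^+ 72)) ?qX_ge0// -sqrtr_sqr ler_wsqrtr//.
    rewrite -exprM; apply: le_trans qm _; by rewrite ler_nat.
  rewrite -(ler_pM2l (_ : 0 < Num.sqrt t%:R / B)); last by rewrite divr_gt0 ?B_gt0.
  have -> : Num.sqrt t%:R / B * (B * W * q ^+ 24) = W * (Num.sqrt t%:R * q ^+ 24).
    by field; rewrite gt_eqF// B_gt0.
  apply: le_trans (_ : W * q ^+ 96 <= _).
    rewrite -(ler_pM2r s0); apply: le_trans h1; rewrite [in leRHS]sE.
    rewrite le_eqVlt; apply/orP; left; apply/eqP; ring.
  rewrite ler_wpM2l ?W_ge0// (_ : q ^+ 96 = q ^+ 72 * q ^+ 24); last by ring.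
  by rewrite ler_wpM2r ?qX_ge0.
have bw0 : 0 <= B * W * q ^+ 24.
  by apply: mulr_ge0 (qX_ge0 _); apply: mulr_ge0 W_ge0; exact: ltW B_gt0.
have claim n : (m <= n)%N -> (n <= T)%N -> ridge_min x ikap w n <=
    ridge_min x ikap w m + \sum_(t < n) res t ^+ 2
    + (ikap n - ikap m) * (B * W * q ^+ 24).
  elim: n => [|n IH]; first by rewrite leqn0 => /eqP m0; rewrite m0.
  rewrite leq_eqVlt => /predU1P[<- _|].
    by rewrite subrr mul0r addr0 lerDl sumr_ge0// => t _; exact: sqr_ge0.
  rewrite ltnS => mn nT; apply: le_trans (@ridge_min_lower _ _ x _ ikap_gt0 w n) _.
  rewrite big_ord_recr /=; have := IH mn (ltnW nT).
  have := ler_wpM2l (_ : 0 <= ikap n.+1 - ikap n) (beta_le n mn (ltnW nT)).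
  by rewrite subr_ge0 => /(_ (ikap_leS n)); lra.
have S_le : ols_min <= ridge_min x ikap w T.
  apply: le_trans (ols_min_le (sol T)) _; rewrite /ridge_min /ridge_obj lerDl.
  by rewrite mulr_ge0 ?inner_ge0 ?(ltW (ikap_gt0 _)).
have m_le : ridge_min x ikap w m <= 2 * W * q ^+ 168.
  apply: le_trans (@ridge_min_pos_le _ _ x _ ikap_gt0 w m 0) _.
  rewrite /ridge_obj inner0r mulr0 addr0.
  apply: le_trans (_ : \sum_(s < m) w s ^+ 2 <= _).
    by apply: ler_sum => s _; rewrite inner0r subr0.
  apply: le_trans (sumsq_le mT) _.
  have -> : 2 * W * q ^+ 168 = W * q ^+ 96 * (2 * q ^+ 72) by ring.
  apply: ler_wpM2l; first exact: mulr_ge0 W_ge0 (qX_ge0 _).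
  apply: le_of_sqr; first by apply: mulr_ge0 (qX_ge0 _).
  rewrite sqr_sqrtr ?ler0n//; apply: le_trans mq _.
  have -> : (2 * q ^+ 72) ^+ 2 = 4 * q ^+ 144 by ring.
  by rewrite ler_wpM2r ?qX_ge0//; lra.
have k_le : (ikap T - ikap m) * (B * W * q ^+ 24) <= B ^+ 2 * W * q ^+ 168.
  have -> : B ^+ 2 * W * q ^+ 168 = B * q ^+ 144 * (B * W * q ^+ 24) by ring.
  rewrite ler_wpM2r//; apply: le_trans (ikap_le_q T).
  by have := ikap_gt0 m; lra.
have WB : W * q ^+ 168 <= B ^+ 2 * W * q ^+ 168.
  have -> : B ^+ 2 * W * q ^+ 168 = B ^+ 2 * (W * q ^+ 168) by ring.
  by apply: ler_peMl (BX_ge1 2); exact: mulr_ge0 W_ge0 (qX_ge0 _).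
have := claim T mT (leqnn T); lra.
Qed.

(** Of the fourth power of a prediction, two factors divided by [ikap t] are at most [c] uniformly;
    the other two are bounded by squares of the response and of the residual, whose sums are of
    order [T]. *)
Lemma res_fourth_sum :
  \sum_(t < T) res t ^+ 4 / ikap t <= 88 * B ^+ 3 * W ^+ 2 * q ^+ 168.
Proof.
pose c := W * B * q ^- 24.
have c00 : 0 <= c.
  by apply: mulr_ge0; [apply: mulr_ge0 W_ge0 (ltW B_gt0)|rewrite invr_ge0 qX_ge0].
have term t : (t < T)%N -> res t ^+ 4 / ikap t <=
    8 * q ^- 96 * w t ^+ 4 + 16 * c * w t ^+ 2 + 16 * c * res t ^+ 2.
  move=> tT; pose a := inner (x t) (sol t).
  have k0 := ikap_gt0 t; have kn : 0 <= (ikap t)^-1 by rewrite invr_ge0 ltW.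
  have ki : (ikap t)^-1 <= q ^- 96.
    by rewrite lef_pV2 ?posrE ?qX_gt0// ikap_ge.
  have ac : a ^+ 2 / ikap t <= c.
    apply: le_trans (ler_wpM2r kn (ridge_pred_sqr ikap_gt0 lev_ge0
      (fun t v => @lev_gform t v) w tT)) _.
    apply: le_trans (_ : lev t * (W * q ^+ 96 * Num.sqrt t%:R) / ikap t <= _).
      by rewrite ler_wpM2r// ler_wpM2l ?lev_ge0// sumsq_le// ltnW.
    have -> : lev t * (W * q ^+ 96 * Num.sqrt t%:R) / ikap t =
      W * q ^+ 96 * (lev t / ikap t * Num.sqrt t%:R) by ring.
    apply: le_trans (ler_wpM2l _ (sqrt_lev_kap_le tT)) _.
      exact: mulr_ge0 W_ge0 (qX_ge0 _).
    rewrite le_eqVlt; apply/orP; left; apply/eqP; rewrite /c.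
    by field; exact: q_neq0.
  have rE : res t = w t - a by [].
  have f4 : res t ^+ 4 <= 8 * w t ^+ 4 + 8 * a ^+ 4.
    rewrite rE; move: (w t) a {ac rE} => u v.
    have -> : 8 * u ^+ 4 + 8 * v ^+ 4 = (u - v) ^+ 4 + ((u + v) ^+ 4 + 6 * (u ^+ 2 - v ^+ 2) ^+ 2).
      by ring.
    rewrite lerDl; apply: addr_ge0; first by rewrite exprn_even_ge0.
    by apply: mulr_ge0 (sqr_ge0 _).
  have a2 : a ^+ 2 <= 2 * w t ^+ 2 + 2 * res t ^+ 2.
    by rewrite rE; have := sqr_ge0 (2 * w t - a); lra.
  apply: le_trans (ler_wpM2r kn f4) _.
  have -> : (8 * w t ^+ 4 + 8 * a ^+ 4) / ikap t =
    8 * (w t ^+ 4 / ikap t) + 8 * (a ^+ 2 / ikap t * a ^+ 2) by ring.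
  have h1 : w t ^+ 4 / ikap t <= q ^- 96 * w t ^+ 4.
    by rewrite mulrC ler_wpM2r// exprn_even_ge0.
  have h2 : a ^+ 2 / ikap t * a ^+ 2 <= c * (2 * w t ^+ 2 + 2 * res t ^+ 2).
    by apply: ler_pM; rewrite ?sqr_ge0// mulr_ge0 ?sqr_ge0.
  lra.
apply: le_trans (ler_sum _ (fun (t : 'I_T) _ => term t (ltn_ord t))) _.
rewrite !big_split /= -!mulr_sumr.
have i96 : 0 <= 8 * q ^- 96 by rewrite mulr_ge0 ?invr_ge0 ?qX_ge0.
have i16 : 0 <= 16 * c by rewrite mulr_ge0.
have s1 := ler_wpM2l i96 hw.
have s2 := ler_wpM2l i16 sumsqT_le.
have s3 := ler_wpM2l i16 res_sum_le.
apply: le_trans (lerD (lerD s1 s2) s3) _.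
pose e := B * W ^+ 2 * q ^+ 168.
have e0 : 0 <= e.
  by apply: mulr_ge0 (qX_ge0 _); apply: mulr_ge0 (ltW B_gt0) (sqr_ge0 _).
have t1 : 8 * q ^- 96 * (W ^+ 2 * q ^+ 192) = 8 * W ^+ 2 * q ^+ 96 by field; exact: q_neq0.
have t2 : 16 * c * (W * q ^+ 192) = 16 * e by rewrite /c /e; field; exact: q_neq0.
have t3 : 16 * c * (4 * B ^+ 2 * W * q ^+ 192) = 64 * (B ^+ 2 * e).
  by rewrite /c /e; field; exact: q_neq0.
have t4 : 88 * B ^+ 3 * W ^+ 2 * q ^+ 168 = 88 * (B ^+ 2 * e) by rewrite /e; ring.
have t5 : e <= B ^+ 2 * e by rewrite ler_peMl ?BX_ge1.
have t6 : W ^+ 2 * q ^+ 96 <= e.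
  apply: le_trans (_ : W ^+ 2 * q ^+ 168 <= _).
    by rewrite ler_wpM2l ?sqr_ge0 ?qX_le.
  have -> : e = B * (W ^+ 2 * q ^+ 168) by rewrite /e; ring.
  by apply: ler_peMl B1; exact: mulr_ge0 (sqr_ge0 _) (qX_ge0 _).
rewrite t1 t2 t3 t4; lra.
Qed.

(** By [lev_le] and [lev_mul_le], [lev t ^ 2] is at most a multiple of [q ^+ 48 / (t + 1)]; the
    harmonic sum is logarithmic in [T] and costs one more [q]. *)
Lemma lev_sqsum : \sum_(t < T) lev t ^+ 2 <= 400 * B ^+ 4 * q ^+ 49.
Proof.
have term t : (t < T)%N -> lev t ^+ 2 <= 2 * B ^+ 4 * q ^+ 48 * t.+1%:R^-1.
  move=> tT; rewrite ler_pdivlMr ?ltr0n// -natr1 mulrDr mulr1.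
  have h1 : lev t ^+ 2 * t%:R <= B ^+ 4 * q ^+ 48.
    have -> : lev t ^+ 2 * t%:R = lev t * (lev t * t%:R) by ring.
    apply: le_trans (ler_pM (lev_ge0 t) _ (lev_le t) (lev_mul_le tT)) _.
      by rewrite mulr_ge0 ?lev_ge0.
    rewrite le_eqVlt; apply/orP; left; apply/eqP; by field; exact: q_neq0.
  have h2 : lev t ^+ 2 <= B ^+ 4 * q ^+ 48.
    apply: le_trans (_ : 1 <= _); last by rewrite mulr_ege1 ?BX_ge1 ?qX_ge1.
    have l1 : lev t <= 1 := le_trans (lev_le t) Bq48.
    by rewrite expr2 mulr_ile1 ?lev_ge0.
  lra.
apply: le_trans (ler_sum _ (fun (t : 'I_T) _ => term t (ltn_ord t))) _.
rewrite -mulr_sumr; have bq0 : 0 <= 2 * B ^+ 4 * q ^+ 48.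
  by apply: mulr_ge0 (qX_ge0 _); rewrite mulr_ge0// exprn_ge0// ltW// B_gt0.
have hT : \sum_(i < T) (i.+1%:R^-1 : R) <= 200 * q.
  have [n Tn] : exists n, T = n.+1 by exists T.-1; rewrite prednK// T_gt0.
  rewrite Tn; apply: le_trans (harmonic_le_ln n) _; rewrite -Tn Tq lnXn ?q_gt0//.
  have := ln_le_subr1 q_gt0; rewrite -(mulr_natl (ln q)).
  have := q_ge1; lra.
apply: le_trans (ler_wpM2l bq0 hT) _.
rewrite le_eqVlt; apply/orP; left; apply/eqP; ring.
Qed.

(** Cauchy-Schwarz between squared leverages and fourth moments gives half the exponent 49 + 192,
    rounded up. *)
Lemma lev_sqr_sum : \sum_(t < T) lev t * w t ^+ 2 <= 20 * B ^+ 2 * W * q ^+ 121.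
Proof.
have b20 : 0 <= 20 * B ^+ 2 * W.
  by apply: mulr_ge0 W_ge0; rewrite mulr_ge0 ?sqr_ge0.
apply: le_of_sqr; first exact: mulr_ge0 b20 (qX_ge0 _).
apply: le_trans (sum_cauchy_schwarz T lev (fun t => w t ^+ 2)) _.
have h : \sum_(i < T) (w i ^+ 2) ^+ 2 <= W ^+ 2 * q ^+ 192.
  by apply: le_trans hw; apply: ler_sum => t _; rewrite -exprM.
apply: le_trans (ler_pM _ _ lev_sqsum h) _.
- by apply: sumr_ge0 => t _; exact: sqr_ge0.
- by apply: sumr_ge0 => t _; exact: sqr_ge0.
have -> : 400 * B ^+ 4 * q ^+ 49 * (W ^+ 2 * q ^+ 192) = (20 * B ^+ 2 * W) ^+ 2 * q ^+ 241 by ring.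
have -> : (20 * B ^+ 2 * W * q ^+ 121) ^+ 2 = (20 * B ^+ 2 * W) ^+ 2 * q ^+ 242 by ring.
by rewrite ler_wpM2l ?sqr_ge0 ?qX_le.
Qed.

End Response.
End Experiment.

(** * Sigmoids *)

Section Concavity.
Context {R : realType}.

(** The sign of [s] selects the side from which the difference quotients are taken. *)
Lemma is_derive_slope (g : R -> R) (a l m : R) (s : R) (e : R) : s != 0 -> 0 < e ->
  is_derive a 1 g l -> (forall h, 0 < h < e -> m <= (g (a + s * h) - g a) / (s * h)) ->
  m <= l.
Proof.
move=> s0 e0 [d <-] hm; move/cvg_ex: d => [l' hl'].
have -> : 'D_1 g a = l' by exact: cvg_lim.
rewrite leNgt; apply/negP => lm.
have /cvgrPdist_lt /(_ (m - l')) := hl'; rewrite subr_gt0 => /(_ lm) [r /= r0 hr].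
pose h := Num.min (e / 2) (r / (2 * `|s|)).
have ns0 : 0 < `|s| by rewrite normr_gt0.
have h0 : 0 < h by rewrite lt_min !divr_gt0// mulr_gt0.
have he : h < e by rewrite /h gt_min; apply/orP; left; lra.
have hs : `|s * h| < r.
  rewrite normrM (gtr0_norm h0); apply: le_lt_trans (_ : `|s| * (r / (2 * `|s|)) < _).
    by rewrite ler_pM2l// ge_min lexx orbT.
  by have -> : `|s| * (r / (2 * `|s|)) = r / 2; [field; rewrite gt_eqF|lra].
have sh0 : s * h != 0 by rewrite mulf_neq0// gt_eqF.
have := hr (s * h); rewrite /= sub0r normrN => /(_ hs sh0).
rewrite /GRing.scale /= mulr1 => hlt.
have := hm h; rewrite h0 he => /(_ isT).
move: hlt; rewrite [s * h + a]addrC mulrC distrC ltr_norml => /andP[_]; lra.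
Qed.

(** The derivative [k] need not be continuous at the endpoints; its values there are limits of
    slopes, which the mean value theorem turns into values at interior points. *)
Lemma derive_nonincr_closed (g k : R -> R) (a b : R) : a < b ->
  (forall u : R, a <= u <= b -> is_derive u 1 g (k u)) ->
  (forall u v : R, a < u -> u <= v -> v < b -> k v <= k u) -> k b <= k a.
Proof.
move=> ab gk hk.
have slope u v : a <= u -> u < v -> v <= b -> exists2 c, u < c < v & g v - g u = k c * (v - u).
  move=> au uv vb; have [||c cin ->] := @MVT R g k u v uv.
  - by move=> c; rewrite in_itv /= => /andP[uc cv]; apply: gk; lra.
  - apply: continuous_in_subspaceT => c; rewrite inE /= in_itv /= => ?.
    by apply: is_derive_continuous; apply: gk; lra.
  by move: cin; rewrite in_itv /=; exists c.
pose w := (a + b) / 2.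
have la : k w <= k a.
  apply: (@is_derive_slope g a (k a) (k w) 1 ((b - a) / 2)); rewrite ?oner_eq0//; first lra.
    by apply: gk; lra.
  move=> h /andP[h0 hw]; rewrite mul1r.
  have h1 : a < a + h by lra.
  have h2 : a + h <= b by lra.
  have [c cin ->] := slope _ _ (lexx _) h1 h2.
  rewrite addrC addKr mulfK ?gt_eqF//; apply: hk; rewrite /w; lra.
have lb : - k w <= - k b.
  have gN : is_derive b 1 (fun u => - g u) (- k b).
    by have := gk b; rewrite lexx (ltW ab) => /(_ isT) h; exact: is_deriveN.
  apply: (@is_derive_slope _ b (- k b) (- k w) (-1) ((b - a) / 2) _ _ gN).
  - by rewrite oppr_eq0 oner_eq0.
  - lra.
  move=> h /andP[h0 hw].
  have h1 : a <= b - h by lra.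
  have h2 : b - h < b by lra.
  have [c cin e] := slope _ _ h1 h2 (lexx _).
  have -> : (- g (b + -1 * h) - - g b) / (-1 * h) = - (g b - g (b - h)) / h.
    by rewrite mulN1r invrN; ring.
  rewrite e (_ : b - (b - h) = h); last by ring.
  rewrite mulNr mulfK ?gt_eqF// lerN2; apply: hk; rewrite /w; lra.
lra.
Qed.

(** Induction on the exceptional points: the interval is cut at each of them, and the
    closed-interval lemma glues the pieces because [g] is differentiable there as well. *)
Lemma derive_nonincr (g k k' : R -> R) (l : seq R) (a b : R) : a <= b ->
  (forall u : R, a <= u <= b -> is_derive u 1 g (k u)) ->
  (forall u : R, a < u < b -> u \notin l -> is_derive u 1 k (k' u) /\ k' u <= 0) ->
  k b <= k a.
Proof.
elim: l a b => [|s l IH] a b; rewrite le_eqVlt => /predU1P[->//|ab] gk kk.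
  apply: derive_nonincr_closed gk _ => // u v au; rewrite le_eqVlt => /predU1P[->//|uv] vb.
  have [||c cin e] := @MVT R k k' u v uv.
  - by move=> c; rewrite in_itv /= => ?; apply: (kk _ _ _).1 => //; lra.
  - apply: continuous_in_subspaceT => c; rewrite inE /= in_itv /= => ?.
    by apply: is_derive_continuous; apply: (kk _ _ _).1 => //; lra.
  rewrite -subr_le0 e; move: cin; rewrite in_itv /= => cin.
  have := (kk c _ isT).2 => /(_ _); have -> : a < c < b by lra.
  by move=> /(_ isT) k0; apply: mulr_le0_ge0 => //; lra.
have [sin|sout] := boolP (a < s < b); last first.
  apply: IH (ltW ab) gk _ => u uab ul; apply: kk => //; rewrite in_cons negb_or ul andbT.
  by apply/negP => /eqP us; move: sout; rewrite -us uab.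
have h1 : k s <= k a.
  apply: IH => [|u hu|u hu ul]; [lra|apply: gk; lra|apply: kk; first lra].
  by rewrite in_cons negb_or ul andbT lt_eqF//; lra.
have h2 : k b <= k s.
  apply: IH => [|u hu|u hu ul]; [lra|apply: gk; lra|apply: kk; first lra].
  by rewrite in_cons negb_or ul andbT gt_eqF//; lra.
exact: le_trans h2 h1.
Qed.

End Concavity.

Section Sigmoid.
Context {R : realType} (phi : R -> R) (b1 b2 b3 : R).
Hypothesis hb1 : 0 < b1.
Hypothesis hb2 : 0 < b2.
Hypothesis hphi : sigmoid_condition b1 b2 b3 phi.

Local Notation f := (fun u => (phi u)^-1).

Lemma phi_gt0 u : 0 < phi u. Proof. by have [/(_ u) /andP[]] := hphi. Qed.
Lemma phi_lt1 u : phi u < 1. Proof. by have [/(_ u) /andP[]] := hphi. Qed.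
Lemma phi_compl_gt0 u : 0 < 1 - phi u. Proof. by rewrite subr_gt0 phi_lt1. Qed.

Lemma phi_lt : {homo phi : u v / u < v}. Proof. by have [_ [[]]] := hphi. Qed.

Lemma phi_sym u : 1 - phi u = phi (- u).
Proof. by have [_ [[_ h _] _]] := hphi; rewrite -(h u); ring. Qed.

Lemma phi_inj : injective phi.
Proof.
move=> u v e; apply/eqP; case: (ltgtP u v) => // /phi_lt; rewrite e ltxx//.
Qed.

Lemma phi_le u v : u <= v -> phi u <= phi v.
Proof. by rewrite le_eqVlt => /predU1P[->//|/phi_lt/ltW]. Qed.

Lemma phi0 : phi 0 = 1 / 2.
Proof. by have := phi_sym 0; rewrite oppr0; lra. Qed.

Lemma inv_phi_is_derive (u : R) : is_derive u 1 f (derive1 f u).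
Proof.
have [_ [_ [_ [/(_ u) [d _] _ _]]]] := hphi.
by apply: DeriveDef => //; rewrite derive1E.
Qed.

Lemma inv_phi_lip_le u v : u <= v -> 0 <= f u - f v <= b1 * (v - u).
Proof.
move=> uv; rewrite subr_ge0 lef_pV2 ?posrE ?phi_gt0// phi_le//=.
have [||c _ e] := @MVT_segment R f (derive1 f) u v uv.
- by move=> c _; exact: inv_phi_is_derive.
- apply: continuous_in_subspaceT => c _; exact: is_derive_continuous (inv_phi_is_derive c).
have [_ [_ [_ [/(_ c) [_ d] _ _]]]] := hphi.
rewrite -opprB e -mulNr ler_wpM2r//; lra.
Qed.

Lemma inv_phi_lip u v : `|f u - f v| <= b1 * `|u - v|.
Proof.
have [uv|/ltW vu] := leP u v.
  have /andP[h1 h2] := inv_phi_lip_le uv.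
  by rewrite (ger0_norm h1) distrC ger0_norm// subr_ge0.
have /andP[h1 h2] := inv_phi_lip_le vu.
by rewrite distrC (ger0_norm h1) ger0_norm// subr_ge0.
Qed.

Lemma inv_phic_lip u v : `|(1 - phi u)^-1 - (1 - phi v)^-1| <= b1 * `|u - v|.
Proof.
rewrite !phi_sym; have := inv_phi_lip (- u) (- v).
by rewrite (_ : - u - - v = - (u - v)) ?normrN//; ring.
Qed.

Lemma inv_phi_le u : f u <= 2 + b1 * `|u|.
Proof.
have := inv_phi_lip u 0; rewrite subr0 phi0 ler_norml => /andP[_]; lra.
Qed.

Lemma inv_phic_le u : (1 - phi u)^-1 <= 2 + b1 * `|u|.
Proof. by rewrite phi_sym; apply: le_trans (inv_phi_le _) _; rewrite normrN. Qed.

Lemma convex_midpoint (g : R -> R) (u v : R) : convex_function [set: R^o] g ->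
  g ((u + v) / 2) <= (g u + g v) / 2.
Proof.
move=> cvx; have h01 : (0 : R) <= 2^-1 by rewrite invr_ge0.
have h11 : 2^-1 <= (1 : R) by rewrite invf_le1// ler1n.
have : g (2^-1 * u + (1 - 2^-1) * v) <= 2^-1 * g u + (1 - 2^-1) * g v.
  by apply: (cvx (Itv01 h01 h11) u v); rewrite inE.
have E : 1 - 2^-1 = 2^-1 :> R by lra.
by rewrite !E -!mulrDr !(mulrC 2^-1).
Qed.

Lemma inv_phi_midpoint u v : f ((u + v) / 2) <= (f u + f v) / 2.
Proof. by have [_ [_ [[h _] _]]] := hphi; exact: (@convex_midpoint f). Qed.

Lemma inv_phic_midpoint u v :
  (1 - phi ((u + v) / 2))^-1 <= ((1 - phi u)^-1 + (1 - phi v)^-1) / 2.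
Proof. by have [_ [_ [[_ h] _]]] := hphi; exact: (@convex_midpoint (fun u => (1 - phi u)^-1)). Qed.

Lemma phi_continuous : continuous phi.
Proof.
move=> u; have -> : phi = (fun v => (f v)^-1) by apply/funext => v; rewrite invrK.
apply: (@continuousV _ _ f u); last exact: is_derive_continuous (inv_phi_is_derive u).
by rewrite invr_eq0 gt_eqF// phi_gt0.
Qed.

Lemma phi_cvg1 : phi u @[u --> +oo] --> (1 : R).
Proof. by have [_ [[]]] := hphi. Qed.

Lemma phi_gt (e : R) : 0 < e -> exists2 M : R, 0 < M & forall u : R, M <= u -> 1 - e < phi u.
Proof.
move=> e0; have /cvgrPdist_lt /(_ _ e0) [M [_ hM]] := phi_cvg1.
exists (Num.max M 0 + 1) => [|u Mu]; first by rewrite ltr_wpDl// le_max lexx orbT.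
have /hM : M < u by apply: lt_le_trans Mu; rewrite ltr_pwDr// le_max lexx.
by rewrite /= ger0_norm ?(ltW (phi_compl_gt0 _))//; lra.
Qed.

Lemma phi_surj q : 0 < q < 1 -> exists u, phi u = q.
Proof.
move=> /andP[q0 q1]; have q1' : 0 < 1 - q by lra.
have [M M0 hM] := phi_gt q1'; have [N N0 hN] := phi_gt q0.
have MN : - N <= M by lra.
have h1 : q < phi M by have := hM M (lexx _); lra.
have h2 : phi (- N) < q by rewrite -phi_sym; have := hN N (lexx _); lra.
have [||c _ <-] := @IVT R phi (- N) M q MN; last by exists c.
  by apply: continuous_subspaceT; exact: phi_continuous.
by rewrite min_l ?max_r ?(phi_le MN)// (ltW h1) (ltW h2).
Qed.

(* By (3b) the function [1/phi u - (b2/2)/(1+u)] is concave on [u >= 0]; being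
   bounded it is nondecreasing, hence below its limit [1]. *)
Lemma inv_phi_tail (u : R) : 0 <= u -> f u <= 1 + b2 / 2 / (1 + u).
Proof.
pose g v := f v - b2 / 2 / (1 + v).
pose k v := derive1 f v + b2 / 2 / (1 + v) ^+ 2.
have gk (v : R) : 0 <= v -> is_derive v 1 g (k v).
  move=> v0; have v1 : 1 + v != 0 by rewrite gt_eqF//; lra.
  have h1 : is_derive v 1 (fun w : R => 1 + w) 1.
    apply: (is_derive_eq (is_deriveD (is_derive_cst (1 : R) v 1) (is_derive_idfun v))).
    by rewrite add0r.
  have := is_deriveB (inv_phi_is_derive v) (is_derive_scale (b2 / 2) (is_derive_inv v1 h1)).
  by move=> h; apply: (is_derive_eq h); rewrite /k; field.
have [_ [_ [_ [_ [S /finite_seqP[l Sl] hS] _]]]] := hphi.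
have kmono (v w : R) : 0 <= v -> v <= w -> k w <= k v.
  move=> v0 vw; apply: (@derive_nonincr R g k
    (fun u => derive1n 2 f u - b2 / (1 + u) ^+ 3) l) => //.
    by move=> c ?; apply: gk; lra.
  move=> c cvw cl; have c0 : 0 <= c by lra.
  have [|d1 d2] := hS c; first by rewrite Sl => /= cl'; move: cl; rewrite cl'.
  have c1 : (1 + c) ^+ 2 != 0 by rewrite gt_eqF// exprn_gt0//; lra.
  have c2 : 1 + c != 0 by rewrite gt_eqF//; lra.
  split; last by move: d2; rewrite ger0_norm//; lra.
  have h1 : is_derive c 1 (fun w : R => 1 + w) 1.
    apply: (is_derive_eq (is_deriveD (is_derive_cst (1 : R) c 1) (is_derive_idfun c))).
    by rewrite add0r.
  have h2 := is_derive_mul h1 h1.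
  have h3 := is_derive_scale (b2 / 2) (is_derive_inv (f := fun w : R => (1 + w) * (1 + w)) c1 h2).
  have h4 : is_derive c 1 (derive1 f) (derive1n 2 f c).
    by split; [exact: d1 | rewrite -derive1E].
  apply: (is_derive_eq (is_deriveD h4 h3)).
  by field.
have gle (v : R) : 0 <= v -> 1 - b2 / 2 <= g v.
  move=> v0; rewrite /g; have : 1 <= f v by rewrite invf_ge1 ?phi_gt0// ltW// phi_lt1.
  have : b2 / 2 / (1 + v) <= b2 / 2.
    by rewrite ler_pdivrMr; [have := mulr_ge0 (ltW hb2) v0; lra|lra].
  lra.
have slope (v w : R) : 0 <= v -> v <= w -> exists2 c, v <= c <= w & g w - g v = k c * (w - v).
  move=> v0 vw; have [||c cin ->] := @MVT_segment R g k v w vw.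
  - by move=> c; rewrite in_itv /= => ?; apply: gk; lra.
  - apply: continuous_in_subspaceT => c; rewrite inE /= in_itv /= => ?.
    by apply: is_derive_continuous; apply: gk; lra.
  by move: cin; rewrite in_itv /=; exists c.
(* By concavity a negative slope would persist; [h] is a length over which it would drive [g] below
   its lower bound. *)
have k0 (v : R) : 0 <= v -> 0 <= k v.
  move=> v0; rewrite leNgt; apply/negP => kv.
  pose h := (g v - (1 - b2 / 2) + 1) / - k v.
  have h0 : 0 < h by rewrite divr_gt0 ?oppr_gt0//; have := gle v v0; lra.
  have [|c cin e] := slope v (v + h) v0; first lra.
  have : k c <= k v by apply: kmono; lra.
  move: e; rewrite (_ : v + h - v = h); last by ring.
  have := gle (v + h); rewrite addr_ge0 ?(ltW h0)// => /(_ isT).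
  have hk : k v * h = - (g v - (1 - b2 / 2) + 1) by rewrite /h; field; rewrite lt_eqF.
  move=> g1 g2 kc; have : k c * h <= k v * h by rewrite ler_pM2r.
  lra.
move=> u0; suff : g u <= 1 by rewrite /g; lra.
suff main (e : R) : 0 < e -> g u <= 1 + e by apply/ler_addgt0Pr => e; exact: main.
move=> e0; have e1 : 0 < e / (1 + e) by rewrite divr_gt0//; lra.
have [M M0 hM] := phi_gt e1.
have [w [uw Mw]] : exists w : R, u <= w /\ M <= w.
  by exists (Num.max u M); rewrite !le_max !lexx orbT.
have [c cin e2] := slope u w u0 uw.
have kc : 0 <= k c by apply: k0; lra.
have : 0 <= g w - g u by rewrite e2 mulr_ge0// subr_ge0.
have : g w <= f w.
  have w1 : 0 <= 1 + w by apply: addr_ge0 => //; exact: le_trans uw.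
  have h2 : 0 <= b2 / 2 := divr_ge0 (ltW hb2) (ler0n R 2).
  by have := divr_ge0 h2 w1; rewrite /g; lra.
have : f w <= 1 + e.
  have := hM w Mw; have -> : 1 - e / (1 + e) = (1 + e)^-1 by field; rewrite gt_eqF//; lra.
  move=> hw; rewrite -[1 + e]invrK lef_pV2 ?posrE ?phi_gt0// ?invr_gt0 ?(ltW hw)//; lra.
lra.
Qed.

End Sigmoid.

(** * Regret of follow-the-regularized-leader *)

Section SigmoidFTRLRegret.
Context {R : realType} (phi : R -> R) (b1 b2 b3 : R).
Hypothesis hb1 : 0 < b1.
Hypothesis hb2 : 0 < b2.
Hypothesis hphi : sigmoid_condition b1 b2 b3 phi.
Implicit Types (a b kap u v U : R).

Let pg := phi_gt0 hphi.
Let pc := phi_compl_gt0 hphi.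

Lemma psi_ge0 u : 0 <= Defs.psi u.
Proof.
rewrite /Defs.psi; apply: addr_ge0; last by rewrite exprn_ge0.
by apply: mulr_ge0 (sqr_ge0 _); rewrite invr_ge0.
Qed.

Lemma psi0 : Defs.psi (0 : R) = 0.
Proof. by rewrite /Defs.psi normr0 !expr0n /= mulr0 addr0. Qed.

Lemma cube_le_psi u : `|u| ^+ 3 <= Defs.psi u.
Proof. by rewrite /Defs.psi lerDr; apply: mulr_ge0 (sqr_ge0 _); rewrite invr_ge0. Qed.

(** Midpoint convexity of the cube with a modulus growing like [|u| + |v|]. Pairs of equal and of
    opposite signs reduce to two polynomial inequalities in the absolute values. *)
Lemma cube_midgap u v :
  (`|u| + `|v|) * (u - v) ^+ 2 / 4 <= `|u| ^+ 3 + `|v| ^+ 3 - 2 * `|(u + v) / 2| ^+ 3.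
Proof.
have E : 2 * `|(u + v) / 2| ^+ 3 = `|u + v| ^+ 3 / 4.
  by rewrite normrM (@ger0_norm _ 2^-1) ?invr_ge0//; field.
rewrite E.
have same (r s : R) : 0 <= r -> 0 <= s ->
    (r + s) * (r - s) ^+ 2 / 4 <= r ^+ 3 + s ^+ 3 - (r + s) ^+ 3 / 4.
  move=> r0 s0.
  have -> : r ^+ 3 + s ^+ 3 - (r + s) ^+ 3 / 4 = 3 * ((r + s) * (r - s) ^+ 2 / 4) by field.
  have : 0 <= (r + s) * (r - s) ^+ 2 / 4.
    by apply: mulr_ge0; [apply: mulr_ge0 (sqr_ge0 _); lra|rewrite invr_ge0].
  lra.
have opp (r s : R) : 0 <= r -> 0 <= s ->
    (r + s) * (r + s) ^+ 2 / 4 <= r ^+ 3 + s ^+ 3 - `|r - s| ^+ 3 / 4.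
  move=> r0 s0; have n0 : `|r - s| <= r + s by rewrite ler_norml; lra.
  have h : `|r - s| ^+ 3 <= (r + s) * (r - s) ^+ 2.
    by rewrite exprS real_normK ?num_real// ler_wpM2r ?sqr_ge0.
  have e : 4 * (r ^+ 3 + s ^+ 3) - (r + s) * (r + s) ^+ 2 = 3 * ((r + s) * (r - s) ^+ 2) by ring.
  have : 0 <= (r + s) * (r - s) ^+ 2 by apply: mulr_ge0 (sqr_ge0 _); lra.
  lra.
have [u0|/ltW u0] := leP 0 u; have [v0|/ltW v0] := leP 0 v.
- by rewrite !ger0_norm ?addr_ge0//; exact: same.
- rewrite (ger0_norm u0) (ler0_norm v0).
  by have := opp u (- v) u0 (_ : 0 <= - v); rewrite oppr_ge0 opprK => /(_ v0).
- rewrite (ler0_norm u0) (ger0_norm v0).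
  have := opp (- u) v (_ : 0 <= - u) v0; rewrite oppr_ge0 => /(_ u0).
  rewrite (_ : - u - v = - (u + v)) ?normrN; last by ring.
  by rewrite (_ : (- u + v) ^+ 2 = (u - v) ^+ 2) //; ring.
- rewrite (ler0_norm u0) (ler0_norm v0) (@ler0_norm _ (u + v)); last by lra.
  have := same (- u) (- v); rewrite !oppr_ge0 u0 v0 => /(_ isT isT).
  rewrite (_ : (- u - - v) ^+ 2 = (u - v) ^+ 2); last by ring.
  by rewrite (_ : - u - v = - (u + v)); last by ring.
Qed.

Lemma psi_midgap u v :
  (1 + `|u|) * (u - v) ^+ 2 / 4 <= Defs.psi u + Defs.psi v - 2 * Defs.psi ((u + v) / 2).
Proof.
have h := cube_midgap u v.
have h2 : 0 <= `|v| * (u - v) ^+ 2 / 4.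
  by apply: mulr_ge0; [apply: mulr_ge0 (sqr_ge0 _)|rewrite invr_ge0].
have e : 2^-1 * u ^+ 2 + 2^-1 * v ^+ 2 - 2 * (2^-1 * ((u + v) / 2) ^+ 2) = (u - v) ^+ 2 / 4.
  by field.
rewrite /Defs.psi; lra.
Qed.

(** The loss in the logit coordinate, with treatment probability [phi u]: there [1 / phi] is convex
    and Lipschitz and the regularizer is explicit. *)
Definition floss a b u : R := a / phi u + b / (1 - phi u).
Definition fobj a b kap u : R := floss a b u + kap * Defs.psi u.

Lemma flossD a b a' b' u : floss (a + a') (b + b') u = floss a b u + floss a' b' u.
Proof. by rewrite /floss; ring. Qed.

Lemma floss_ge0 a b u : 0 <= a -> 0 <= b -> 0 <= floss a b u.
Proof. by move=> a0 b0; rewrite addr_ge0// divr_ge0 ?(ltW (pg _)) ?(ltW (pc _)). Qed.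

Lemma floss_lip a b u v : 0 <= a -> 0 <= b ->
  floss a b u - floss a b v <= b1 * (a + b) * `|u - v|.
Proof.
move=> a0 b0; have h1 := inv_phi_lip hphi u v; have h2 := inv_phic_lip hphi u v.
have := ler_wpM2l a0 (le_trans (ler_norm _) h1).
have := ler_wpM2l b0 (le_trans (ler_norm _) h2).
rewrite /floss; lra.
Qed.

(** The left-hand side is the minimum of [a / p + b / (1 - p)] over [p]; the difference is an
    explicit square. *)
Lemma floss_sqrt a b u : 0 <= a -> 0 <= b ->
  (Num.sqrt a + Num.sqrt b) ^+ 2 <= floss a b u.
Proof.
move=> a0 b0; rewrite /floss -{2}(sqr_sqrtr a0) -{2}(sqr_sqrtr b0).
have := pg u; have := pc u; move: (Num.sqrt a) (Num.sqrt b) (phi u) => r s p p1 p0.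
rewrite -subr_ge0.
have -> : r ^+ 2 / p + s ^+ 2 / (1 - p) - (r + s) ^+ 2 = (r * (1 - p) - s * p) ^+ 2 / (p * (1 - p)).
  by field; rewrite !gt_eqF.
by rewrite divr_ge0 ?sqr_ge0// mulr_ge0 ?(ltW p0) ?(ltW p1).
Qed.

Lemma fobj_midpoint a b kap u v : 0 <= a -> 0 <= b -> 0 <= kap ->
  2 * fobj a b kap ((u + v) / 2) <=
  fobj a b kap u + fobj a b kap v - kap * ((1 + `|u|) * (u - v) ^+ 2 / 4).
Proof.
move=> a0 b0 k0; have h1 := ler_wpM2l a0 (inv_phi_midpoint hphi u v).
have h2 := ler_wpM2l b0 (inv_phic_midpoint hphi u v).
have h3 := ler_wpM2l k0 (psi_midgap u v).
rewrite /fobj /floss; lra.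
Qed.

(** Minimization over bounded logits, so that the regret bounds apply to the clipped design. *)
Definition fminimizer a b kap U u :=
  `|u| <= U /\ forall v, `|v| <= U -> fobj a b kap u <= fobj a b kap v.

(** The midpoint of the minimizer and a competitor is feasible, hence no better than the minimizer:
    midpoint convexity replaces first-order conditions. *)
Lemma fminimizer_gap a b kap U u v : 0 <= a -> 0 <= b -> 0 <= kap ->
  fminimizer a b kap U u -> `|v| <= U ->
  kap * ((1 + `|u|) * (u - v) ^+ 2 / 4) <= fobj a b kap v - fobj a b kap u.
Proof.
move=> a0 b0 k0 [uU um] vU; have := fobj_midpoint u v a0 b0 k0.
have /um : `|(u + v) / 2| <= U.
  rewrite normrM (@ger0_norm _ 2^-1) ?invr_ge0//.
  by rewrite ler_pdivrMr//; apply: le_trans (ler_normD _ _) _; lra.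
lra.
Qed.

Lemma fobj_continuous a b kap : continuous (fobj a b kap).
Proof.
move=> u; have pn : phi u != 0 by rewrite gt_eqF.
have pn' : 1 - phi u != 0 by rewrite gt_eqF.
have cp := phi_continuous hphi (x := u).
apply: continuousD; last first.
  apply: continuousM; first exact: cst_continuous.
  apply: continuousD.
    by apply: continuousM; [exact: cst_continuous|exact: exprn_continuous].
  apply: (@continuous_comp _ _ _ (fun v : R => `|v|) (fun v : R => v ^+ 3)).
    exact: norm_continuous.
  exact: exprn_continuous.
apply: continuousD.
  by apply: continuousM; [exact: cst_continuous|exact: continuousV].
apply: continuousM; first exact: cst_continuous.
by apply: continuousV => //; apply: continuousB => //; exact: cst_continuous.
Qed.

Lemma fminimizer_ex a b kap U : 0 <= U -> exists u, fminimizer a b kap U u.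
Proof.
move=> U0; have [||c cin hc] := @EVT_min R (fobj a b kap) (- U) U.
- by lra.
- by apply: continuous_subspaceT; exact: fobj_continuous.
exists c; split; first by move: cin; rewrite in_itv /= ler_norml.
by move=> v; rewrite ler_norml => vU; apply: hc; rewrite in_itv.
Qed.

Definition fargmin a b kap U : R := get (fminimizer a b kap U).

Lemma fargminP a b kap U : 0 <= U -> fminimizer a b kap U (fargmin a b kap U).
Proof. by move=> U0; have [u hu] := fminimizer_ex a b kap U0; exact: getPex (ex_intro _ u hu). Qed.

Definition fmin a b kap U : R := fobj a b kap (fargmin a b kap U).

Lemma fmin_le a b kap U v : 0 <= U -> `|v| <= U -> fmin a b kap U <= fobj a b kap v.
Proof. by move=> U0; exact: (fargminP a b kap U0).2. Qed.

Lemma fminE a b kap U u : 0 <= U -> fminimizer a b kap U u -> fmin a b kap U = fobj a b kap u.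
Proof.
move=> U0 [uU um]; apply/eqP; rewrite eq_le fmin_le//= um//.
exact: (fargminP a b kap U0).1.
Qed.

Lemma fobj_global_min a b kap : 0 <= a -> 0 <= b -> 0 < kap ->
  exists u, forall v, fobj a b kap u <= fobj a b kap v.
Proof.
move=> a0 b0 k0; pose J0 := fobj a b kap 0.
have fl0 := floss_ge0 0 a0 b0.
have J00 : 0 <= J0 by rewrite /J0 /fobj psi0 mulr0 addr0.
(* For logits beyond this bound the cubic penalty alone exceeds the value of the objective at 0. *)
pose U := J0 / kap + 1.
have U1 : 1 <= U by rewrite lerDr divr_ge0// ltW.
have U0 : 0 <= U by lra.
have [u [uU um]] := fminimizer_ex a b kap U0.
exists u => v; have [vU|/ltW Uv] := leP `|v| U; first exact: um.
apply: le_trans (um 0 _) _; first by rewrite normr0.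
rewrite -/J0; apply: le_trans (_ : kap * Defs.psi v <= _); last first.
  by rewrite /fobj lerDr floss_ge0.
rewrite mulrC -ler_pdivrMr//; apply: le_trans (cube_le_psi v).
apply: le_trans (_ : `|v| <= _); first by rewrite /U in Uv; lra.
by rewrite -[leLHS]expr1 ler_weXn2l//; lra.
Qed.

(** Comparison with the logit 0, that is, with the fair coin. This is how the cubic regularizer
    limits the logits. *)
Lemma fobj_global_min_cube a b kap u : 0 <= a -> 0 <= b -> 0 < kap ->
  (forall v, fobj a b kap u <= fobj a b kap v) -> kap * `|u| ^+ 3 <= 2 * (a + b).
Proof.
move=> a0 b0 k0 /(_ 0); have := floss_ge0 u a0 b0.
have := ler_wpM2l (ltW k0) (cube_le_psi u).
have -> : fobj a b kap 0 = 2 * (a + b).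
  by rewrite /fobj psi0 mulr0 addr0 /floss (phi0 hphi); field.
by rewrite /fobj; lra.
Qed.

(** * Regret along a sequence of losses *)

Section Sequence.
Variables (al be kap u : nat -> R) (n : nat) (U : R).
Hypothesis U0 : 0 <= U.
Hypothesis al0 : forall t, 0 <= al t.
Hypothesis be0 : forall t, 0 <= be t.
Hypothesis kap0 : forall t, 0 < kap t.
Hypothesis kap_le : forall t, kap t <= kap t.+1.

Let A t := \sum_(s < t) al s.
Let B t := \sum_(s < t) be s.

Hypothesis um : forall t, (t < n)%N -> fminimizer (A t) (B t) (kap t) U (u t).

Let A0 t : 0 <= A t. Proof. by apply: sumr_ge0. Qed.
Let B0 t : 0 <= B t. Proof. by apply: sumr_ge0. Qed.

Let fobjS t v k : fobj (A t.+1) (B t.+1) k v = fobj (A t) (B t) k v + floss (al t) (be t) v.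
Proof. by rewrite /fobj /A /B !big_ord_recr /= flossD; ring. Qed.

(** Two bounds on the gain from knowing the current loss: Lipschitz constant squared over the
    curvature of the objective at its minimizer, and the loss itself. *)
Definition fstep t : R := Num.min
  ((b1 * (al t + be t)) ^+ 2 / (kap t * (1 + `|u t|))) (floss (al t) (be t) (u t)).

Lemma fstep_bound t v : (t < n)%N -> `|v| <= U ->
  floss (al t) (be t) (u t) - floss (al t) (be t) v
   - (fobj (A t) (B t) (kap t) v - fobj (A t) (B t) (kap t) (u t)) <= fstep t.
Proof.
move=> tn vU; have := fminimizer_gap (A0 t) (B0 t) (ltW (kap0 t)) (um tn) vU.
have lip := floss_lip (u t) v (al0 t) (be0 t).
have fl0 := floss_ge0 v (al0 t) (be0 t).
have k0 := kap0 t.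
set g := b1 * (al t + be t) in lip *; set D := `|u t - v| in lip *.
have -> : (u t - v) ^+ 2 = D ^+ 2 by rewrite real_normK ?num_real.
set c := kap t * (1 + `|u t|) => gap.
have c0 : 0 < c by rewrite mulr_gt0// ltr_pwDl.
have D0 : 0 <= D by exact: normr_ge0.
have gapE : kap t * ((1 + `|u t|) * D ^+ 2 / 4) = c * D ^+ 2 / 4 by rewrite /c; ring.
rewrite /fstep -/g -/c le_min; apply/andP; split; last first.
  have : 0 <= c * D ^+ 2 / 4.
    by apply: mulr_ge0; [apply: mulr_ge0 (ltW c0) (sqr_ge0 _)|rewrite invr_ge0].
  by move: gap; rewrite gapE; lra.
have h : g * D - c * D ^+ 2 / 4 <= g ^+ 2 / c.
  rewrite -subr_ge0; have -> : g ^+ 2 / c - (g * D - c * D ^+ 2 / 4) = (g - c * D / 2) ^+ 2 / c.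
    by field; rewrite gt_eqF.
  by rewrite divr_ge0 ?sqr_ge0// ltW.
by move: gap; rewrite gapE; lra.
Qed.

(** The losses paid are compared by induction with the constrained minimum of the objective.
    Increasing [kap] can only raise that minimum, as [psi] is nonnegative. *)
Lemma ftrl_upper v : `|v| <= U ->
  \sum_(t < n) floss (al t) (be t) (u t) <=
  fobj (A n) (B n) (kap n) v + \sum_(t < n) fstep t.
Proof.
move=> vU; apply: le_trans (_ : fmin (A n) (B n) (kap n) U + \sum_(t < n) fstep t <= _); last first.
  by rewrite lerD2r fmin_le.
have : forall t, (t <= n)%N -> \sum_(s < t) floss (al s) (be s) (u s) <=
    fmin (A t) (B t) (kap t) U + \sum_(s < t) fstep s; last exact.
elim=> [_|t IH tn].
  rewrite !big_ord0 addr0 /fmin /fobj; apply: addr_ge0; first exact: floss_ge0.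
  by rewrite mulr_ge0 ?psi_ge0// ltW.
rewrite !big_ord_recr /=; have {}IH := IH (ltnW tn).
rewrite (fminE U0 (um tn)) in IH.
pose v' := fargmin (A t.+1) (B t.+1) (kap t.+1) U.
have [v'U _] := fargminP (A t.+1) (B t.+1) (kap t.+1) U0.
have := fstep_bound tn v'U.
have : fobj (A t.+1) (B t.+1) (kap t) v' <= fmin (A t.+1) (B t.+1) (kap t.+1) U.
  by rewrite /fmin /fobj lerD2l ler_wpM2r ?psi_ge0.
rewrite fobjS -/v'; lra.
Qed.

(** A logit outside [[-V, V]] is moved to the nearest endpoint; one inverse probability decreases
    and the other exceeds 1 there by at most the tail bound. *)
Lemma floss_clip a b V v : 0 <= a -> 0 <= b -> 0 <= V -> exists2 v', `|v'| <= V &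
  floss a b v' <= floss a b v + (a + b) * (b2 / 2 / (1 + V)).
Proof.
move=> a0 b0 V0; have ab0 : 0 <= (a + b) * (b2 / 2 / (1 + V)).
  by rewrite mulr_ge0 ?addr_ge0// !divr_ge0 ?(ltW hb2) ?addr_ge0.
have tail := inv_phi_tail hb2 hphi V0.
set e := b2 / 2 / (1 + V) in ab0 tail *.
have e0 : 0 <= e by rewrite !divr_ge0 ?(ltW hb2) ?addr_ge0.
have inv1 w : 1 <= (phi w)^-1 by rewrite invf_ge1// ltW// (phi_lt1 hphi).
have inv1c w : 1 <= (1 - phi w)^-1 by rewrite (phi_sym hphi).
have mono w w' : w <= w' -> (phi w')^-1 <= (phi w)^-1.
  by move=> ww; rewrite lef_pV2 ?posrE// (phi_le hphi).
have monoc w w' : w <= w' -> (1 - phi w)^-1 <= (1 - phi w')^-1.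
  by move=> ww; rewrite !(phi_sym hphi) mono// lerN2.
have [vV|Vv] := leP `|v| V; first by exists v => //; rewrite lerDl.
move: Vv; rewrite lter_normr => /orP[Vv|Vv].
  exists V; first by rewrite ger0_norm.
  have h1 : (phi V)^-1 <= (phi v)^-1 + e by have := inv1 v; lra.
  have := ler_wpM2l a0 h1; have := ler_wpM2l b0 (monoc _ _ (ltW Vv)).
  by have : 0 <= b * e := mulr_ge0 b0 e0; rewrite /floss; lra.
exists (- V); first by rewrite normrN ger0_norm.
have h1 : (1 - phi (- V))^-1 <= (1 - phi v)^-1 + e.
  by rewrite (phi_sym hphi (- V)) opprK; have := inv1c v; lra.
have vV : v <= - V by lra.
have := ler_wpM2l b0 h1; have := ler_wpM2l a0 (mono _ _ vV).
by have : 0 <= a * e := mulr_ge0 a0 e0; rewrite /floss; lra.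
Qed.

Lemma min1_le_ln (r : R) : 1 <= r -> Num.min 1 (r - 1) <= 2 * ln r.
Proof.
move=> r1; have r0 : 0 < r by lra.
have : 1 - r^-1 <= ln r.
  have := ln_le_subr1 (_ : 0 < r^-1); rewrite invr_gt0 => /(_ r0).
  by rewrite lnV ?posrE//; lra.
have ri : r^-1 * r = 1 by rewrite mulVf// gt_eqF.
have i0 : 0 < r^-1 by rewrite invr_gt0.
rewrite ge_min; have [r2|/ltW r2] := leP r 2; move=> h; apply/orP.
  right; apply: le_trans (_ : 2 * (1 - r^-1) <= _); last lra.
  have : (r - 2) * (1 - r^-1) <= 0.
    apply: mulr_le0_ge0; first lra.
    by rewrite subr_ge0 invf_le1.
  lra.
left; have : r^-1 <= 2^-1 by rewrite lef_pV2 ?posrE.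
lra.
Qed.

(** The penalty [k * psi v] at the minimizer for [k] is at most [dl], so raising [k] to [k'] costs
    at most [dl * (k' / k - 1)], and also at most [dl]. The logarithm dominates both and telescopes
    over rounds. *)
Lemma fmin_raise a b k k' dl : 0 < k -> k <= k' -> 0 <= dl ->
  (forall c v, 0 < c -> c <= k' -> `|v| <= U -> fmin a b c U <= floss a b v + dl) ->
  fmin a b k' U <= fmin a b k U + 2 * dl * ln (k' / k).
Proof.
move=> k0 kk' dl0 hd; have k'0 : 0 < k' by lra.
pose v := fargmin a b k U; have [vU _] := fargminP a b k U0.
have r1 : 1 <= k' / k by rewrite ler_pdivlMr// mul1r.
have m0 := min1_le_ln r1.
have h1 : fmin a b k' U <= fmin a b k U + dl.
  apply: le_trans (hd k' v k'0 (lexx _) vU) _.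
  by rewrite lerD2r /fmin -/v /fobj lerDl mulr_ge0 ?psi_ge0// ltW.
have h2 : fmin a b k' U <= fmin a b k U + dl * (k' / k - 1).
  apply: le_trans (fmin_le a b k' U0 vU) _.
  have -> : fobj a b k' v = fmin a b k U + (k * Defs.psi v) * (k' / k - 1).
    by rewrite /fmin -/v /fobj; field; rewrite gt_eqF.
  rewrite lerD2l ler_wpM2r ?subr_ge0//.
  by have := hd k v k0 kk' vU; rewrite {1}/fmin -/v /fobj lerD2l.
apply: le_trans (_ : fmin a b k U + dl * Num.min 1 (k' / k - 1) <= _); last first.
  by rewrite lerD2l (mulrC 2) -mulrA ler_wpM2l.
by rewrite minr_pMr// addr_minr mulr1 le_min h1 h2.
Qed.

(** The current decision is a competitor for the next minimum, so the losses paid cover the growth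
    of the minimum except for the part due to [kap]. The free parameter [V] trades the tail of
    [1 / phi] against the penalty at [V]. *)
Lemma ftrl_lower V : 0 <= V -> V <= U ->
  let dl := (A n + B n) * (b2 / 2 / (1 + V)) + kap n * (V ^+ 2 / 2 + V ^+ 3) in
  (Num.sqrt (A n) + Num.sqrt (B n)) ^+ 2 - 2 * dl * ln (kap n / kap 0%N)
  <= \sum_(t < n) floss (al t) (be t) (u t).
Proof.
move=> V0 VU /=; set dl := (A n + B n) * _ + _.
have V1 : 0 <= b2 / 2 / (1 + V) by rewrite !divr_ge0 ?(ltW hb2) ?addr_ge0.
have kmono t m : (t <= m)%N -> kap t <= kap m.
  elim: m => [|m IH]; first by rewrite leqn0 => /eqP ->.
  rewrite leq_eqVlt => /predU1P[->//|]; rewrite ltnS => /IH h.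
  exact: le_trans h (kap_le m).
have psiV v : `|v| <= V -> Defs.psi v <= V ^+ 2 / 2 + V ^+ 3.
  move=> vV; rewrite /Defs.psi mulrC; apply: lerD.
    by rewrite ler_wpM2r ?invr_ge0// -(real_normK (num_real v)) ler_pXn2r ?nnegrE.
  by rewrite ler_pXn2r ?nnegrE.
have pv0 : 0 <= V ^+ 2 / 2 + V ^+ 3 by rewrite addr_ge0 ?divr_ge0 ?exprn_ge0.
have dl0 : 0 <= dl.
  by apply: addr_ge0; apply: mulr_ge0 => //; [exact: addr_ge0|exact: ltW].
have hd t c v : (t <= n)%N -> 0 < c -> c <= kap n -> `|v| <= U ->
    fmin (A t) (B t) c U <= floss (A t) (B t) v + dl.
  move=> tn c0 cn vU; have [v' v'V hv'] := floss_clip v (A0 t) (B0 t) V0.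
  apply: le_trans (fmin_le _ _ _ U0 (le_trans v'V VU)) _.
  rewrite /fobj /dl addrA; apply: lerD.
    apply: le_trans hv' _; rewrite lerD2l ler_wpM2r//.
    by apply: lerD; apply: partial_sum_le.
  by apply: ler_pM => //; [exact: ltW|exact: psi_ge0|exact: psiV].
have main t : (t <= n)%N -> fmin (A t) (B t) (kap t) U <=
    \sum_(s < t) floss (al s) (be s) (u s) + 2 * dl * ln (kap t / kap 0%N).
  elim: t => [_|t IH tn].
    rewrite big_ord0 divff ?gt_eqF// ln1 mulr0 addr0.
    apply: le_trans (fmin_le _ _ _ U0 (_ : `|0| <= U)) _; first by rewrite normr0.
    by rewrite /fobj psi0 mulr0 addr0 /floss /A /B !big_ord0 !mul0r addr0.
  have {}IH := IH (ltnW tn).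
  have h1 := fmin_raise (kap0 t) (kap_le t) dl0
    (fun c v c0 cn => hd t.+1 c v tn c0 (le_trans cn (kmono _ _ tn))).
  have h2 : fmin (A t.+1) (B t.+1) (kap t) U <=
      fmin (A t) (B t) (kap t) U + floss (al t) (be t) (u t).
    by rewrite (fminE U0 (um tn)) -fobjS fmin_le// (um tn).1.
  have h3 : ln (kap t.+1 / kap 0%N) = ln (kap t / kap 0%N) + ln (kap t.+1 / kap t).
    rewrite -lnM ?posrE ?divr_gt0//; congr ln; field.
    by rewrite !gt_eqF.
  rewrite big_ord_recr /= h3; lra.
have := main n (leqnn n).
have : (Num.sqrt (A n) + Num.sqrt (B n)) ^+ 2 <= fmin (A n) (B n) (kap n) U.
  apply: le_trans (floss_sqrt (fargmin (A n) (B n) (kap n) U) (A0 n) (B0 n)) _.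
  by rewrite /fmin /fobj lerDl mulr_ge0 ?psi_ge0// ltW.
lra.
Qed.

End Sequence.
End SigmoidFTRLRegret.

(** * The clipped design *)

Section History.
Context {R : realType}.
Variable step : (nat -> bool) -> (nat -> R) -> nat -> R.
Implicit Types (z : nat -> bool) (p : nat -> R).

(** The recursion of the design for an abstract step, shared by the original and the clipped
    design. *)
Fixpoint history z (t : nat) : seq R :=
  if t is t'.+1 then
    let h := history z t' in rcons h (step z (nth 0 h) t')
  else [::].

Definition hprob z t : R := step z (nth 0 (history z t)) t.

Definition local_step := forall z z' p p' t,
  (forall s, (s < t)%N -> z s = z' s /\ p s = p' s) -> step z p t = step z' p' t.

Lemma size_history z t : size (history z t) = t.
Proof. by elim: t => //= t IH; rewrite size_rcons IH. Qed.

Lemma nth_history z t s : (s < t)%N -> nth 0 (history z t) s = hprob z s.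
Proof.
elim: t => // t IH; rewrite ltnS leq_eqVlt /= nth_rcons size_history.
by move=> /predU1P[->|st]; [rewrite ltnn eqxx|rewrite st IH].
Qed.

Hypothesis loc : local_step.

Lemma hprobE z t : hprob z t = step z (hprob z) t.
Proof. by apply: loc => s st; rewrite nth_history. Qed.

Lemma adapted_hprob t : adapted t (hprob^~ t).
Proof.
have [n] := ubnP t; elim: n t => // n IH t tn z z' zz'.
rewrite !hprobE; apply: loc => s st; split; first exact: zz'.
apply: (IH s (leq_trans st tn)) => r rs; apply: zz'; exact: ltn_trans st.
Qed.

End History.

Section Design.
Context {R : realType} (T d : nat) (phi : R -> R).
Context (x : nat -> 'cV[R]_d) (y : bool -> nat -> R) (U : R).
Implicit Types (z : nat -> bool) (p : nat -> R).

Lemma ridge_local z z' p p' k t :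
  (forall s, (s < t)%N -> z s = z' s /\ p s = p' s) ->
  ridge T x y z p k t = ridge T x y z' p' k t.
Proof.
move=> h; rewrite /ridge; congr argmin; apply/funext => beta; congr (_ + _).
by apply: eq_bigr => s _; rewrite /observed /ipw; have [-> ->] := h s (ltn_ord s).
Qed.

Lemma cum_loss_local z z' p p' k t :
  (forall s, (s < t)%N -> z s = z' s /\ p s = p' s) ->
  cum_loss T x y z p k t = cum_loss T x y z' p' k t.
Proof.
move=> h; apply: eq_bigr => s _.
rewrite (@ridge_local z z' p p' k s) => [|r rs]; last exact: h (ltn_trans rs (ltn_ord s)).
by rewrite /observed /ipw; have [-> ->] := h s (ltn_ord s).
Qed.

Lemma ftrl_step_local : local_step (ftrl_step T phi x y).
Proof.
move=> z z' p p' t h; rewrite /ftrl_step; congr argmin; apply/funext => q.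
by rewrite !(cum_loss_local _ h).
Qed.

Lemma ftrl_historyE z t : ftrl_history T phi x y z t = history (ftrl_step T phi x y) z t.
Proof. by elim: t => //= t ->. Qed.

Lemma ftrl_probE z t : ftrl_prob T phi x y z t = hprob (ftrl_step T phi x y) z t.
Proof. by rewrite /ftrl_prob ftrl_historyE. Qed.

Definition logit (q : R) : R := 'pinv_(fun=> 0) [set: R] phi q.

(** The logit of the original step is kept whenever it is small, so that the two designs agree there
    by definition, without appeal to uniqueness of minimizers. Being a global minimizer, it also
    minimizes over [[-U, U]]. *)
Definition clip_logit z p t : R :=
  let u := logit (ftrl_step T phi x y z p t) in
  if `|u| <= U then u
  else fargmin phi (cum_loss T x y z p true t) (cum_loss T x y z p false t)
         (Defs.eta T x t.+1)^-1 U.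

(* Clipping the logit bounds the inverse probabilities; it changes the design
   only on an event of small probability. *)
Definition clip_step z p t : R := phi (clip_logit z p t).

Definition clip_prob := hprob clip_step.

Lemma clip_logit_local : local_step clip_logit.
Proof.
move=> z z' p p' t h; rewrite /clip_logit (ftrl_step_local h).
by rewrite !(cum_loss_local _ h).
Qed.

Lemma clip_step_local : local_step clip_step.
Proof. by move=> z z' p p' t h; rewrite /clip_step (clip_logit_local h). Qed.

Definition clip_u z t := clip_logit z (clip_prob z) t.

Lemma clip_probE z t : clip_prob z t = phi (clip_u z t).
Proof. by rewrite /clip_prob (hprobE clip_step_local). Qed.

Lemma adapted_clip_prob t : adapted t (clip_prob^~ t).
Proof. exact: adapted_hprob clip_step_local t. Qed.

Lemma adapted_clip_u t : adapted t (clip_u^~ t).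
Proof.
move=> z z' h; apply: clip_logit_local => s st; split; first exact: h.
by apply: adapted_clip_prob => r rs; apply: h; exact: ltn_trans st.
Qed.

(** The test for small logits is made along the clipped design; by strong induction both designs
    then have the same history. *)
Lemma clip_prob_ftrl z n :
  (forall t, (t < n)%N -> `|logit (ftrl_step T phi x y z (clip_prob z) t)| <= U) ->
  (forall t, exists u, phi u = ftrl_step T phi x y z (clip_prob z) t) ->
  injective phi ->
  forall t, (t < n)%N -> clip_prob z t = ftrl_prob T phi x y z t.
Proof.
move=> small surj inj t; have [m] := ubnP t; elim: m t => // m IH t tm tn.
rewrite clip_probE ftrl_probE (hprobE ftrl_step_local) /clip_u /clip_logit small//.
have <- : ftrl_step T phi x y z (clip_prob z) t =
          ftrl_step T phi x y z (hprob (ftrl_step T phi x y) z) t.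
  apply: ftrl_step_local => s st; split=> //.
  by rewrite -ftrl_probE; apply: IH; [exact: leq_trans st tm|exact: ltn_trans tn].
rewrite /logit; have [u <-] := surj t.
rewrite pinvK// inE; by exists u.
Qed.

End Design.

Section FtrlStep.
Context {R : realType} (T d : nat) (phi : R -> R) (b1 b2 b3 : R).
Hypothesis hphi : sigmoid_condition b1 b2 b3 phi.
Context (x : nat -> 'cV[R]_d) (y : bool -> nat -> R).
Variables (z : nat -> bool) (p : nat -> R) (t : nat).
Hypothesis a0 : forall k, 0 <= cum_loss T x y z p k t.
Hypothesis k0 : 0 < (Defs.eta T x t.+1)^-1.

Lemma logitK u : logit phi (phi u) = u.
Proof.
rewrite /logit pinvKV ?inE//; by move=> v w _ _; exact: (phi_inj hphi).
Qed.

(** As [phi] is a bijection onto [(0, 1)] and [Psi (phi u)] is [psi u], minimizing over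
    probabilities amounts to minimizing [fobj] over all logits. *)
Lemma ftrl_stepP : exists u, phi u = ftrl_step T phi x y z p t /\
  forall v, fobj phi (cum_loss T x y z p true t) (cum_loss T x y z p false t)
     (Defs.eta T x t.+1)^-1 u <=
   fobj phi (cum_loss T x y z p true t) (cum_loss T x y z p false t)
     (Defs.eta T x t.+1)^-1 v.
Proof.
set A := cum_loss T x y z p true t; set B := cum_loss T x y z p false t.
set kap := _^-1.
pose F q := A / q + B / (1 - q) + kap * Psi phi q.
have FE u : F (phi u) = fobj phi A B kap u.
  by rewrite /F /fobj /floss /Psi -/(logit phi (phi u)) logitK.
rewrite /ftrl_step -/A -/B -/kap /argmin; set S := [set u | _].
have [u hu] := fobj_global_min hphi (a0 true) (a0 false) k0.
have : S (get S).
  apply: getPex; exists (phi u); split.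
    by rewrite /= (phi_gt0 hphi) (phi_lt1 hphi).
  by move=> q /= /(phi_surj hphi) [v <-]; rewrite -/(F _) -/(F _) !FE; exact: hu.
move: (get S) => q [/= q01 qm]; have [v vq] := phi_surj hphi q01.
exists v; split=> // w; rewrite -!FE vq; apply: qm.
by rewrite /= (phi_gt0 hphi) (phi_lt1 hphi).
Qed.

Lemma logit_ftrl_step_cube : (Defs.eta T x t.+1)^-1 *
  `|logit phi (ftrl_step T phi x y z p t)| ^+ 3 <=
  2 * (cum_loss T x y z p true t + cum_loss T x y z p false t).
Proof.
have [u [<- hu]] := ftrl_stepP; rewrite logitK.
exact: (fobj_global_min_cube hphi (a0 true) (a0 false) k0 hu).
Qed.

Lemma clip_logit_min U : 0 <= U -> fminimizer phi
  (cum_loss T x y z p true t) (cum_loss T x y z p false t) (Defs.eta T x t.+1)^-1 U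
  (clip_logit T phi x y U z p t).
Proof.
move=> U0; rewrite /clip_logit; case: ifP => h; last exact: (fargminP hphi).
by split=> // v _; move: h; have [u [<- hu]] := ftrl_stepP; rewrite logitK.
Qed.

End FtrlStep.

(** * Analysis in expectation *)

Section NoisyRidge.
Context {R : realType} (T d : nat) (x : nat -> 'cV[R]_d) (y : bool -> nat -> R) (B q : R).
Hypothesis B2 : 2 <= B.
Hypothesis Bq : B <= q.
Hypothesis Tq : T%:R = q ^+ 192.
Hypothesis hx3 : forall t, (t < T)%N -> enorm (x t) <= B * q ^+ 48.
Hypothesis hx2 : forall n v, (n <= T)%N -> B * q ^+ 96 <= n%:R ->
  n%:R / B * inner v v <= \sum_(s < n) inner (x s) v ^+ 2.
Variable W : R.
Hypothesis W1 : 1 <= W.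
Hypothesis hy : forall k, \sum_(t < T) y k t ^+ 4 <= W ^+ 2 * q ^+ 192.

Variable p : (nat -> bool) -> nat -> R.
Variable m : R.
Hypothesis pa : forall t, adapted t (p^~ t).
Hypothesis p0 : forall z t, 0 < p z t < 1.
Hypothesis pm : forall z t, (p z t)^-1 <= m.
Hypothesis pcm : forall z t, (1 - p z t)^-1 <= m.
Implicit Types (z : nat -> bool) (k : bool) (t : nat) (g : (nat -> bool) -> R).

Let p01 z t : 0 <= p z t <= 1.
Proof. by have := p0 z t; lra. Qed.

Local Notation E := (pexp p T).
Local Notation kap := (ikap T x).
Local Notation lv := (lev T x B q).

Let kap_gt0 t : 0 < kap t := ikap_gt0 x B2 Bq Tq t.
Let kap_leS t : kap t <= kap t.+1 := ikap_leS x B2 Bq Tq t.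
Let lv_ge0 t : 0 <= lv t := lev_ge0 T x B2 Bq t.
Let lv_gform t v (tT : (t < T)%N) : inner (x t) v ^+ 2 <= lv t * gform x kap t v v :=
  lev_gform B2 Bq Tq hx2 v tT.

Definition parm k z t : R := if k then p z t else 1 - p z t.
Definition pipw k z t : R := ipw z (p z) k t.
(** The centred noise of the inverse-probability-weighted outcome, which is [y k t + xi z k t]. *)
Definition xi z k t : R := y k t * (pipw k z t - 1).
Definition res0 k t : R := ridge_res x kap (y k) t.
Definition npred k z t : R := inner (x t) (ridge_sol x kap (xi z k) t).
(** By linearity of ridge regression this is the residual of the actual predictor, split into a
    deterministic residual and a prediction fitted to noise. *)
Definition ures k z t : R := res0 k t - npred k z t.

Lemma parm_gt0 k z t : 0 < parm k z t.
Proof. by rewrite /parm; have := p0 z t; case: k; lra. Qed.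

Lemma parm_lt1 k z t : parm k z t < 1.
Proof. by rewrite /parm; have := p0 z t; case: k; lra. Qed.

Lemma parmV_le k z t : (parm k z t)^-1 <= m.
Proof. by rewrite /parm; case: k. Qed.

Lemma parmV_gt0 k z t : 0 < (parm k z t)^-1.
Proof. by rewrite invr_gt0 parm_gt0. Qed.

Lemma parmV_ge1 k z t : 1 <= (parm k z t)^-1.
Proof. by rewrite invf_ge1 ?parm_gt0// ltW// parm_lt1. Qed.

Lemma m_ge1 : 1 <= m.
Proof. exact: le_trans (parmV_ge1 true (fun=> true) 0) (parmV_le _ _ _). Qed.

Lemma adapted_parm k t : adapted t (parm k ^~ t).
Proof. by move=> z z' h; rewrite /parm (pa h). Qed.

Lemma pipwE k z t : pipw k z t = (z t == k)%:R / parm k z t.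
Proof. by []. Qed.

Lemma pipw_ge0 k z t : 0 <= pipw k z t.
Proof. by rewrite pipwE divr_ge0 ?ler0n// ltW// parm_gt0. Qed.

Lemma adapted_pipw k t : adapted t.+1 (pipw k ^~ t).
Proof.
move=> z z' h; rewrite !pipwE h// (@adapted_parm k t z z')//.
by move=> s st; apply: h; exact: ltnW.
Qed.

Lemma pipw_upd k z t b : pipw k (upd z t b) t = (b == k)%:R / parm k z t.
Proof. by rewrite pipwE updE (adapted_upd _ _ (adapted_parm k (t := t))). Qed.

Lemma adapted_xi k t : adapted t.+1 (fun z => xi z k t).
Proof. by move=> z z' h; rewrite /xi (adapted_pipw k h). Qed.

Lemma adapted_npred k t : adapted t (npred k ^~ t).
Proof.
move=> z z' h; rewrite /npred; congr inner; apply: eq_ridge_sol => s st.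
by apply: adapted_xi => r rs; apply: h; exact: leq_trans rs st.
Qed.

Lemma adapted_ures k t : adapted t (ures k ^~ t).
Proof. by move=> z z' h; rewrite /ures (adapted_npred k h). Qed.

Lemma cexp_pipw k t g : adapted t g -> cexp p t (fun z => pipw k z t * g z) = g.
Proof.
move=> ag; apply/funext => z; rewrite /cexp !pipw_upd !(adapted_upd _ _ ag).
have := parm_gt0 k z t; rewrite /parm; case: k => /= h; field; rewrite gt_eqF//.
Qed.

Lemma cexp_pipw2 k t g : adapted t g ->
  cexp p t (fun z => pipw k z t ^+ 2 * g z) = fun z => g z / parm k z t.
Proof.
move=> ag; apply/funext => z; rewrite /cexp !pipw_upd !(adapted_upd _ _ ag).
have := parm_gt0 k z t; rewrite /parm; case: k => /= h; field; rewrite gt_eqF//.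
Qed.

Lemma E_pipw k t g : adapted t g -> (t < T)%N ->
  E (fun z => pipw k z t * g z) = E g.
Proof.
move=> ag tT; rewrite (@pexp_cexp _ p pa t) ?cexp_pipw//.
by move=> z z' h; rewrite (adapted_pipw k h) (adaptedW (leqnSn t) ag h).
Qed.

Lemma E_pipw2 k t g : adapted t g -> (t < T)%N ->
  E (fun z => pipw k z t ^+ 2 * g z) = E (fun z => g z / parm k z t).
Proof.
move=> ag tT; rewrite (@pexp_cexp _ p pa t) ?cexp_pipw2//.
by move=> z z' h; rewrite (adapted_pipw k h) (adaptedW (leqnSn t) ag h).
Qed.

Lemma E_xi k t g : adapted t g -> (t < T)%N -> E (fun z => xi z k t * g z) = 0.
Proof.
move=> ag tT; have -> : (fun z => xi z k t * g z) =
    (fun z => y k t * (pipw k z t * g z - g z)) by apply/funext => z; rewrite /xi; ring.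
by rewrite pexpZ pexpB E_pipw// subrr mulr0.
Qed.

Lemma E_xi2 k t g : adapted t g -> (t < T)%N -> (forall z, 0 <= g z) ->
  E (fun z => xi z k t ^+ 2 * g z) <= m * y k t ^+ 2 * E g.
Proof.
move=> ag tT g0.
have -> : (fun z => xi z k t ^+ 2 * g z) = (fun z => y k t ^+ 2 *
    (pipw k z t ^+ 2 * g z - 2 * (pipw k z t * g z) + g z)).
  by apply/funext => z; rewrite /xi; ring.
rewrite pexpZ pexpD pexpB pexpZ E_pipw// E_pipw2//.
rewrite -[leRHS]mulrAC mulrC ler_wpM2r ?sqr_ge0//.
have : E (fun z => g z / parm k z t) <= m * E g.
  rewrite -pexpZ; apply: pexp_le => // z.
  by rewrite mulrC ler_wpM2r// parmV_le.
have : 0 <= E g by apply: pexp_ge0.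
lra.
Qed.

Lemma E_xi2_le k t : (t < T)%N -> E (fun z => xi z k t ^+ 2) <= m * y k t ^+ 2.
Proof.
move=> tT; have := @E_xi2 k t (fun=> 1) (fun _ _ _ => erefl) tT (fun=> ler01).
rewrite pexp_cst mulr1; under [X in pexp _ _ X]eq_fun do rewrite mulr1.
by [].
Qed.

Let lv2 t : 0 < 1 + lv t /\ 1 + lv t <= 2.
Proof.
have := lv_ge0 t; have := lev_le B2 Bq hx3 t.
by have := Bq48 B2 Bq; lra.
Qed.

(* Ridge regression on pure noise with comparator [0]: since the prediction
   [npred] is uncorrelated with the current noise, its energy is paid for by
   the leverages. *)
Lemma npred_energy k : \sum_(t < T) E (fun z => npred k z t ^+ 2)
  <= 40 * B ^+ 2 * W * m * q ^+ 121.
Proof.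
have reg z : \sum_(t < T) (xi z k t - npred k z t) ^+ 2 / (1 + lv t)
    <= \sum_(t < T) xi z k t ^+ 2.
  have := ridge_regret kap_gt0 kap_leS lv_ge0 lv_gform (xi z k) 0 (leqnn T).
  rewrite /ridge_obj inner0r mulr0 addr0 => /le_trans; apply.
  by apply: ler_sum => t _; rewrite inner0r subr0.
have {}reg := pexp_le p01 T reg; rewrite !pexp_sum in reg.
have term t : (t < T)%N -> E (fun z => (xi z k t - npred k z t) ^+ 2 / (1 + lv t)) =
    (E (fun z => xi z k t ^+ 2) + E (fun z => npred k z t ^+ 2)) / (1 + lv t).
  move=> tT; rewrite -pexpD mulrC -pexpZ.
  have -> : (fun z => (xi z k t - npred k z t) ^+ 2 / (1 + lv t)) =
    (fun z => (1 + lv t)^-1 * (xi z k t ^+ 2 + npred k z t ^+ 2)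
       - 2 / (1 + lv t) * (xi z k t * npred k z t)).
    by apply/funext => z; ring.
  by rewrite pexpB !pexpZ E_xi ?mulr0 ?subr0//; exact: adapted_npred.
have n0 t : 0 <= E (fun z => npred k z t ^+ 2) by apply: pexp_ge0 => // z; exact: sqr_ge0.
have x0 t : 0 <= E (fun z => xi z k t ^+ 2) by apply: pexp_ge0 => // z; exact: sqr_ge0.
have h1 : \sum_(t < T) E (fun z => npred k z t ^+ 2) <=
    2 * \sum_(t < T) lv t * E (fun z => xi z k t ^+ 2).
  have : \sum_(t < T) (E (fun z => npred k z t ^+ 2) / 2) <=
    \sum_(t < T) ((E (fun z => xi z k t ^+ 2) + E (fun z => npred k z t ^+ 2)) / (1 + lv t)
      - E (fun z => xi z k t ^+ 2) + lv t * E (fun z => xi z k t ^+ 2)).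
    apply: ler_sum => t _; have [l0 l2] := lv2 t; have l3 := lv_ge0 t.
    have a : E (fun z => npred k z t ^+ 2) / 2 <= E (fun z => npred k z t ^+ 2) / (1 + lv t).
      by rewrite ler_wpM2l// lef_pV2 ?posrE.
    have b : E (fun z => xi z k t ^+ 2) * (1 - lv t) <= E (fun z => xi z k t ^+ 2) / (1 + lv t).
      rewrite ler_wpM2l// -[leRHS]mul1r ler_pdivlMr//.
      by have := sqr_ge0 (lv t); lra.
    rewrite mulrDl; lra.
  rewrite -mulr_suml big_split /= sumrB.
  have : \sum_(t < T) (E (fun z => xi z k t ^+ 2) + E (fun z => npred k z t ^+ 2)) / (1 + lv t)
      <= \sum_(t < T) E (fun z => xi z k t ^+ 2).
    by apply: le_trans reg; apply: ler_sum => t _; rewrite term.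
  lra.
apply: le_trans h1 _.
have h2 : \sum_(t < T) lv t * E (fun z => xi z k t ^+ 2) <= m * \sum_(t < T) lv t * y k t ^+ 2.
  rewrite mulr_sumr; apply: ler_sum => t _; rewrite mulrCA.
  by rewrite ler_wpM2l ?lv_ge0// E_xi2_le.
have m0 : 0 <= m by have := m_ge1; lra.
have h3 := ler_wpM2l m0 (lev_sqr_sum B2 Bq Tq hx3 W1 (hy k)).
have -> : 40 * B ^+ 2 * W * m * q ^+ 121 = 2 * (m * (20 * B ^+ 2 * W * q ^+ 121)) by ring.
by rewrite ler_wpM2l//; exact: le_trans h2 h3.
Qed.

(** These constants depend on [B] and [W] alone, hence not on the horizon; only this matters, not
    their values. *)
Definition cres (B W : R) := 4 * B ^+ 2 * W.
Definition cnoise (B W : R) := 80 * B ^+ 3 * W.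
Definition cmnoise (B W : R) := 160 * B ^+ 4 * W.
Definition closs (B W : R) := 2 * cres B W + 2 * cnoise B W.
Definition cstep (B W : R) := 2 * (16 * 88 * B ^+ 6 * W ^+ 2 + 4 * cmnoise B W).
Definition cftrl (B W : R) := 4 * closs B W + cstep B W.
Definition cftrl0 (B W : R) := 2 * cftrl B W + 4 * cmnoise B W.

Local Notation Kr := (cres B W).
Local Notation Kn := (cnoise B W).
Local Notation Km := (cmnoise B W).
Local Notation Ka := (closs B W).
Local Notation Kf := (cstep B W).
Local Notation Kg := (cftrl B W).
Local Notation Kh := (cftrl0 B W).

Let B0 : 0 <= B. Proof. by have := B2; lra. Qed.
Let W0 : 0 <= W. Proof. by have := W1; lra. Qed.
Let q_gt0' : 0 < q. Proof. exact: q_gt0 B2 Bq. Qed.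
Let qn0 : q != 0. Proof. by rewrite gt_eqF. Qed.

Lemma cres_ge0 : 0 <= Kr.
Proof. exact: mulr_ge0 (mulr_ge0 (ler0n _ _) (exprn_ge0 _ B0)) W0. Qed.

Lemma cnoise_ge0 : 0 <= Kn.
Proof. exact: mulr_ge0 (mulr_ge0 (ler0n _ _) (exprn_ge0 _ B0)) W0. Qed.

Lemma cmnoise_ge0 : 0 <= Km.
Proof. exact: mulr_ge0 (mulr_ge0 (ler0n _ _) (exprn_ge0 _ B0)) W0. Qed.

Lemma closs_ge0 : 0 <= Ka.
Proof. by have := cres_ge0; have := cnoise_ge0; rewrite /closs; lra. Qed.

Let c88_ge0 : 0 <= 16 * 88 * B ^+ 6 * W ^+ 2.
Proof.
exact: mulr_ge0 (mulr_ge0 (mulr_ge0 (ler0n _ _) (ler0n _ _)) (exprn_ge0 _ B0)) (sqr_ge0 _).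
Qed.

Lemma cstep_ge0 : 0 <= Kf.
Proof.
have h := c88_ge0.
by have := cmnoise_ge0; rewrite /cstep; lra.
Qed.

Lemma cftrl_ge0 : 0 <= Kg.
Proof. by have := closs_ge0; have := cstep_ge0; rewrite /cftrl; lra. Qed.

Lemma cftrl0_ge0 : 0 <= Kh.
Proof. by have := cftrl_ge0; have := cmnoise_ge0; rewrite /cftrl0; lra. Qed.

Lemma KqX_le K a b : 0 <= K -> (a <= b)%N -> K * q ^+ a <= K * q ^+ b.
Proof. by move=> K0 ab; rewrite ler_wpM2l// (qX_le B2 Bq). Qed.

Hypothesis hm : m <= 2 * B * q ^+ 33.

Let m0 : 0 <= m. Proof. by have := m_ge1; lra. Qed.

Lemma npred_energy_q k : \sum_(t < T) E (fun z => npred k z t ^+ 2) <= Kn * q ^+ 154.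
Proof.
apply: le_trans (npred_energy k) _.
have -> : Kn * q ^+ 154 = 40 * B ^+ 2 * W * (2 * B * q ^+ 33) * q ^+ 121.
  by rewrite /cnoise; ring.
rewrite ler_wpM2r ?(qX_ge0 B2 Bq)// ler_wpM2l//.
exact: mulr_ge0 (mulr_ge0 (ler0n _ _) (exprn_ge0 _ B0)) W0.
Qed.

(** Division by a treatment probability costs the factor [m] a second time; the result is still
    below the order [q ^+ 192] of the main terms. *)
Lemma m_npred_energy k : m * \sum_(t < T) E (fun z => npred k z t ^+ 2) <= Km * q ^+ 187.
Proof.
have -> : Km * q ^+ 187 = (2 * B * q ^+ 33) * (Kn * q ^+ 154).
  by rewrite /cmnoise /cnoise; ring.
apply: ler_pM => //; last exact: npred_energy_q.
by apply: sumr_ge0 => t _; apply: (pexp_ge0 p01) => z; exact: sqr_ge0.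
Qed.

Lemma res0_sqsum k : \sum_(t < T) res0 k t ^+ 2 <= Kr * q ^+ 192.
Proof. exact: (res_sum_le B2 Bq Tq hx3 hx2 W1 (hy k)). Qed.

Lemma res0_sqr_le k t : (t < T)%N -> res0 k t ^+ 2 <= Kr * q ^+ 120.
Proof. exact: (res_sqr_le B2 Bq Tq hx3 hx2 W1 (hy k)). Qed.

Lemma ures_sqr_le k z t : ures k z t ^+ 2 <= 2 * res0 k t ^+ 2 + 2 * npred k z t ^+ 2.
Proof. by rewrite /ures; have := sqr_ge0 (res0 k t + npred k z t); lra. Qed.

Definition arm_loss k z t : R := pipw k z t * ures k z t ^+ 2.
Definition total_loss k z : R := \sum_(t < T) arm_loss k z t.

Lemma arm_loss_ge0 k z t : 0 <= arm_loss k z t.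
Proof. by rewrite mulr_ge0 ?pipw_ge0 ?sqr_ge0. Qed.

Lemma total_loss_ge0 k z : 0 <= total_loss k z.
Proof. by apply: sumr_ge0 => t _; exact: arm_loss_ge0. Qed.

Lemma E_total_loss k : E (total_loss k) <= Ka * q ^+ 192.
Proof.
rewrite /total_loss pexp_sum.
have -> : \sum_(t < T) E (fun z => arm_loss k z t) = \sum_(t < T) E (fun z => ures k z t ^+ 2).
  apply: eq_bigr => t _; rewrite /arm_loss E_pipw// => z z' h.
  by rewrite (adapted_ures k h).
apply: le_trans (_ : \sum_(t < T) (2 * res0 k t ^+ 2 + 2 * E (fun z => npred k z t ^+ 2)) <= _).
  apply: ler_sum => t _.
  rewrite -pexpZ -[X in _ <= X + _](pexp_cst p T) -pexpD; apply: (pexp_le p01) => z.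
  exact: ures_sqr_le.
rewrite big_split /= -!mulr_sumr.
have := res0_sqsum k; have := npred_energy_q k.
have := KqX_le (a := 154) (b := 192) cnoise_ge0 isT.
by rewrite /closs; lra.
Qed.

(** * Regret of the clipped design in expectation *)

Variables (phi : R -> R) (b1 b2 b3 : R) (uu : (nat -> bool) -> nat -> R).
Hypothesis hb1 : 0 < b1.
Hypothesis hb2 : 0 < b2.
Hypothesis hphi : sigmoid_condition b1 b2 b3 phi.
Hypothesis b1B : b1 <= B.
Hypothesis b2B : b2 <= B.
Hypothesis hp : forall z t, p z t = phi (uu z t).
Hypothesis ua : forall t, adapted t (uu^~ t).
Hypothesis umin : forall z t, (t < T)%N -> fminimizer phi
  (\sum_(s < t) arm_loss true z s) (\sum_(s < t) arm_loss false z s)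
  (kap t) (q ^+ 33) (uu z t).

(** Inverse probabilities grow at most linearly in the logit. This cancels against the curvature
    factor [1 + |u|] in the step bound, so that the signal part costs no factor [m]. *)
Lemma parmV_le_uu k z t : (parm k z t)^-1 <= B * (1 + `|uu z t|).
Proof.
have h : 2 + b1 * `|uu z t| <= B * (1 + `|uu z t|).
  have : b1 * `|uu z t| <= B * `|uu z t| by rewrite ler_wpM2r.
  have := B2; lra.
apply: le_trans h; rewrite /parm hp; case: k.
  exact: (inv_phi_le hphi).
exact: (inv_phic_le hphi).
Qed.

Lemma flossE (a : bool -> R) z t :
  floss phi (a true) (a false) (uu z t) = \sum_k a k / parm k z t.
Proof. by rewrite big_bool /floss /parm hp. Qed.

Definition step_bound z t : R :=
  fstep phi b1 (arm_loss true z) (arm_loss false z) kap (uu z) t.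

Lemma pipw_disj z t : pipw true z t = 0 \/ pipw false z t = 0.
Proof. by rewrite !pipwE; case: (z t); rewrite /= mul0r; [right|left]. Qed.

(* Both bounds on the step loss are used: the quadratic one for the signal part
   of the residual, the linear one for its noise part. *)
Lemma step_bound_le z t : (t < T)%N -> step_bound z t <= \sum_k
  (16 * B ^+ 2 * (pipw k z t ^+ 2 * ((kap t * (1 + `|uu z t|))^-1 * res0 k t ^+ 4))
   + 4 * (pipw k z t * (npred k z t ^+ 2 / parm k z t))).
Proof.
move=> tT.
have c0 : 0 < kap t * (1 + `|uu z t|) by rewrite mulr_gt0// ltr_pwDl.
set c := kap t * _ in c0 *.
have arm k : Num.min ((b1 * arm_loss k z t) ^+ 2 / c) (arm_loss k z t / parm k z t) <=
   16 * B ^+ 2 * (pipw k z t ^+ 2 * (c^-1 * res0 k t ^+ 4))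
   + 4 * (pipw k z t * (npred k z t ^+ 2 / parm k z t)).
  have i0 := pipw_ge0 k z t; have ci : 0 <= c^-1 by rewrite invr_ge0 ltW.
  have pi0 := ltW (parmV_gt0 k z t).
  have t1 : 0 <= 16 * B ^+ 2 * (pipw k z t ^+ 2 * (c^-1 * res0 k t ^+ 4)).
    apply: mulr_ge0; first by apply: mulr_ge0 => //; exact: sqr_ge0.
    apply: mulr_ge0 (sqr_ge0 _) _; apply: mulr_ge0 => //; exact: exprn_even_ge0.
  have t2 : 0 <= 4 * (pipw k z t * (npred k z t ^+ 2 / parm k z t)).
    by apply: mulr_ge0 => //; apply: mulr_ge0 => //; apply: mulr_ge0 => //; exact: sqr_ge0.
  have u2 := ures_sqr_le k z t; have us := sqr_ge0 (ures k z t).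
  rewrite ge_min; apply/orP.
  have [nr|/ltW rn] := leP (npred k z t ^+ 2) (res0 k t ^+ 2).
    left; apply: ler_wpDr => //.
    have -> : (b1 * arm_loss k z t) ^+ 2 / c =
      b1 ^+ 2 * (pipw k z t ^+ 2 * (c^-1 * (ures k z t ^+ 2) ^+ 2)).
      by rewrite /arm_loss; ring.
    have -> : 16 * B ^+ 2 * (pipw k z t ^+ 2 * (c^-1 * res0 k t ^+ 4)) =
      B ^+ 2 * (pipw k z t ^+ 2 * (c^-1 * (4 * res0 k t ^+ 2) ^+ 2)) by ring.
    apply: ler_pM.
    - exact: sqr_ge0.
    - by apply: mulr_ge0 (sqr_ge0 _) _; apply: mulr_ge0 ci (sqr_ge0 _).
    - by rewrite ler_pXn2r ?nnegrE// ltW.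
    rewrite ler_wpM2l ?sqr_ge0// ler_wpM2l// ler_pXn2r ?nnegrE//; lra.
  right; apply: ler_wpDl => //.
  have -> : 4 * (pipw k z t * (npred k z t ^+ 2 / parm k z t)) =
    pipw k z t * (4 * npred k z t ^+ 2) / parm k z t by ring.
  rewrite /arm_loss ler_wpM2r// ler_wpM2l//; lra.
apply: le_trans (ler_sum _ (fun k _ => arm k)).
rewrite /step_bound /fstep -/c (@flossE (fun k => arm_loss k z t)) !big_bool /=.
have z0 : (b1 * 0) ^+ 2 / c = 0 by rewrite mulr0 expr0n mul0r.
case: (pipw_disj z t) => e0.
  have e1 : arm_loss true z t = 0 by rewrite /arm_loss e0 mul0r.
  by rewrite e1 z0 !mul0r minxx !add0r.
have e1 : arm_loss false z t = 0 by rewrite /arm_loss e0 mul0r.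
by rewrite e1 z0 !mul0r minxx !addr0.
Qed.

Lemma E_step_bound : E (fun z => \sum_(t < T) step_bound z t) <= Kf * q ^+ 187.
Proof.
rewrite pexp_sum.
have term t : (t < T)%N -> E (step_bound ^~ t) <= \sum_k
    (16 * B ^+ 3 * (res0 k t ^+ 4 / kap t) + 4 * (m * E (fun z => npred k z t ^+ 2))).
  move=> tT; apply: le_trans (pexp_le p01 T (fun z => step_bound_le z tT)) _.
  rewrite pexp_sum; apply: ler_sum => k _; rewrite pexpD pexpZ pexpZ.
  apply: lerD.
    rewrite E_pipw2//; last by move=> z z' h; rewrite (ua h).
    rewrite (_ : 16 * B ^+ 3 * _ = 16 * B ^+ 2 * (B * (res0 k t ^+ 4 / kap t))); last by ring.
    rewrite ler_wpM2l ?mulr_ge0 ?sqr_ge0//.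
    rewrite -[leRHS](pexp_cst p T); apply: (pexp_le p01) => z.
    have r0 : 0 <= res0 k t ^+ 4 / kap t.
      by rewrite divr_ge0 ?(ltW (kap_gt0 _))// exprn_even_ge0.
    have u0 : 0 < 1 + `|uu z t| by rewrite ltr_pwDl.
    have -> : (kap t * (1 + `|uu z t|))^-1 * res0 k t ^+ 4 / parm k z t =
      (parm k z t)^-1 / (1 + `|uu z t|) * (res0 k t ^+ 4 / kap t).
      by rewrite invfM; ring.
    by rewrite ler_wpM2r// ler_pdivrMr// parmV_le_uu.
  rewrite ler_wpM2l// E_pipw//; last first.
    by move=> z z' h; rewrite (adapted_npred k h) (adapted_parm k h).
  rewrite -pexpZ; apply: (pexp_le p01) => z.
  by rewrite mulrC ler_wpM2r ?sqr_ge0// parmV_le.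
apply: le_trans (ler_sum _ (fun (t : 'I_T) _ => term t (ltn_ord t))) _.
rewrite exchange_big /=.
have arm k : \sum_(t < T) (16 * B ^+ 3 * (res0 k t ^+ 4 / kap t)
      + 4 * (m * E (fun z => npred k z t ^+ 2)))
    <= (16 * 88 * B ^+ 6 * W ^+ 2 + 4 * Km) * q ^+ 187.
  rewrite big_split /= -!mulr_sumr [leRHS]mulrDl. apply: lerD; last first.
    by rewrite -mulrA ler_wpM2l// m_npred_energy.
  have h := res_fourth_sum B2 Bq Tq hx3 hx2 W1 (hy k).
  have b3' : 0 <= 16 * B ^+ 3 by apply: mulr_ge0 (ler0n _ _) (exprn_ge0 _ B0).
  apply: le_trans (ler_wpM2l b3' h) _.
  rewrite (_ : 16 * B ^+ 3 * _ = 16 * 88 * B ^+ 6 * W ^+ 2 * q ^+ 168); last by ring.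
  exact: (KqX_le (a := 168) (b := 187) c88_ge0 isT).
by rewrite big_bool /=; have := arm true; have := arm false; rewrite /cstep; lra.
Qed.

(** The loss charged to the leader, its conditional mean given the past, and the latter with
    deterministic residuals. *)
Definition fhat z t : R := \sum_k arm_loss k z t / parm k z t.
Definition fval z t : R := \sum_k ures k z t ^+ 2 / parm k z t.
Definition fval0 z t : R := \sum_k res0 k t ^+ 2 / parm k z t.

Lemma E_fhat t : (t < T)%N -> E (fhat ^~ t) = E (fval ^~ t).
Proof.
move=> tT; rewrite !pexp_sum; apply: eq_bigr => k _; rewrite /arm_loss.
have -> : (fun z => pipw k z t * ures k z t ^+ 2 / parm k z t) =
  (fun z => pipw k z t * (ures k z t ^+ 2 / parm k z t)) by apply/funext => z; ring.
by rewrite E_pipw// => z z' h; rewrite (adapted_ures k h) (adapted_parm k h).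
Qed.

Lemma fhat_upper z v : `|v| <= q ^+ 33 -> \sum_(t < T) fhat z t <=
  floss phi (total_loss true z) (total_loss false z) v + kap T * Defs.psi v
  + \sum_(t < T) step_bound z t.
Proof.
move=> vU; have := ftrl_upper hphi (qX_ge0 B2 Bq 33) (arm_loss_ge0 true z)
  (arm_loss_ge0 false z) kap_gt0 kap_leS (umin z) vU.
by under eq_bigr do rewrite (flossE (fun k => arm_loss k z _)).
Qed.

Lemma E_fval : E (fun z => \sum_(t < T) fval z t) <= Kg * q ^+ 192.
Proof.
have -> : E (fun z => \sum_(t < T) fval z t) = E (fun z => \sum_(t < T) fhat z t).
  by rewrite !pexp_sum; apply: eq_bigr => t _; rewrite E_fhat.
have up z : \sum_(t < T) fhat z t <=
    2 * total_loss true z + 2 * total_loss false z + \sum_(t < T) step_bound z t.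
  (* The comparator is the fair coin, whose penalty is 0. *)
  have := @fhat_upper z 0; rewrite normr0 => /(_ (qX_ge0 B2 Bq 33)).
  rewrite psi0 mulr0 addr0 /floss (phi0 hphi).
  have -> : 1 - 1 / 2 = 1 / 2 :> R by field.
  by rewrite div1r invrK; lra.
apply: le_trans (pexp_le p01 T up) _; rewrite !pexpD !pexpZ.
have := E_total_loss true; have := E_total_loss false; have := E_step_bound.
have := KqX_le (a := 187) (b := 192) cstep_ge0 isT.
by rewrite /cftrl; lra.
Qed.

Lemma E_npred_parm k : E (fun z => \sum_(t < T) npred k z t ^+ 2 / parm k z t)
  <= Km * q ^+ 187.
Proof.
rewrite pexp_sum; apply: le_trans (m_npred_energy k); rewrite mulr_sumr.
apply: ler_sum => t _; rewrite -pexpZ; apply: (pexp_le p01) => z.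
by rewrite mulrC ler_wpM2r ?sqr_ge0// parmV_le.
Qed.

Lemma E_fval0 : E (fun z => \sum_(t < T) fval0 z t) <= Kh * q ^+ 192.
Proof.
have le z : \sum_(t < T) fval0 z t <= 2 * \sum_(t < T) fval z t +
    \sum_k 2 * \sum_(t < T) npred k z t ^+ 2 / parm k z t.
  have -> : \sum_k 2 * \sum_(t < T) npred k z t ^+ 2 / parm k z t =
      2 * \sum_(t < T) \sum_k npred k z t ^+ 2 / parm k z t.
    by rewrite -mulr_sumr exchange_big.
  rewrite -mulrDr -big_split /= mulr_sumr.
  apply: ler_sum => t _; rewrite -big_split mulr_sumr; apply: ler_sum => k _ /=.
  rewrite -mulrDl mulrA ler_wpM2r ?(ltW (parmV_gt0 _ _ _))//.
  by rewrite /ures; have := sqr_ge0 (res0 k t - 2 * npred k z t); lra.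
apply: le_trans (pexp_le p01 T le) _; rewrite pexpD pexpZ [X in _ + X <= _]pexp_sum big_bool /=.
rewrite !pexpZ; have := E_npred_parm true; have := E_npred_parm false; have := E_fval.
have := KqX_le (a := 187) (b := 192) cmnoise_ge0 isT.
by rewrite /cftrl0; lra.
Qed.

(* From [|u^2 - r^2| <= l r^2 + (1 + 1/l) n^2] with [l = q^-2]. *)
Lemma ures_res0_dist k z t : `|ures k z t ^+ 2 - res0 k t ^+ 2| <=
  q ^- 2 * res0 k t ^+ 2 + 2 * q ^+ 2 * npred k z t ^+ 2.
Proof.
rewrite /ures; set r := res0 k t; set n := npred k z t.
have q2 : 0 < q ^+ 2 by exact: exprn_gt0.
have h : 2 * `|r * n| <= q ^- 2 * r ^+ 2 + q ^+ 2 * n ^+ 2.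
  have s : 0 <= (`|r| / q - q * `|n|) ^+ 2 by exact: sqr_ge0.
  have e : (`|r| / q - q * `|n|) ^+ 2 = q ^- 2 * `|r| ^+ 2 + q ^+ 2 * `|n| ^+ 2 - 2 * (`|r| * `|n|).
    by field.
  by rewrite normrM; move: s; rewrite e !real_normK ?num_real//; lra.
have n2 : n ^+ 2 <= q ^+ 2 * n ^+ 2 by rewrite ler_peMl ?sqr_ge0 ?(qX_ge1 B2 Bq).
have -> : (r - n) ^+ 2 - r ^+ 2 = n ^+ 2 - 2 * (r * n) by ring.
have n0 := sqr_ge0 n.
apply: le_trans (ler_normB _ _) _; rewrite (ger0_norm n0).
have -> : `|2 * (r * n)| = 2 * `|r * n| by rewrite normrM ger0_norm.
by lra.
Qed.

Definition cdist (B W : R) := cftrl0 B W + 4 * cmnoise B W.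
Definition cdist0 (B W : R) := cres B W + 2 * cnoise B W.

Lemma E_fval_dist : E (fun z => \sum_(t < T) \sum_k
    `|ures k z t ^+ 2 - res0 k t ^+ 2| / parm k z t) <= cdist B W * q ^+ 190.
Proof.
have le z : \sum_(t < T) \sum_k `|ures k z t ^+ 2 - res0 k t ^+ 2| / parm k z t <=
    q ^- 2 * \sum_(t < T) fval0 z t +
    2 * q ^+ 2 * \sum_k \sum_(t < T) npred k z t ^+ 2 / parm k z t.
  rewrite [X in _ + _ * X]exchange_big /= !mulr_sumr -big_split.
  apply: ler_sum => t _ /=; rewrite !mulr_sumr -big_split; apply: ler_sum => k _ /=.
  have pi0 := ltW (parmV_gt0 k z t); have h := ler_wpM2r pi0 (ures_res0_dist k z t).
  by apply: le_trans h _; rewrite mulrDl !mulrA.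
apply: le_trans (pexp_le p01 T le) _.
rewrite pexpD !pexpZ [X in _ + _ * X <= _]pexp_sum big_bool /=.
have qi : 0 <= q ^- 2 by rewrite invr_ge0 exprn_ge0// ltW.
have q2 : 0 <= 2 * q ^+ 2 by rewrite mulr_ge0// exprn_ge0// ltW.
have h1 := ler_wpM2l qi E_fval0.
have h2 := ler_wpM2l q2 (lerD (E_npred_parm true) (E_npred_parm false)).
apply: le_trans (lerD h1 h2) _.
have e1 : q ^- 2 * (Kh * q ^+ 192) = Kh * q ^+ 190 by field.
have e2 : 2 * q ^+ 2 * (Km * q ^+ 187 + Km * q ^+ 187) = 4 * (Km * q ^+ 189) by ring.
rewrite e1 e2; have := KqX_le (a := 189) (b := 190) cmnoise_ge0 isT.
by rewrite /cdist; lra.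
Qed.

Lemma E_res0_dist k : E (fun z => \sum_(t < T) `|ures k z t ^+ 2 - res0 k t ^+ 2|)
  <= cdist0 B W * q ^+ 190.
Proof.
have le z : \sum_(t < T) `|ures k z t ^+ 2 - res0 k t ^+ 2| <=
    q ^- 2 * \sum_(t < T) res0 k t ^+ 2 + 2 * q ^+ 2 * \sum_(t < T) npred k z t ^+ 2.
  rewrite !mulr_sumr -big_split; apply: ler_sum => t _ /=; exact: ures_res0_dist.
apply: le_trans (pexp_le p01 T le) _; rewrite pexpD !pexpZ [X in _ + _ * X <= _]pexp_sum pexp_cst.
have qi : 0 <= q ^- 2 by rewrite invr_ge0 exprn_ge0// ltW.
have q2 : 0 <= 2 * q ^+ 2 by rewrite mulr_ge0// exprn_ge0// ltW.
have h1 := ler_wpM2l qi (res0_sqsum k).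
have h2 := ler_wpM2l q2 (npred_energy_q k).
apply: le_trans (lerD h1 h2) _.
have e1 : q ^- 2 * (Kr * q ^+ 192) = Kr * q ^+ 190 by field.
have e2 : 2 * q ^+ 2 * (Kn * q ^+ 154) = 2 * (Kn * q ^+ 156) by ring.
rewrite e1 e2; have := KqX_le (a := 156) (b := 190) cnoise_ge0 isT.
by rewrite /cdist0; lra.
Qed.

(** The arithmetic-geometric mean inequality turns a second moment into a first moment; [c] is the
    target accuracy. *)
Lemma E_abs_le (g : (nat -> bool) -> R) (c b : R) : 0 < c ->
  E (fun z => g z ^+ 2) <= b -> E (fun z => `|g z|) <= b / c + c.
Proof.
move=> c0 gb; have le z : `|g z| <= c^-1 * g z ^+ 2 + c.
  have s : 0 <= (`|g z| - c) ^+ 2 / c by rewrite divr_ge0 ?sqr_ge0// ltW.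
  have e : (`|g z| - c) ^+ 2 / c = c^-1 * `|g z| ^+ 2 + c - 2 * `|g z|.
    by field; rewrite gt_eqF.
  by move: s; rewrite e real_normK ?num_real//; have := normr_ge0 (g z); lra.
apply: le_trans (pexp_le p01 T le) _; rewrite pexpD pexpZ pexp_cst lerD2r mulrC.
by rewrite ler_wpM2r// invr_ge0 ltW.
Qed.

Lemma E_ipw_mart k (g : (nat -> bool) -> nat -> R) : (forall t, adapted t (g^~ t)) ->
  E (fun z => (\sum_(t < T) (pipw k z t - 1) * g z t) ^+ 2) <=
  \sum_(t < T) E (fun z => g z t ^+ 2 / parm k z t).
Proof.
move=> ga.
have := @pexp_mds _ p T (fun t z => (pipw k z t - 1) * g z t).
rewrite /= => ->; last 2 first.
- by move=> t z z' h; rewrite (adapted_pipw k h) (adaptedW (leqnSn t) (ga t) h).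
- move=> t z.
  have -> : (fun z => (pipw k z t - 1) * g z t) = (fun z => pipw k z t * g z t - g z t).
    by apply/funext => z'; ring.
  have -> : cexp p t (fun z => pipw k z t * g z t - g z t) z =
     cexp p t (fun z => pipw k z t * g z t) z - cexp p t (g^~ t) z.
    by rewrite /cexp; ring.
  by rewrite cexp_pipw// cexp_adapted// subrr.
apply: ler_sum => t _.
have g2a : adapted t (fun z => g z t ^+ 2) by move=> z z' h; rewrite (ga t _ _ h).
have -> : (fun z => ((pipw k z t - 1) * g z t) ^+ 2) = (fun z =>
   pipw k z t ^+ 2 * g z t ^+ 2 - (2 * (pipw k z t * g z t ^+ 2) - g z t ^+ 2)).
  by apply/funext => z; ring.
rewrite !pexpB pexpZ E_pipw2// E_pipw//.
have : 0 <= E (fun z => g z t ^+ 2) by apply: (pexp_ge0 p01) => z; exact: sqr_ge0.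
lra.
Qed.

Definition ctotal (B W : R) := cdist0 B W + 2 * B * cres B W ^+ 2 + 1.

(** The noise part of the residuals is removed in [L^1]; what remains is a martingale in the inverse
    weights, controlled by its variance. *)
Lemma E_total_dist k : E (fun z => `|total_loss k z - \sum_(t < T) res0 k t ^+ 2|)
  <= ctotal B W * q ^+ 190.
Proof.
have le z : `|total_loss k z - \sum_(t < T) res0 k t ^+ 2| <=
   \sum_(t < T) pipw k z t * `|ures k z t ^+ 2 - res0 k t ^+ 2| +
   `|\sum_(t < T) (pipw k z t - 1) * res0 k t ^+ 2|.
  have -> : total_loss k z - \sum_(t < T) res0 k t ^+ 2 =
    \sum_(t < T) pipw k z t * (ures k z t ^+ 2 - res0 k t ^+ 2) +
    \sum_(t < T) (pipw k z t - 1) * res0 k t ^+ 2.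
    rewrite -big_split -sumrB; apply: eq_bigr => t _ /=; rewrite /arm_loss; ring.
  apply: le_trans (ler_normD _ _) _; rewrite lerD2r.
  apply: le_trans (ler_norm_sum _ _ _) _; apply: ler_sum => t _.
  by rewrite normrM (ger0_norm (pipw_ge0 _ _ _)).
apply: le_trans (pexp_le p01 T le) _; rewrite pexpD.
have h1 : E (fun z => \sum_(t < T) pipw k z t * `|ures k z t ^+ 2 - res0 k t ^+ 2|)
   <= cdist0 B W * q ^+ 190.
  apply: le_trans (E_res0_dist k); rewrite !pexp_sum; apply: ler_sum => t _.
  by rewrite E_pipw// => z z' h; rewrite (adapted_ures k h).
have sq : E (fun z => (\sum_(t < T) (pipw k z t - 1) * res0 k t ^+ 2) ^+ 2) <=
    2 * B * Kr ^+ 2 * q ^+ 345.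
  apply: le_trans (E_ipw_mart k (g := fun _ t => res0 k t ^+ 2) (fun _ _ _ _ => erefl)) _.
  apply: le_trans (_ : \sum_(t < T) (m * (Kr * q ^+ 120)) * res0 k t ^+ 2 <= _).
    apply: ler_sum => t _; rewrite -[leRHS](pexp_cst p T); apply: (pexp_le p01) => z.
    have -> : (res0 k t ^+ 2) ^+ 2 / parm k z t =
      (parm k z t)^-1 * res0 k t ^+ 2 * res0 k t ^+ 2 by ring.
    rewrite ler_wpM2r ?sqr_ge0//.
    apply: ler_pM; rewrite ?sqr_ge0 ?(ltW (parmV_gt0 _ _ _)) ?parmV_le//.
    exact: res0_sqr_le.
  have kq : 0 <= Kr * q ^+ 120 by exact: mulr_ge0 cres_ge0 (qX_ge0 B2 Bq _).
  rewrite -mulr_sumr; apply: le_trans (ler_wpM2l (mulr_ge0 m0 kq) (res0_sqsum k)) _.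
  have -> : 2 * B * Kr ^+ 2 * q ^+ 345 = 2 * B * q ^+ 33 * (Kr * q ^+ 120 * (Kr * q ^+ 192)).
    by ring.
  rewrite -[leLHS]mulrA; rewrite ler_wpM2r//; apply: mulr_ge0 kq _.
  exact: mulr_ge0 cres_ge0 (qX_ge0 B2 Bq _).
have h2 := E_abs_le (qX_gt0 B2 Bq 190) sq.
have e : 2 * B * Kr ^+ 2 * q ^+ 345 / q ^+ 190 = 2 * B * Kr ^+ 2 * q ^+ 155 by field.
have bk : 0 <= 2 * B * Kr ^+ 2 by apply: mulr_ge0 (sqr_ge0 _); rewrite mulr_ge0.
have := KqX_le (a := 155) (b := 190) bk isT.
rewrite e in h2; rewrite /ctotal; lra.
Qed.

Definition cfhat (B W : R) := cdist B W + 2 * (4 * B ^+ 2 * cres B W * cftrl0 B W + 1).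

Lemma E_fhat_dist : E (fun z => `|\sum_(t < T) fval0 z t - \sum_(t < T) fhat z t|)
  <= cfhat B W * q ^+ 190.
Proof.
pose g k z t := res0 k t ^+ 2 / parm k z t.
have le z : `|\sum_(t < T) fval0 z t - \sum_(t < T) fhat z t| <=
   \sum_(t < T) \sum_k pipw k z t * (`|ures k z t ^+ 2 - res0 k t ^+ 2| / parm k z t) +
   \sum_k `|\sum_(t < T) (pipw k z t - 1) * g k z t|.
  rewrite distrC.
  have -> : \sum_(t < T) fhat z t - \sum_(t < T) fval0 z t =
    \sum_(t < T) \sum_k pipw k z t * ((ures k z t ^+ 2 - res0 k t ^+ 2) / parm k z t) +
    \sum_k \sum_(t < T) (pipw k z t - 1) * g k z t.
    rewrite [X in _ = _ + X]exchange_big /= -big_split -sumrB; apply: eq_bigr => t _ /=.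
    rewrite /fhat /fval0 -big_split -sumrB; apply: eq_bigr => k _ /=.
    by rewrite /arm_loss /g; ring.
  apply: le_trans (ler_normD _ _) _; apply: lerD.
    apply: le_trans (ler_norm_sum _ _ _) _; apply: ler_sum => t _.
    apply: le_trans (ler_norm_sum _ _ _) _; apply: ler_sum => k _.
    rewrite normrM (ger0_norm (pipw_ge0 _ _ _)) normrM.
    by rewrite (ger0_norm (ltW (parmV_gt0 _ _ _))).
  exact: ler_norm_sum.
apply: le_trans (pexp_le p01 T le) _; rewrite pexpD.
have h1 : E (fun z => \sum_(t < T) \sum_k pipw k z t *
    (`|ures k z t ^+ 2 - res0 k t ^+ 2| / parm k z t)) <= cdist B W * q ^+ 190.
  apply: le_trans E_fval_dist; rewrite !pexp_sum; apply: ler_sum => t _.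
  rewrite !pexp_sum; apply: ler_sum => k _.
  by rewrite E_pipw// => z z' h; rewrite (adapted_ures k h) (adapted_parm k h).
have KK : 0 <= 4 * B ^+ 2 * Kr * Kh.
  apply: mulr_ge0 cftrl0_ge0; apply: mulr_ge0 cres_ge0.
  exact: mulr_ge0 (ler0n _ _) (exprn_ge0 _ B0).
have h2 k : E (fun z => `|\sum_(t < T) (pipw k z t - 1) * g k z t|) <=
    (4 * B ^+ 2 * Kr * Kh + 1) * q ^+ 190.
  have sq : E (fun z => (\sum_(t < T) (pipw k z t - 1) * g k z t) ^+ 2) <=
      4 * B ^+ 2 * Kr * Kh * q ^+ 378.
    apply: le_trans (E_ipw_mart k (g := g k) _) _.
      by move=> t z z' h; rewrite /g (adapted_parm k h).
    pose c := Kr * q ^+ 120 * (2 * B * q ^+ 33) ^+ 2.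
    have c0 : 0 <= c.
      by apply: mulr_ge0 (sqr_ge0 _); exact: mulr_ge0 cres_ge0 (qX_ge0 B2 Bq _).
    have -> : 4 * B ^+ 2 * Kr * Kh * q ^+ 378 = c * (Kh * q ^+ 192) by rewrite /c; ring.
    apply: le_trans (ler_wpM2l c0 E_fval0).
    rewrite -pexpZ -pexp_sum; apply: (pexp_le p01) => z.
    rewrite mulr_sumr; apply: ler_sum => t _.
    have pi0 := ltW (parmV_gt0 k z t).
    apply: le_trans (_ : c * (res0 k t ^+ 2 / parm k z t) <= _); last first.
      rewrite ler_wpM2l// /fval0 (bigD1 k)//= lerDl.
      by apply: sumr_ge0 => k' _; rewrite divr_ge0 ?sqr_ge0// ltW// parm_gt0.
    have -> : g k z t ^+ 2 / parm k z t =
      res0 k t ^+ 2 * (parm k z t)^-1 ^+ 2 * (res0 k t ^+ 2 / parm k z t).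
      by rewrite /g; ring.
    rewrite ler_wpM2r ?(mulr_ge0 (sqr_ge0 _) pi0)//.
    apply: ler_pM; rewrite ?sqr_ge0 ?res0_sqr_le//.
    have mm := le_trans (parmV_le k z t) hm.
    by rewrite ler_pXn2r ?nnegrE//; exact: le_trans mm.
  have := E_abs_le (qX_gt0 B2 Bq 190) sq.
  have -> : 4 * B ^+ 2 * Kr * Kh * q ^+ 378 / q ^+ 190 = 4 * B ^+ 2 * Kr * Kh * q ^+ 188 by field.
  have := KqX_le (a := 188) (b := 190) KK isT; lra.
rewrite [X in _ + X <= _]pexp_sum big_bool /=.
have := h2 true; have := h2 false; rewrite /cfhat; lra.
Qed.

Lemma sqrt_ge_sub (a g : R) : 0 <= a -> 0 < g -> g - `|a - g ^+ 2| / g <= Num.sqrt a.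
Proof.
move=> a0 g0; have s0 := sqrtr_ge0 a; have e := sqr_sqrtr a0.
move: (Num.sqrt a) s0 e => s s0 <-.
have -> : s ^+ 2 - g ^+ 2 = (s - g) * (s + g) by ring.
have sg : 0 <= s + g by rewrite addr_ge0// ltW.
rewrite normrM (ger0_norm sg) lerBlDr -lerBlDl.
have h1 : g - s <= `|s - g| by rewrite distrC; exact: ler_norm.
apply: le_trans h1 _; rewrite -mulrA ler_peMr// ler_pdivlMr// mul1r; lra.
Qed.

(** The errors enter linearly because [g] and [h] are within a factor [B] of each other. If a
    linearized factor is negative, so is the left-hand side. *)
Lemma sqrt_mul_ge (a b g h : R) : 0 <= a -> 0 <= b -> 0 < g -> 0 < h ->
  h <= B * g -> g <= B * h ->
  g * h - B * (`|a - g ^+ 2| + `|b - h ^+ 2|) <= Num.sqrt a * Num.sqrt b.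
Proof.
move=> a0 b0 g0 h0 hg gh.
have sa := sqrt_ge_sub a0 g0; have sb := sqrt_ge_sub b0 h0.
have da := normr_ge0 (a - g ^+ 2); have db := normr_ge0 (b - h ^+ 2).
move: `|a - _| `|b - _| da db sa sb => u v u0 v0 sa sb.
have ug : 0 <= u / g by rewrite divr_ge0// ltW.
have vh : 0 <= v / h by rewrite divr_ge0// ltW.
have k1 : u / g * h <= B * u.
  have -> : u / g * h = u * (h / g) by ring.
  by rewrite mulrC ler_wpM2r// ler_pdivrMr.
have k2 : v / h * g <= B * v.
  have -> : v / h * g = v * (g / h) by ring.
  by rewrite mulrC ler_wpM2r// ler_pdivrMr.
have [c1|c1] := leP 0 (g - u / g); have [c2|c2] := leP 0 (h - v / h).
- apply: le_trans (ler_pM c1 c2 sa sb).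
  have -> : (g - u / g) * (h - v / h) = g * h - u / g * h - v / h * g + u / g * (v / h) by ring.
  by have := mulr_ge0 ug vh; rewrite mulrDr; lra.
- apply: le_trans (mulr_ge0 (sqrtr_ge0 a) (sqrtr_ge0 b)).
  have := ler_wpM2r (ltW g0) (ltW c2); rewrite mul0r mulrBl mulrDr.
  by have := mulr_ge0 B0 u0; lra.
- apply: le_trans (mulr_ge0 (sqrtr_ge0 a) (sqrtr_ge0 b)).
  have := ler_wpM2r (ltW h0) (ltW c1); rewrite mul0r mulrBl mulrDr.
  by have := mulr_ge0 B0 v0; lra.
- apply: le_trans (mulr_ge0 (sqrtr_ge0 a) (sqrtr_ge0 b)).
  have := ler_wpM2r (ltW h0) (ltW c1); rewrite mul0r mulrBl mulrDr.
  by have := mulr_ge0 B0 v0; lra.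
Qed.

Variables (gs : bool -> R) (us : R).
Hypothesis gs0 : forall k, 0 < gs k.
Hypothesis gsE : forall k, gs k ^+ 2 = ols_min T x (y k).
Hypothesis gsB : forall k, gs (~~ k) <= B * gs k.
Hypothesis usE : phi us = gs true / (gs true + gs false).
Hypothesis usB : `|us| <= B.

Local Notation G := ((gs true + gs false) ^+ 2).

(** [us] is the logit of the Neyman allocation, with probabilities proportional to [gs]; for the
    losses [gs k ^+ 2] the value is [(gs true + gs false) ^+ 2]. *)
Lemma floss_us (a b : R) : floss phi a b us =
  a * (1 + gs false / gs true) + b * (1 + gs true / gs false).
Proof.
have g1 := gs0 true; have g0 := gs0 false; rewrite /floss usE; field.
by rewrite !gt_eqF ?addr_gt0//= (_ : _ - _ = gs false) ?gt_eqF//; ring.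
Qed.

Let dev k z := `|total_loss k z - ols_min T x (y k)|.
Let devsum z := dev true z + dev false z.

Lemma ftrl_cost_upper z : \sum_(t < T) fhat z t <=
  G + (1 + B) * devsum z + B * (B ^+ 2 + B ^+ 3) * q ^+ 144 + \sum_(t < T) step_bound z t.
Proof.
have usU : `|us| <= q ^+ 33.
  apply: le_trans usB _; apply: le_trans Bq _; exact: (qX_le B2 Bq (isT : 1 <= 33)%N).
apply: le_trans (fhat_upper z usU) _; rewrite lerD2r; apply: lerD; last first.
  have -> : B * (B ^+ 2 + B ^+ 3) * q ^+ 144 = B * q ^+ 144 * (B ^+ 2 + B ^+ 3) by ring.
  apply: ler_pM; rewrite ?psi_ge0 ?(ltW (kap_gt0 _))//.
    exact: ikap_le_q B2 Bq Tq hx3 T.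
  have u2 : us ^+ 2 <= B ^+ 2 by rewrite -[us ^+ 2]real_normK ?num_real// ler_pXn2r ?nnegrE.
  have u3 : `|us| ^+ 3 <= B ^+ 3 by rewrite ler_pXn2r ?nnegrE.
  by rewrite /Defs.psi; have := sqr_ge0 us; lra.
rewrite floss_us.
have c k : 0 <= 1 + gs (~~ k) / gs k <= 1 + B.
  have : 0 <= gs (~~ k) / gs k by rewrite divr_ge0 ?ltW.
  have : gs (~~ k) / gs k <= B by rewrite ler_pdivrMr.
  by move: (gs (~~ k) / gs k) => r; lra.
have arm k : total_loss k z * (1 + gs (~~ k) / gs k) <=
    gs k ^+ 2 * (1 + gs (~~ k) / gs k) + (1 + B) * dev k z.
  rewrite -lerBlDl -mulrBl gsE mulrC; have /andP[c0 c1] := c k.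
  have := ler_wpM2l c0 (ler_norm (total_loss k z - ols_min T x (y k))).
  move/le_trans; apply; apply: ler_wpM2r => //; exact: normr_ge0.
have -> : G = gs true ^+ 2 * (1 + gs false / gs true) + gs false ^+ 2 * (1 + gs true / gs false).
  by field; rewrite !gt_eqF.
have := arm true; have := arm false; rewrite /devsum /=; lra.
Qed.

Lemma ln_crad_ratio : 0 <= ln (kap T / kap 0%N) <= 49 * q.
Proof.
have k0 := kap_gt0 0%N; have r0 : 0 < crad T x 0%N by exact: crad_gt0.
have kE : kap T / kap 0%N = crad T x T / crad T x 0%N.
  rewrite /ikap (sqrtT B2 Bq Tq); field; rewrite gt_eqF//=; exact: qn0.
have r1 : 1 <= kap T / kap 0%N.
  rewrite ler_pdivlMr// mul1r.
  have mono n : kap 0%N <= kap n by elim: n => // n /le_trans; apply.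
  exact: mono.
rewrite ln_ge0//=.
have h : kap T / kap 0%N <= q ^+ 49.
  rewrite kE ler_pdivrMr//; apply: le_trans (crad_le_q B2 Bq hx3 T) _.
  have -> : q ^+ 49 = q * q ^+ 48 by ring.
  rewrite -[leLHS]mulr1; apply: ler_pM => //.
  - exact: mulr_ge0 B0 (qX_ge0 B2 Bq _).
  - by rewrite ler_wpM2r// (qX_ge0 B2 Bq).
  - exact: crad_ge1.
apply: le_trans (_ : ln (q ^+ 49) <= _).
  by rewrite ler_ln ?posrE//; [lra | exact: (qX_gt0 B2 Bq)].
rewrite lnXn// -[leLHS]mulr_natl ler_wpM2l//.
by have := ln_le_subr1 q_gt0'; lra.
Qed.

Lemma ftrl_cost_lower z : G - (1 + 2 * B) * devsum z
  - (98 * B * q ^- 11 * (total_loss true z + total_loss false z) + 196 * B * q ^+ 181)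
  <= \sum_(t < T) fhat z t.
Proof.
(* At [V = q ^+ 12] the tail error [q ^+ (192 - 12)] and the penalty [q ^+ (144 + 36)] balance; the
   logarithm adds one power. *)
have V0 : 0 <= q ^+ 12 by exact: (qX_ge0 B2 Bq).
have VU : q ^+ 12 <= q ^+ 33 by exact: (qX_le B2 Bq).
have -> : \sum_(t < T) fhat z t =
    \sum_(t < T) floss phi (arm_loss true z t) (arm_loss false z t) (uu z t).
  by apply: eq_bigr => t _; rewrite (flossE (fun k => arm_loss k z t)).
apply: le_trans (ftrl_lower hb2 hphi (qX_ge0 B2 Bq 33) (arm_loss_ge0 true z)
  (arm_loss_ge0 false z) kap_gt0 kap_leS (umin z) V0 VU).
rewrite -/(total_loss true z) -/(total_loss false z).
set A1 := total_loss true z; set A0 := total_loss false z.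
have A10 : 0 <= A1 by exact: total_loss_ge0.
have A00 : 0 <= A0 by exact: total_loss_ge0.
have main : G - (1 + 2 * B) * devsum z <= (Num.sqrt A1 + Num.sqrt A0) ^+ 2.
  have := sqrt_mul_ge A10 A00 (gs0 true) (gs0 false) (gsB true) (gsB false).
  rewrite !gsE -/(dev true z) -/(dev false z).
  have d1 : gs true ^+ 2 <= A1 + dev true z.
    by rewrite gsE -lerBlDl /dev distrC; exact: ler_norm.
  have d0 : gs false ^+ 2 <= A0 + dev false z.
    by rewrite gsE -lerBlDl /dev distrC; exact: ler_norm.
  have -> : (Num.sqrt A1 + Num.sqrt A0) ^+ 2 = A1 + A0 + 2 * (Num.sqrt A1 * Num.sqrt A0).
    by rewrite -{2}(sqr_sqrtr A10) -{2}(sqr_sqrtr A00); ring.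
  have -> : G = gs true ^+ 2 + gs false ^+ 2 + 2 * (gs true * gs false) by ring.
  by rewrite /devsum; move: (gs true ^+ 2) (gs false ^+ 2) d1 d0 => g1 g0 d1 d0; lra.
have /andP[l0 l1] := ln_crad_ratio.
set dl := (A1 + A0) * _ + _.
have AA : 0 <= A1 + A0 by exact: addr_ge0.
have v12 : 0 < q ^+ 12 by exact: (qX_gt0 B2 Bq).
have i0 : 0 <= b2 / 2 / (1 + q ^+ 12).
  exact: divr_ge0 (divr_ge0 (ltW hb2) (ler0n _ _)) (addr_ge0 ler01 V0).
have p0' : 0 <= (q ^+ 12) ^+ 2 / 2 + (q ^+ 12) ^+ 3.
  exact: addr_ge0 (divr_ge0 (exprn_ge0 _ V0) (ler0n _ _)) (exprn_ge0 _ V0).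
have k0 := ltW (kap_gt0 T).
have dl0 : 0 <= dl by exact: addr_ge0 (mulr_ge0 AA i0) (mulr_ge0 k0 p0').
have dlB : dl <= B * q ^- 12 * (A1 + A0) + 2 * B * q ^+ 180.
  have -> : 2 * B * q ^+ 180 = B * q ^+ 144 * (2 * q ^+ 36) by ring.
  apply: lerD.
    rewrite mulrC; apply: (ler_wpM2r AA).
    rewrite ler_pdivrMr; last by rewrite ltr_wpDl.
    have -> : B * q ^- 12 * (1 + q ^+ 12) = B * q ^- 12 + B by field.
    have : 0 <= B * q ^- 12 by exact: divr_ge0 B0 V0.
    by have := b2B; have := hb2; move: (B * _) => c; lra.
  apply: ler_pM k0 p0' _ _; first exact: ikap_le_q B2 Bq Tq hx3 T.
  have -> : (q ^+ 12) ^+ 2 = q ^+ 24 by ring.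
  have -> : (q ^+ 12) ^+ 3 = q ^+ 36 by ring.
  have : q ^+ 24 <= q ^+ 36 by exact: (qX_le B2 Bq).
  have := qX_ge0 B2 Bq 24; move: (q ^+ 24) (q ^+ 36) => c e; lra.
have fin := ler_pM (mulr_ge0 (ler0n _ 2) dl0) l0 (ler_wpM2l (ler0n _ 2) dlB) l1.
move: main fin.
have -> : 2 * (B * q ^- 12 * (A1 + A0) + 2 * B * q ^+ 180) * (49 * q) =
  98 * B * q ^- 11 * (A1 + A0) + 196 * B * q ^+ 181 by field.
move: (98 * B * _ * _) (196 * B * _) (2 * dl * _) (_ ^+ 2) => c e f g; lra.
Qed.

Lemma step_bound_ge0 z t : 0 <= step_bound z t.
Proof.
rewrite /step_bound /fstep le_min; apply/andP; split.
  by rewrite divr_ge0 ?sqr_ge0// ltW// mulr_gt0// ltr_pwDl.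
exact: (floss_ge0 hphi _ (arm_loss_ge0 true z t) (arm_loss_ge0 false z t)).
Qed.

Definition cdev (B W : R) := ctotal B W + 3 * B ^+ 2 * W.

Lemma E_dev k : E (dev k) <= cdev B W * q ^+ 190.
Proof.
have up := res_sum_upper B2 Bq Tq hx3 hx2 W1 (hy k).
have lo := res_sum_lower B2 Bq Tq hx3 hx2 W1 (hy k).
have c0 : 0 <= 3 * B ^+ 2 * W by exact: mulr_ge0 (mulr_ge0 (ler0n _ _) (sqr_ge0 _)) W0.
have u1 := KqX_le (a := 144) (b := 190) c0 isT.
have u2 := KqX_le (a := 168) (b := 190) c0 isT.
set S := \sum_(t < T) _ in up lo.
have SE : S = \sum_(t < T) res0 k t ^+ 2 by [].
have dS : `|S - ols_min T x (y k)| <= 3 * B ^+ 2 * W * q ^+ 190.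
  by rewrite ler_norml; apply/andP; split; lra.
have le z : dev k z <= `|total_loss k z - S| + 3 * B ^+ 2 * W * q ^+ 190.
  apply: le_trans (_ : `|total_loss k z - S| + `|S - ols_min T x (y k)| <= _).
    by apply: le_trans (ler_normD _ _); rewrite subrKA.
  by rewrite lerD2l.
apply: le_trans (pexp_le p01 T le) _; rewrite pexpD pexp_cst.
have -> : cdev B W * q ^+ 190 = ctotal B W * q ^+ 190 + 3 * B ^+ 2 * W * q ^+ 190.
  by rewrite /cdev; ring.
exact: lerD (E_total_dist k) (lexx _).
Qed.

Definition cval (B W : R) := cfhat B W + (1 + 2 * B) * (2 * cdev B W) + cstep B W
  + B * (B ^+ 2 + B ^+ 3) + 196 * B * closs B W + 196 * B.

(* The FTRL regret bounds: the total of [fval0] is that of the best fixed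
   treatment probability. *)
Lemma E_fval_opt : E (fun z => `|\sum_(t < T) fval0 z t - G|) <= cval B W * q ^+ 190.
Proof.
have B20 : 0 <= 1 + 2 * B by rewrite addr_ge0// mulr_ge0.
pose c1 := B * (B ^+ 2 + B ^+ 3) * q ^+ 144 + 196 * B * q ^+ 181.
pose c2 := 98 * B * q ^- 11.
have c20 : 0 <= c2 by exact: divr_ge0 (mulr_ge0 (ler0n _ _) B0) (qX_ge0 B2 Bq 11).
have d0 : 0 <= 196 * B * q ^+ 181 by exact: mulr_ge0 (mulr_ge0 (ler0n _ _) B0) (qX_ge0 B2 Bq _).
have b0 : 0 <= B * (B ^+ 2 + B ^+ 3).
  exact: mulr_ge0 B0 (addr_ge0 (exprn_ge0 _ B0) (exprn_ge0 _ B0)).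
have bq0 : 0 <= B * (B ^+ 2 + B ^+ 3) * q ^+ 144 by exact: mulr_ge0 b0 (qX_ge0 B2 Bq _).
have le z : `|\sum_(t < T) fval0 z t - G| <=
    `|\sum_(t < T) fval0 z t - \sum_(t < T) fhat z t|
    + ((1 + 2 * B) * (dev true z + dev false z) + (\sum_(t < T) step_bound z t
    + (c2 * (total_loss true z + total_loss false z) + c1))).
  apply: le_trans (_ : `|\sum_(t < T) fval0 z t - \sum_(t < T) fhat z t| +
      `|\sum_(t < T) fhat z t - G| <= _).
    by apply: le_trans (ler_normD _ _); rewrite subrKA.
  rewrite lerD2l; have up := ftrl_cost_upper z; have lo := ftrl_cost_lower z.
  have s0 : 0 <= \sum_(t < T) step_bound z t by apply: sumr_ge0 => t _; exact: step_bound_ge0.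
  have v0 : 0 <= devsum z by exact: addr_ge0 (normr_ge0 _) (normr_ge0 _).
  have Bv : 0 <= B * devsum z by exact: mulr_ge0.
  have t0 : 0 <= c2 * (total_loss true z + total_loss false z).
    exact: mulr_ge0 c20 (addr_ge0 (total_loss_ge0 true z) (total_loss_ge0 false z)).
  rewrite -/c2 in lo; rewrite -/(devsum z) /c1.
  have e1 : (1 + B) * devsum z = devsum z + B * devsum z by ring.
  have e2 : (1 + 2 * B) * devsum z = devsum z + 2 * (B * devsum z) by ring.
  rewrite e1 in up; rewrite e2 in lo; rewrite e2.
  move: (196 * B * q ^+ 181) (c2 * _) (devsum z) (B * devsum z) (B * _ * q ^+ 144)
    (\sum_(t < T) step_bound z t) (\sum_(t < T) fhat z t) (G) d0 t0 v0 Bv bq0 s0 up lo.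
  move=> f1 f2 f3 f4 f5 f6 f7 f8 *.
  by rewrite ler_norml; apply/andP; split; lra.
apply: le_trans (pexp_le p01 T le) _.
rewrite pexpD pexpD pexpZ pexpD pexpD pexpD pexpZ pexpD pexp_cst.
have h1 := E_fhat_dist; have h2 := ler_wpM2l B20 (lerD (E_dev true) (E_dev false)).
have h3 := ler_wpM2l c20 (lerD (E_total_loss true) (E_total_loss false)).
have h4 := E_step_bound; have h5 := KqX_le (a := 187) (b := 190) cstep_ge0 isT.
have h6 : c1 <= B * (B ^+ 2 + B ^+ 3) * q ^+ 190 + 196 * B * q ^+ 190.
  have g1 := KqX_le (a := 144) (b := 190) b0 isT.
  have g2 := KqX_le (a := 181) (b := 190) (mulr_ge0 (ler0n _ 196) B0) isT.
  exact: lerD g1 g2.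
have h7 : c2 * (Ka * q ^+ 192 + Ka * q ^+ 192) <= 196 * B * Ka * q ^+ 190.
  have -> : c2 * (Ka * q ^+ 192 + Ka * q ^+ 192) = 196 * B * Ka * q ^+ 181 by rewrite /c2; field.
  exact: (KqX_le (a := 181) (b := 190) (mulr_ge0 (mulr_ge0 (ler0n _ 196) B0) closs_ge0) isT).
have -> : cval B W * q ^+ 190 = cfhat B W * q ^+ 190 + ((1 + 2 * B) * (cdev B W * q ^+ 190
   + cdev B W * q ^+ 190) + (Kf * q ^+ 190 + (196 * B * Ka * q ^+ 190
   + (B * (B ^+ 2 + B ^+ 3) * q ^+ 190 + 196 * B * q ^+ 190)))).
  by rewrite /cval; ring.
apply: lerD h1 _; apply: lerD h2 _; apply: lerD (le_trans h4 h5) _.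
exact: lerD (le_trans h3 h7) h6.
Qed.

(** * The martingale of the estimation error *)

Definition wgt z t : R := \sum_k ures k z t / parm k z t.
(** The central limit theorem is applied to these weights: the residuals are deterministic, which
    gives a uniform bound, though the probabilities remain random. *)
Definition wgt0 z t : R := \sum_k res0 k t / parm k z t.

Let parm_neq0 k z t : parm k z t != 0.
Proof. by rewrite gt_eqF// parm_gt0. Qed.

Lemma wgt0_norm_le z t : (t < T)%N -> `|wgt0 z t| <= 4 * B * (1 + Kr) * q ^+ 93.
Proof.
move=> tT; have r k : `|res0 k t| <= (1 + Kr) * q ^+ 60.
  have K0 := cres_ge0; have q60 := qX_ge0 B2 Bq 60.
  apply: le_of_sqr; first by rewrite mulr_ge0// addr_ge0.
  rewrite real_normK ?num_real//; apply: le_trans (res0_sqr_le k tT) _.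
  have -> : ((1 + Kr) * q ^+ 60) ^+ 2 = (1 + 2 * Kr + Kr ^+ 2) * q ^+ 120 by ring.
  by apply: ler_wpM2r (qX_ge0 B2 Bq 120) _ _ _; have := sqr_ge0 Kr; lra.
apply: le_trans (ler_norm_sum _ _ _) _.
have arm k : `|res0 k t / parm k z t| <= 2 * B * (1 + Kr) * q ^+ 93.
  have -> : 2 * B * (1 + Kr) * q ^+ 93 = (1 + Kr) * q ^+ 60 * (2 * B * q ^+ 33) by ring.
  rewrite normrM (ger0_norm (ltW (parmV_gt0 k z t))); apply: ler_pM => //.
    exact: ltW (parmV_gt0 _ _ _).
  exact: le_trans (parmV_le _ _ _) hm.
by rewrite big_bool /=; have := arm true; have := arm false; lra.
Qed.

(** The identity [p (1 - p) (a / p + b / (1 - p)) ^ 2 = a ^ 2 / p + b ^ 2 / (1 - p) - (a - b) ^ 2],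
    which separates the loss of the design from a deterministic term. *)
Lemma mvar_wgt0 z t : mvar p wgt0 z t = fval0 z t - (res0 true t - res0 false t) ^+ 2.
Proof.
rewrite /mvar /wgt0 /fval0 !big_bool /=.
have := parm_neq0 true z t; have := parm_neq0 false z t; rewrite /parm => h0 h1.
by field; rewrite h0 h1.
Qed.

Let yd t : R := y true t - y false t.

Lemma yd_fourth : \sum_(t < T) yd t ^+ 4 <= (4 * W) ^+ 2 * q ^+ 192.
Proof.
apply: le_trans (_ : \sum_(t < T) (8 * y true t ^+ 4 + 8 * y false t ^+ 4) <= _).
  apply: ler_sum => t _; rewrite /yd.
  move: (y true t) (y false t) => a b.
  have -> : 8 * a ^+ 4 + 8 * b ^+ 4 =
    (a - b) ^+ 4 + 6 * ((a + b) ^+ 2 * (a - b) ^+ 2) + ((a + b) ^+ 2) ^+ 2 by ring.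
  rewrite -addrA lerDl addr_ge0 ?sqr_ge0//.
  by apply: mulr_ge0 => //; apply: mulr_ge0; exact: sqr_ge0.
rewrite big_split /= -!mulr_sumr; have := hy true; have := hy false.
have -> : (4 * W) ^+ 2 * q ^+ 192 = 16 * (W ^+ 2 * q ^+ 192) by ring.
lra.
Qed.

Lemma res0_diff t : res0 true t - res0 false t = ridge_res x kap yd t.
Proof.
rewrite /res0 /ridge_res /yd.
have -> : ridge_sol x kap (fun t => y true t - y false t) t =
  ridge_sol x kap (y true) t - ridge_sol x kap (y false) t.
  by rewrite -ridge_solN -ridge_solD.
by rewrite innerBr; ring.
Qed.

(** The difference of the outcomes is itself a response with [4 * W] for [W], so the two regret
    bounds apply to it. *)
Lemma res0_diff_sqsum : `|\sum_(t < T) (res0 true t - res0 false t) ^+ 2 - ols_min T x yd|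
  <= 12 * B ^+ 2 * W * q ^+ 168.
Proof.
have W4 : 1 <= 4 * W by have := W1; lra.
have up := res_sum_upper B2 Bq Tq hx3 hx2 W4 yd_fourth.
have lo := res_sum_lower B2 Bq Tq hx3 hx2 W4 yd_fourth.
rewrite (eq_bigr (fun t : 'I_T => ridge_res x kap yd t ^+ 2)) => [|t _]; last by rewrite res0_diff.
set S := \sum_(t < T) _ in up lo *.
have c0 : 0 <= 3 * B ^+ 2 * W by exact: mulr_ge0 (mulr_ge0 (ler0n _ _) (sqr_ge0 _)) W0.
have u1 := KqX_le (a := 144) (b := 168) c0 isT.
have e a : 3 * B ^+ 2 * (4 * W) * q ^+ a = 4 * (3 * B ^+ 2 * W * q ^+ a) by ring.
have e' a : 12 * B ^+ 2 * W * q ^+ a = 4 * (3 * B ^+ 2 * W * q ^+ a) by ring.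
rewrite e in up; rewrite e in lo; rewrite e'.
by rewrite ler_norml; apply/andP; split; lra.
Qed.

(** The root of the residual sum of squares is the distance of the response to the span of the
    covariates, hence a seminorm. *)
Lemma ols_min_triangle (w w' : nat -> R) :
  Num.sqrt (ols_min T x (fun t => w t + w' t)) <=
  Num.sqrt (ols_min T x w) + Num.sqrt (ols_min T x w').
Proof.
set g := Num.sqrt (ols_min T x w); set h := Num.sqrt (ols_min T x w').
have g0 : 0 <= g by exact: sqrtr_ge0.
have h0 : 0 <= h by exact: sqrtr_ge0.
have gE : g ^+ 2 = ols_min T x w by rewrite sqr_sqrtr// ols_min_ge0.
have hE : h ^+ 2 = ols_min T x w' by rewrite sqr_sqrtr// ols_min_ge0.
apply: le_of_sqr; first exact: addr_ge0.
rewrite sqr_sqrtr ?ols_min_ge0//.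
apply: le_trans (ols_min_le B2 Bq Tq hx2 _ (ols T x w + ols T x w')) _.
pose a t := w t - inner (x t) (ols T x w); pose b t := w' t - inner (x t) (ols T x w').
have -> : \sum_(t < T) (w t + w' t - inner (x t) (ols T x w + ols T x w')) ^+ 2 =
    \sum_(t < T) a t ^+ 2 + \sum_(t < T) b t ^+ 2 + 2 * \sum_(t < T) a t * b t.
  rewrite mulr_sumr -!big_split; apply: eq_bigr => t _ /=; rewrite innerDr /a /b; ring.
have cs : \sum_(t < T) a t * b t <= g * h.
  apply: le_of_sqr; first exact: mulr_ge0.
  by rewrite exprMn gE hE; exact: sum_cauchy_schwarz.
have -> : (g + h) ^+ 2 = g ^+ 2 + h ^+ 2 + 2 * (g * h) by ring.
have aE : \sum_(t < T) a t ^+ 2 = ols_min T x w by [].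
have bE : \sum_(t < T) b t ^+ 2 = ols_min T x w' by [].
by rewrite gE hE aE bE; lra.
Qed.

Let sd := Num.sqrt (ols_min T x yd).

(** The lower bound makes the variance bound conservative; the upper one makes the target of the
    conditional variance nonnegative. *)
Lemma ols_min_diff : (gs true - gs false) ^+ 2 <= ols_min T x yd <= G.
Proof.
have gE k : Num.sqrt (ols_min T x (y k)) = gs k by rewrite -gsE sqrtr_sqr gtr0_norm.
have sdE : sd ^+ 2 = ols_min T x yd by rewrite sqr_sqrtr// ols_min_ge0.
have sd0 : 0 <= sd by exact: sqrtr_ge0.
have nE w : ols_min T x (fun t => - w t) = ols_min T x w.
  rewrite /ols_min /ols ridge_solN; apply: eq_bigr => t _; rewrite innerNr; ring.
have t1 : gs true <= sd + gs false.
  have := ols_min_triangle yd (y false); rewrite !gE.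
  by rewrite (_ : (fun t => yd t + y false t) = y true) ?gE//; apply/funext => t; rewrite /yd; ring.
have t2 : gs false <= sd + gs true.
  have := ols_min_triangle (fun t => - yd t) (y true); rewrite nE !gE.
  rewrite (_ : (fun t => - yd t + y true t) = y false) ?gE//.
  by apply/funext => t; rewrite /yd; ring.
have t3 : sd <= gs true + gs false.
  have := ols_min_triangle (y true) (fun t => - y false t); rewrite nE !gE.
  by rewrite (_ : (fun t => y true t + - y false t) = yd)//; apply/funext.
rewrite -sdE; apply/andP; split; last by rewrite ler_pXn2r ?nnegrE// addr_ge0// ltW.
by rewrite -[leLHS]real_normK ?num_real// ler_pXn2r ?nnegrE// ler_norml; apply/andP; split; lra.
Qed.

Lemma adapted_wgt0 t : adapted t (wgt0^~ t).
Proof. by move=> z z' h; rewrite /wgt0; apply: eq_bigr => k _; rewrite (adapted_parm k h). Qed.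

Lemma E_mdiff_dist : E (fun z => (\sum_(t < T) mdiff p wgt z t
  - \sum_(t < T) mdiff p wgt0 z t) ^+ 2) <= 2 * Km * q ^+ 187.
Proof.
pose v z t := \sum_k npred k z t / parm k z t.
have va t : adapted t (v^~ t).
  move=> z z' h; rewrite /v; apply: eq_bigr => k _.
  by rewrite (adapted_npred k h) (adapted_parm k h).
have -> : (fun z => (\sum_(t < T) mdiff p wgt z t - \sum_(t < T) mdiff p wgt0 z t) ^+ 2) =
  (fun z => (\sum_(t < T) mdiff p v z t) ^+ 2).
  apply/funext => z; rewrite -sumrB -[RHS]sqrrN -sumrN; congr (_ ^+ 2).
  apply: eq_bigr => t _; rewrite /mdiff /wgt /wgt0 /v /ures !big_bool /=; ring.
have := @pexp_mds _ p T (fun t z => mdiff p v z t).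
rewrite /= => ->; last 2 first.
- move=> t z z' h; rewrite /mdiff (h t)// (adaptedW (leqnSn t) (pa (t := t)) h).
  by rewrite (adaptedW (leqnSn t) (va t) h).
- move=> t z; rewrite /cexp /mdiff !updE !(adapted_upd _ _ (pa (t := t))).
  by rewrite !(adapted_upd _ _ (va t)) /=; ring.
apply: le_trans (_ : \sum_(t < T) \sum_k E (fun z => npred k z t ^+ 2 / parm k z t) <= _).
  apply: ler_sum => t _; rewrite (@pexp_cexp _ p pa t)//; last first.
    move=> z z' h; rewrite /mdiff (h t)// (adaptedW (leqnSn t) (pa (t := t)) h).
    by rewrite (adaptedW (leqnSn t) (va t) h).
  rewrite -pexp_sum; apply: (pexp_le p01) => z.
  rewrite /cexp /mdiff !updE !(adapted_upd _ _ (pa (t := t))) !(adapted_upd _ _ (va t)) /=.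
  rewrite /v !big_bool /= /parm; have /andP[a0 a1] := p0 z t.
  move: (npred _ _ _) (npred _ _ _) (p z t) a0 a1 => a b r r0 r1.
  have r1' : 0 < 1 - r by rewrite subr_gt0.
  (* The conditional variance is the sum of squares over probabilities minus the square of the
     difference. *)
  rewrite -subr_ge0 (_ : _ - _ = (b - a) ^+ 2) ?sqr_ge0//.
  by field; rewrite !gt_eqF.
rewrite exchange_big /= big_bool /= -!pexp_sum.
have := E_npred_parm true; have := E_npred_parm false; lra.
Qed.

Let qX_neq0 n : q ^+ n != 0.
Proof. by rewrite expf_neq0. Qed.

(** After division by [sqrt T] the increments are of order [q ^- 3]: residuals [q ^+ 60] times
    inverse probabilities [q ^+ 33], over [q ^+ 96]. The noise part of the weights is removed by
    Chebyshev at the price of one [del]. *)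
Lemma clt_wgt (a C zeta del : R) : 0 < a -> 0 <= C -> clt_bound a C ->
  4 * B * (1 + Kr) / q ^+ 3 <= 1 -> 0 <= zeta -> 0 < del ->
  let s := 4 * gs true * gs false / q ^+ 192 in
  2 * ncdf (zeta / Num.sqrt (s + a)) - 1 - C * (4 * B * (1 + Kr) / q ^+ 3) * (s + a)
    - 2 * (cval B W + 12 * B ^+ 2 * W) / a / q ^+ 2 - ncdf (- (del / Num.sqrt (2 * a)))
    - 2 * Km / del ^+ 2 / q ^+ 5
  <= pprob p T (fun z => `|\sum_(t < T) mdiff p wgt z t| <= (zeta + 2 * del) * q ^+ 96).
Proof.
move=> a0 C0 hC e1 zeta0 del0 /=; set s := 4 * gs true * gs false / _.
have K0 := cres_ge0.
have q96 := qX_gt0 B2 Bq 96; have q192 := qX_gt0 B2 Bq 192.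
have q192E : q ^+ 192 = q ^+ 96 * q ^+ 96 by ring.
pose w z t := wgt0 z t / q ^+ 96; set e := 4 * B * (1 + Kr) / q ^+ 3 in e1 *.
have e0 : 0 <= e.
  by apply: divr_ge0 (qX_ge0 B2 Bq 3); rewrite !mulr_ge0// addr_ge0.
have we z t : (t < T)%N -> `|w z t| <= e.
  move=> tT; rewrite normrM (@ger0_norm _ (q ^+ 96)^-1) ?invr_ge0 ?(ltW q96)//.
  rewrite ler_pdivrMr//; apply: le_trans (wgt0_norm_le z tT) _.
  have -> // : e * q ^+ 96 = 4 * B * (1 + Kr) * q ^+ 93.
  by rewrite /e; field.
pose Sd := ols_min T x yd; pose s2 := (G - Sd) / q ^+ 192.
have /andP[sd1 sd2] : (gs true - gs false) ^+ 2 <= Sd <= G := ols_min_diff.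
have s20 : 0 <= s2 by rewrite divr_ge0 ?(ltW q192)// subr_ge0.
have s2s : s2 <= s.
  rewrite /s2 /s ler_pdivrMr// divfK ?qX_neq0//.
  have -> : G = (gs true - gs false) ^+ 2 + 4 * gs true * gs false by ring.
  by lra.
have wa t : adapted t (w^~ t) by move=> z z' h; rewrite /w (adapted_wgt0 h).
have := hC p w T e s2 zeta del pa wa p01 we e1 e0 s20 zeta0 del0.
have mvE z : \sum_(t < T) mvar p w z t - s2 = ((\sum_(t < T) fval0 z t - G)
   - (\sum_(t < T) (res0 true t - res0 false t) ^+ 2 - Sd)) / q ^+ 192.
  have -> : \sum_(t < T) mvar p w z t = (\sum_(t < T) mvar p wgt0 z t) / q ^+ 192.
    rewrite mulr_suml; apply: eq_bigr => t _; rewrite /mvar /w q192E; field; exact: qn0.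
  under eq_bigr do rewrite mvar_wgt0.
  by rewrite sumrB /s2; ring.
have bad : pprob p T (fun z => a / 2 < `|\sum_(t < T) mvar p w z t - s2|) <=
    2 * (cval B W + 12 * B ^+ 2 * W) / a / q ^+ 2.
  have -> : 2 * (cval B W + 12 * B ^+ 2 * W) / a / q ^+ 2 =
    ((cval B W + 12 * B ^+ 2 * W) * q ^+ 190 / q ^+ 192) / (a / 2).
    by field; rewrite qn0 gt_eqF.
  apply: (@markov_pexp _ p p01 T (fun z => `|\sum_(t < T) mvar p w z t - s2|)) => //.
    by rewrite divr_gt0.
  have le z : `|\sum_(t < T) mvar p w z t - s2| <=
     (q ^+ 192)^-1 * (`|\sum_(t < T) fval0 z t - G| + 12 * B ^+ 2 * W * q ^+ 190).
    rewrite mvE mulrC normrM (@ger0_norm _ (q ^+ 192)^-1) ?invr_ge0 ?(ltW q192)//.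
    rewrite ler_pM2l ?invr_gt0//; apply: le_trans (ler_normB _ _) _.
    apply: lerD (lexx _) _; apply: le_trans res0_diff_sqsum _.
    apply: KqX_le (isT : 168 <= 190)%N.
    exact: mulr_ge0 (mulr_ge0 (ler0n _ _) (sqr_ge0 _)) W0.
  apply: le_trans (pexp_le p01 T le) _; rewrite pexpZ pexpD pexp_cst.
  rewrite [leRHS]mulrC ler_pM2l ?invr_gt0//.
  have -> : (cval B W + 12 * B ^+ 2 * W) * q ^+ 190 =
    cval B W * q ^+ 190 + 12 * B ^+ 2 * W * q ^+ 190 by ring.
  exact: lerD E_fval_opt (lexx _).
have far : pprob p T (fun z => del * q ^+ 96 < `|\sum_(t < T) mdiff p wgt z t
    - \sum_(t < T) mdiff p wgt0 z t|) <= 2 * Km / del ^+ 2 / q ^+ 5.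
  have -> : 2 * Km / del ^+ 2 / q ^+ 5 = 2 * Km * q ^+ 187 / (del * q ^+ 96) ^+ 2.
    by field; rewrite qn0 gt_eqF.
  by apply: (chebyshev_pexp p01); [rewrite mulr_gt0 | exact: E_mdiff_dist].
have near : pprob p T (fun z => `|\sum_(t < T) mdiff p w z t| <= zeta + del) <=
   pprob p T (fun z => `|\sum_(t < T) mdiff p wgt z t| <= (zeta + 2 * del) * q ^+ 96)
   + pprob p T (fun z => del * q ^+ 96 < `|\sum_(t < T) mdiff p wgt z t
    - \sum_(t < T) mdiff p wgt0 z t|).
  apply: le_trans (pprobU p01 _ _ _); apply: (pprob_le p01) => z h.
  apply/orP; have [nr|//] := leP `|\sum_(t < T) mdiff p wgt z t
    - \sum_(t < T) mdiff p wgt0 z t| (del * q ^+ 96); last by right.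
  left; have {}h : `|\sum_(t < T) mdiff p wgt0 z t| <= (zeta + del) * q ^+ 96.
    rewrite -ler_pdivrMr//; apply: le_trans h.
    rewrite -[X in _ / X](ger0_norm (ltW q96)) -normf_div mulr_suml.
    by under eq_bigr do rewrite /mdiff -mulrA -/(w z _).
  have := ler_normD (\sum_(t < T) mdiff p wgt z t
    - \sum_(t < T) mdiff p wgt0 z t) (\sum_(t < T) mdiff p wgt0 z t).
  by rewrite subrK; lra.
(* Replacing the true variance by its upper bound [s] only lowers the normal probability, since
   [zeta] is nonnegative. *)
have m1 : ncdf (zeta / Num.sqrt (s + a)) <= ncdf (zeta / Num.sqrt (s2 + a)).
  have sa2 : 0 < s2 + a by rewrite ltr_wpDl.
  have sas : s2 + a <= s + a by rewrite lerD2r.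
  have sa : 0 < s + a by exact: lt_le_trans sas.
  apply: ncdf_le; rewrite ler_wpM2l// lef_pV2 ?posrE ?sqrtr_gt0//.
  exact: ler_wsqrtr.
have m2 : C * e * (s2 + a) <= C * e * (s + a).
  by apply: ler_wpM2l; [exact: mulr_ge0 | rewrite lerD2r].
lra.
Qed.

(** * The variance bound estimator *)

Local Notation G0 := (gram x (fun=> 0) T).

Definition hat (t s : nat) : R := inner (x t) (invmx G0 *m x s).

Let cpos : 0 < q ^+ 192 / B.
Proof. by rewrite divr_gt0 ?(qX_gt0 B2 Bq)//; have := B2; lra. Qed.

Let G0_unit : G0 \in unitmx.
Proof. exact: (gram_unit cpos (ols_coercive B2 Bq Tq hx2)). Qed.

Lemma design_gram : (design_mx T x)^T *m design_mx T x = G0.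
Proof.
rewrite /gram raddf0 addr0; apply/matrixP => i j; rewrite summxE mxE.
apply: eq_bigr => t _; rewrite !mxE big_ord1 !mxE.
by [].
Qed.

Lemma resid_mxE (t s : 'I_T) : resid_mx T x t s = (t == s)%:R - hat t s.
Proof.
rewrite /resid_mx design_gram -mulmxA.
rewrite mxE [X in X + _]mxE [X in _ + X]mxE [X in _ - X]mxE; congr (_ - _).
rewrite /hat /inner; apply: eq_bigr => i _; rewrite !mxE; congr (_ * _).
by apply: eq_bigr => j _; rewrite !mxE.
Qed.

Lemma sum_hat (w : nat -> R) t :
  \sum_(s < T) hat t s * w s = inner (x t) (ols T x w).
Proof.
rewrite /ols /ridge_sol mulmx_sumr innerC inner_suml; apply: eq_bigr => s _.
by rewrite -scalemxAr innerZl mulrC innerC.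
Qed.

(** The least squares leverage is the square of a covariate norm over the smallest eigenvalue of the
    full Gram matrix: order [q ^+ 96 / q ^+ 192]. *)
Lemma hat_diag t : (t < T)%N -> 0 <= hat t t <= B ^+ 3 / q ^+ 96.
Proof.
move=> tT; set v := invmx G0 *m x t.
have hE : hat t t = gform x (fun=> 0) T v v.
  by rewrite -gformE /v mulmxA mulmxV// mul1mx.
have co := ols_coercive B2 Bq Tq hx2 v; rewrite -hE in co.
have h0 : 0 <= hat t t by apply: le_trans co; apply: mulr_ge0 (ltW cpos) (inner_ge0 v).
rewrite h0 /=.
have cs : hat t t ^+ 2 <= inner (x t) (x t) * inner v v by exact: cauchy_schwarz.
have xx : inner (x t) (x t) <= B ^+ 2 * q ^+ 96.
  rewrite -enorm_sqr (_ : B ^+ 2 * q ^+ 96 = (B * q ^+ 48) ^+ 2); last by ring.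
  by rewrite ler_pXn2r ?nnegrE ?sqrtr_ge0 ?hx3// mulr_ge0// (qX_ge0 B2 Bq).
have Bp : 0 < B by have := B2; lra.
have vv : inner v v <= B / q ^+ 192 * hat t t.
  have -> : B / q ^+ 192 * hat t t = hat t t / (q ^+ 192 / B).
    by field; rewrite qn0 gt_eqF.
  by rewrite ler_pdivlMr// mulrC.
have [z0|z0] := leP (hat t t) 0.
  by apply: le_trans z0 _; exact: divr_ge0 (exprn_ge0 _ B0) (qX_ge0 B2 Bq _).
rewrite -(ler_pM2r z0) -expr2; apply: le_trans cs _.
have -> : B ^+ 3 / q ^+ 96 * hat t t = B ^+ 2 * q ^+ 96 * (B / q ^+ 192 * hat t t).
  by field.
by apply: ler_pM => //; exact: inner_ge0.
Qed.

(** The hat matrix is idempotent, so a diagonal entry dominates its own square. *)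
Lemma hat_le1 t : (t < T)%N -> hat t t <= 1.
Proof.
move=> tT; set v := invmx G0 *m x t.
have hE : hat t t = gform x (fun=> 0) T v v.
  by rewrite -gformE /v mulmxA mulmxV// mul1mx.
have h : hat t t ^+ 2 <= hat t t.
  rewrite {2}hE /gform mul0r addr0 (bigD1 (Ordinal tT))//= -expr2 lerDl.
  by apply: sumr_ge0 => s _; rewrite -expr2 sqr_ge0.
rewrite leNgt; apply/negP => h1.
have : hat t t < hat t t ^+ 2 by rewrite expr2 ltr_pMl// (lt_trans ltr01).
by rewrite ltNge h.
Qed.

Let quad (a : nat -> R) : R := \sum_(t < T) a t * inner (x t) (ols T x a).

Lemma ols_sym (a b : nat -> R) :
  \sum_(t < T) a t * inner (x t) (ols T x b) = \sum_(t < T) b t * inner (x t) (ols T x a).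
Proof.
have c0 : (fun=> 0 : R) T = 0 by [].
rewrite /ols -!(ridge_normal (kap := fun=> 0) cpos (ols_coercive B2 Bq Tq hx2)).
by rewrite /gform !mul0r !addr0; apply: eq_bigr => t _; rewrite mulrC.
Qed.

Lemma quad_ge0 a : 0 <= quad a.
Proof.
rewrite /quad /ols -(ridge_normal cpos (ols_coercive B2 Bq Tq hx2)).
by rewrite /gform mul0r addr0; apply: sumr_ge0 => t _; rewrite -expr2 sqr_ge0.
Qed.

Lemma ols_min_quad a : ols_min T x a = \sum_(t < T) a t ^+ 2 - quad a.
Proof.
have e : \sum_(t < T) inner (x t) (ols T x a) ^+ 2 = quad a.
  rewrite /quad /ols -(ridge_normal cpos (ols_coercive B2 Bq Tq hx2)).
  by rewrite /gform mul0r addr0; apply: eq_bigr => t _; rewrite expr2.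
have -> : \sum_(t < T) a t ^+ 2 - quad a =
  \sum_(t < T) a t ^+ 2 - quad a - (quad a - quad a) by ring.
rewrite -{3}e /quad /ols_min -!sumrB; apply: eq_bigr => t _; ring.
Qed.

Lemma quadD a b : quad (fun t => a t + b t) =
  quad a + quad b + 2 * \sum_(t < T) b t * inner (x t) (ols T x a).
Proof.
rewrite mulr_natl mulr2n {2}ols_sym /quad -!big_split /ols ridge_solD.
by apply: eq_bigr => t _ /=; rewrite innerDr; ring.
Qed.

(** Noises of distinct rounds are uncorrelated, so only the leverages survive. *)
Lemma E_quad_xi k : E (fun z => quad (xi z k)) = \sum_(t < T) hat t t * E (fun z => xi z k t ^+ 2).
Proof.
have -> : (fun z => quad (xi z k)) =
   (fun z => \sum_(t < T) \sum_(s < T) hat t s * (xi z k t * xi z k s)).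
  apply/funext => z; apply: eq_bigr => t _; rewrite -sum_hat mulr_sumr.
  by apply: eq_bigr => s _; ring.
rewrite pexp_sum; apply: eq_bigr => t _; rewrite pexp_sum (bigD1 t)//= pexpZ.
rewrite big1 ?addr0// => s st; rewrite pexpZ.
have cross (i j : nat) : (i < j < T)%N -> E (fun z => xi z k j * xi z k i) = 0.
  move=> /andP[ij jT]; apply: E_xi => //; exact: adaptedW ij (adapted_xi k (t := i)).
case: (ltngtP s t) => [lt|gt|/val_inj e].
- by rewrite cross ?mulr0// lt ltn_ord.
- under eq_fun do rewrite mulrC.
  by rewrite cross ?mulr0// gt ltn_ord.
- by rewrite e eqxx in st.
Qed.

Let rs k t : R := y k t - inner (x t) (ols T x (y k)).
Let glin k t : R := y k t * (2 * rs k t - (1 - hat t t) * y k t).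

(* [xi] is the noise of the inverse-probability-weighted outcomes, so the
   bilinear part of [Ahat] is the quadratic form of the noise off the diagonal. *)
Lemma Ahat_expand k z : T%:R * Ahat T x y z (p z) k - ols_min T x (y k) =
  \sum_(t < T) (pipw k z t - 1) * glin k t
  + \sum_(t < T) hat t t * xi z k t ^+ 2 - quad (xi z k).
Proof.
have obs t : observed y z t * pipw k z t = y k t + xi z k t.
  rewrite /observed /xi pipwE; case: (z t =P k) => [->|_] /=; first by ring.
  by rewrite mul0r mulr0; ring.
have obs2 t : observed y z t ^+ 2 * pipw k z t = y k t ^+ 2 * pipw k z t.
  rewrite /observed pipwE; case: (z t =P k) => [->//|_] /=.
  by rewrite mul0r !mulr0.
have T0 : T%:R != 0 :> R by rewrite Tq qX_neq0.
pose a t := y k t + xi z k t.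
have -> : T%:R * Ahat T x y z (p z) k =
    \sum_(t < T) (1 - hat t t) * (y k t ^+ 2 * pipw k z t) +
    \sum_(t < T) \sum_(s < T | s != t) resid_mx T x t s * (a t * a s).
  rewrite /Ahat mulrDr !(mulVKf T0); congr (_ + _).
    apply: eq_bigr => t _; by rewrite -mulrA resid_mxE eqxx -obs2 /pipw.
  apply: eq_bigr => t _; apply: eq_bigr => s _; rewrite /a -!obs /pipw; ring.
(* Off the diagonal both factors are weighted outcomes [a], so the double sum is the full residual
   quadratic form of [a] minus its diagonal. *)
have -> : \sum_(t < T) \sum_(s < T | s != t) resid_mx T x t s * (a t * a s) =
    \sum_(t < T) a t ^+ 2 - quad a - \sum_(t < T) (1 - hat t t) * a t ^+ 2.
  rewrite -!sumrB; apply: eq_bigr => t _.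
  have -> : a t * inner (x t) (ols T x a) = a t * (hat t t * a t)
      + \sum_(s < T | s != t) a t * (hat t s * a s).
    by rewrite -sum_hat mulr_sumr (bigD1 t).
  have -> : \sum_(s < T | s != t) resid_mx T x t s * (a t * a s) =
      - \sum_(s < T | s != t) a t * (hat t s * a s).
    rewrite -sumrN; apply: eq_bigr => s st; rewrite resid_mxE eq_sym (negbTE st) sub0r; ring.
  ring.
have -> : quad a = quad (y k) + quad (xi z k)
    + 2 * \sum_(t < T) xi z k t * inner (x t) (ols T x (y k)).
  exact: quadD.
rewrite ols_min_quad.
have e : \sum_(t < T) (1 - hat t t) * (y k t ^+ 2 * pipw k z t) + (\sum_(t < T) a t ^+ 2
    - 2 * (\sum_(t < T) xi z k t * inner (x t) (ols T x (y k)))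
    - \sum_(t < T) (1 - hat t t) * a t ^+ 2) - \sum_(t < T) y k t ^+ 2 =
   \sum_(t < T) (pipw k z t - 1) * glin k t + \sum_(t < T) hat t t * xi z k t ^+ 2.
  rewrite mulr_sumr -!sumrB -!big_split -sumrB; apply: eq_bigr => t _ /=.
  by rewrite /glin /rs /a /xi; ring.
by rewrite -e; ring.
Qed.

Definition cahat (B W : R) := 20 * B * W ^+ 2 + 1 + 4 * B ^+ 4 * W.

Lemma E_Ahat_dist k : E (fun z => `|Ahat T x y z (p z) k - ols_min T x (y k) / q ^+ 192|)
  <= cahat B W / q ^+ 2.
Proof.
have q192 := qX_gt0 B2 Bq 192.
have le z : `|Ahat T x y z (p z) k - ols_min T x (y k) / q ^+ 192| <=
  (q ^+ 192)^-1 * (`|\sum_(t < T) (pipw k z t - 1) * glin k t| +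
    (\sum_(t < T) hat t t * xi z k t ^+ 2 + quad (xi z k))).
  have -> : Ahat T x y z (p z) k - ols_min T x (y k) / q ^+ 192 =
     (q ^+ 192)^-1 * (T%:R * Ahat T x y z (p z) k - ols_min T x (y k)).
    by rewrite Tq; field.
  rewrite normrM ger0_norm ?invr_ge0 ?(ltW q192)// ler_pM2l ?invr_gt0// Ahat_expand -addrA.
  apply: le_trans (ler_normD _ _) _; apply: lerD (lexx _) _.
  apply: le_trans (ler_normB _ _) _; rewrite !ger0_norm ?quad_ge0//.
  by apply: sumr_ge0 => t _; apply: mulr_ge0 (sqr_ge0 _); have /andP[] := hat_diag (ltn_ord t).
apply: le_trans (pexp_le p01 T le) _; rewrite pexpZ !pexpD E_quad_xi.
have -> : E (fun z => \sum_(t < T) hat t t * xi z k t ^+ 2) =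
    \sum_(t < T) hat t t * E (fun z => xi z k t ^+ 2).
  by rewrite pexp_sum; apply: eq_bigr => t _; rewrite pexpZ.
have ysq := sumsqT_le B2 Bq Tq W1 (hy k).
have B3 : 0 <= B ^+ 3 / q ^+ 96 by exact: divr_ge0 (exprn_ge0 _ B0) (qX_ge0 B2 Bq _).
have dg : \sum_(t < T) hat t t * E (fun z => xi z k t ^+ 2) <= 2 * B ^+ 4 * W * q ^+ 190.
  apply: le_trans (_ : B ^+ 3 / q ^+ 96 * (2 * B * q ^+ 33) * \sum_(t < T) y k t ^+ 2 <= _).
    rewrite mulr_sumr; apply: ler_sum => t _; have /andP[h0 h1] := hat_diag (ltn_ord t).
    rewrite -mulrA; apply: ler_pM => //; first by apply: (pexp_ge0 p01) => z; exact: sqr_ge0.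
    by apply: le_trans (E_xi2_le k (ltn_ord t)) _; rewrite ler_wpM2r ?sqr_ge0.
  have b33 : 0 <= 2 * B * q ^+ 33 by exact: mulr_ge0 (mulr_ge0 (ler0n _ _) B0) (qX_ge0 B2 Bq _).
  apply: le_trans (ler_wpM2l (mulr_ge0 B3 b33) ysq) _.
  have -> : B ^+ 3 / q ^+ 96 * (2 * B * q ^+ 33) * (W * q ^+ 192) = 2 * B ^+ 4 * W * q ^+ 129.
    by field.
  apply: KqX_le (isT : 129 <= 190)%N.
  exact: mulr_ge0 (mulr_ge0 (ler0n _ _) (exprn_ge0 _ B0)) W0.
have lin2 : E (fun z => (\sum_(t < T) (pipw k z t - 1) * glin k t) ^+ 2) <=
    20 * B * W ^+ 2 * q ^+ 321.
  apply: le_trans (E_ipw_mart k (g := fun _ => glin k) (fun _ _ _ _ => erefl)) _.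
  have term t : (t < T)%N -> E (fun z => glin k t ^+ 2 / parm k z t) <=
      (2 * B * q ^+ 33) * (W * q ^+ 96) * (8 * rs k t ^+ 2 + 2 * y k t ^+ 2).
    move=> tT; rewrite -[leRHS](pexp_cst p T); apply: (pexp_le p01) => z.
    have pi := le_trans (parmV_le k z t) hm; have pi0 := ltW (parmV_gt0 k z t).
    have -> : glin k t ^+ 2 / parm k z t = (parm k z t)^-1 * (y k t ^+ 2)
      * (2 * rs k t - (1 - hat t t) * y k t) ^+ 2 by rewrite /glin; ring.
    have /andP[h0 h1] := hat_diag tT.
    have h2 : hat t t <= 2 by have := hat_le1 tT; lra.
    apply: ler_pM; [exact: mulr_ge0 pi0 (sqr_ge0 _)|exact: sqr_ge0| |].
      by apply: ler_pM => //; [exact: sqr_ge0 | exact: (sqr_le_W B2 Bq W1 (hy k) tT)].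
    have c1 : ((1 - hat t t) * y k t) ^+ 2 <= y k t ^+ 2.
      rewrite exprMn ler_piMl ?sqr_ge0//.
      have := mulr_ge0 h0 (_ : 0 <= 2 - hat t t); rewrite subr_ge0 => /(_ h2).
      have -> : (1 - hat t t) ^+ 2 = 1 - hat t t * (2 - hat t t) by ring.
      by lra.
    have := sqr_ge0 (2 * rs k t + (1 - hat t t) * y k t).
    move: (rs k t) ((1 - hat t t) * y k t) c1 => r b c1 c2.
    have -> : (2 * r - b) ^+ 2 = 8 * r ^+ 2 + 2 * b ^+ 2 - (2 * r + b) ^+ 2 by ring.
    by lra.
  apply: le_trans (ler_sum _ (fun (t : 'I_T) _ => term t (ltn_ord t))) _.
  rewrite -mulr_sumr big_split /= -!mulr_sumr.
  have S := ols_min_le_W B2 Bq Tq hx2 W1 (hy k).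
  have c0 : 0 <= 2 * B * q ^+ 33 * (W * q ^+ 96).
    exact: mulr_ge0 (mulr_ge0 (mulr_ge0 (ler0n _ _) B0) (qX_ge0 B2 Bq _))
      (mulr_ge0 W0 (qX_ge0 B2 Bq _)).
  have -> : 20 * B * W ^+ 2 * q ^+ 321 =
    2 * B * q ^+ 33 * (W * q ^+ 96) * (8 * (W * q ^+ 192) + 2 * (W * q ^+ 192)) by ring.
  by rewrite ler_wpM2l//; apply: lerD; rewrite ler_wpM2l.
have lin := E_abs_le (qX_gt0 B2 Bq 190) lin2.
have lin' : 20 * B * W ^+ 2 * q ^+ 321 / q ^+ 190 <= 20 * B * W ^+ 2 * q ^+ 190.
  have -> : 20 * B * W ^+ 2 * q ^+ 321 / q ^+ 190 = 20 * B * W ^+ 2 * q ^+ 131 by field.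
  apply: KqX_le (isT : 131 <= 190)%N.
  exact: mulr_ge0 (mulr_ge0 (ler0n _ _) B0) (sqr_ge0 _).
have -> : cahat B W / q ^+ 2 = (q ^+ 192)^-1 * (20 * B * W ^+ 2 * q ^+ 190 + q ^+ 190 +
   (2 * B ^+ 4 * W * q ^+ 190 + 2 * B ^+ 4 * W * q ^+ 190)).
  by rewrite /cahat; field.
rewrite ler_pM2l ?invr_gt0//; apply: lerD; last exact: lerD.
exact: le_trans lin (lerD lin' (lexx _)).
Qed.

End NoisyRidge.

(** * Coverage at a fixed horizon *)

Lemma eq_CI (R : realType) (T d : nat) (x : nat -> 'cV[R]_d) (y : bool -> nat -> R)
    (z z' : nat -> bool) (p p' : nat -> R) (beta beta' : bool -> nat -> 'cV[R]_d) (alpha : R) :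
  (forall t, (t < T)%N -> z t = z' t) -> (forall t, (t < T)%N -> p t = p' t) ->
  (forall k t, (t < T)%N -> beta k t = beta' k t) ->
  CI T x y z p beta alpha = CI T x y z' p' beta' alpha.
Proof.
move=> ze pe be.
have oe t : (t < T)%N -> observed y z t = observed y z' t.
  by move=> tT; rewrite /observed ze.
have ie k t : (t < T)%N -> ipw z p k t = ipw z' p' k t.
  by move=> tT; rewrite /ipw ze// pe.
have ae : aipw T x y z p beta = aipw T x y z' p' beta'.
  by rewrite /aipw; congr (_ * _); apply: eq_bigr => t _; rewrite !be// !ie// oe.
have he k : Ahat T x y z p k = Ahat T x y z' p' k.
  rewrite /Ahat; congr (_ * _ + _ * _); first by apply: eq_bigr => t _; rewrite ie// oe.
  by apply: eq_bigr => t _; apply: eq_bigr => s _; rewrite !ie// !oe.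
by rewrite /CI ae /VB_hat /resid_hat !he.
Qed.

Section ClippedDesign.
Context {R : realType} (T d : nat) (x : nat -> 'cV[R]_d) (y : bool -> nat -> R) (B q : R).
Hypothesis B2 : 2 <= B.
Hypothesis Bq : B <= q.
Hypothesis Tq : T%:R = q ^+ 192.
Hypothesis hx3 : forall t, (t < T)%N -> enorm (x t) <= B * q ^+ 48.
Hypothesis hx2 : forall n v, (n <= T)%N -> B * q ^+ 96 <= n%:R ->
  n%:R / B * inner v v <= \sum_(s < n) inner (x s) v ^+ 2.
Variable W : R.
Hypothesis W1 : 1 <= W.
Hypothesis hy : forall k, \sum_(t < T) y k t ^+ 4 <= W ^+ 2 * q ^+ 192.
Variables (phi : R -> R) (b1 b2 b3 : R).
Hypothesis hb1 : 0 < b1.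
Hypothesis hb2 : 0 < b2.
Hypothesis hphi : sigmoid_condition b1 b2 b3 phi.
Hypothesis b1B : b1 <= B.
Hypothesis b2B : b2 <= B.
Implicit Types (z : nat -> bool) (k : bool) (t : nat).

Local Notation p := (clip_prob T phi x y (q ^+ 33)).
Local Notation uu := (clip_u T phi x y (q ^+ 33)).
Local Notation m := (2 * B * q ^+ 33).

Let q_gt0' : 0 < q. Proof. exact: q_gt0 B2 Bq. Qed.
Let qn0 : q != 0. Proof. by rewrite gt_eqF. Qed.
Let B0 : 0 <= B. Proof. by have := B2; lra. Qed.
Let kap_gt0 t : 0 < ikap T x t := ikap_gt0 x B2 Bq Tq t.
Let U0 : 0 <= q ^+ 33. Proof. exact: (qX_ge0 B2 Bq 33). Qed.

Let p0 z t : 0 < p z t < 1.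
Proof. by rewrite clip_probE (phi_gt0 hphi) (phi_lt1 hphi). Qed.

Let p01 z t : 0 <= p z t <= 1.
Proof. by have := p0 z t; lra. Qed.

Let pa t : adapted t (p^~ t) := adapted_clip_prob T phi x y (q ^+ 33) (t := t).

Let eta0 t : 0 < (Defs.eta T x t.+1)^-1.
Proof.
rewrite /Defs.eta invr_gt0 mulr_gt0// invr_gt0.
  by rewrite (sqrtT B2 Bq Tq) (qX_gt0 B2 Bq).
by apply: lt_le_trans ltr01 _; exact: radius_ge1.
Qed.

Lemma clip_cum_loss_ge0 z k t : 0 <= cum_loss T x y z (p z) k t.
Proof.
apply: sumr_ge0 => s _; rewrite mulr_ge0 ?sqr_ge0//.
exact: (pipw_ge0 p0).
Qed.

Lemma clip_u_norm z t : `|uu z t| <= q ^+ 33.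
Proof.
by have [] := clip_logit_min hphi (fun k => clip_cum_loss_ge0 z k t) (eta0 t) U0.
Qed.

Let invm (u : R) : `|u| <= q ^+ 33 -> 2 + b1 * `|u| <= m.
Proof.
move=> h; have h1 : b1 * `|u| <= B * q ^+ 33 by rewrite ler_pM// ltW.
have h2 : 2 <= B * q ^+ 33.
  apply: le_trans B2 _; rewrite ler_peMr//; exact: (qX_ge1 B2 Bq).
lra.
Qed.

Let pm z t : (p z t)^-1 <= m.
Proof.
rewrite clip_probE; apply: le_trans (inv_phi_le hphi _) _.
exact: invm (clip_u_norm z t).
Qed.

Let pcm z t : (1 - p z t)^-1 <= m.
Proof.
rewrite clip_probE; apply: le_trans (inv_phic_le hphi _) _.
exact: invm (clip_u_norm z t).
Qed.

Lemma clip_ridge z k t : (t < T)%N -> ridge T x y z (p z) k t =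
  ridge_sol x (ikap T x) (fun s => y k s + xi y p z k s) t.
Proof.
move=> tT; rewrite -(argmin_ridge_pos x kap_gt0) /ridge; congr argmin.
apply/funext => v; rewrite /ridge_obj eta_ikap// enorm_sqr; congr (_ + _).
apply: eq_bigr => s _; congr ((_ - _) ^+ 2).
rewrite /observed /xi -/(pipw p k z s) pipwE; case: (z s =P k) => [->|_] /=; first by ring.
by rewrite mul0r mulr0; ring.
Qed.

Lemma clip_ures z k t : (t < T)%N ->
  y k t - inner (x t) (ridge T x y z (p z) k t) = ures T x y p k z t.
Proof.
move=> tT; rewrite clip_ridge// ridge_solD innerDr /ures /res0 /npred /ridge_res.
by rewrite opprD addrA.
Qed.

Lemma clip_cum_loss z k t : (t <= T)%N ->
  cum_loss T x y z (p z) k t = \sum_(s < t) arm_loss T x y p k z s.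
Proof.
move=> tT; apply: eq_bigr => s _; have sT := leq_trans (ltn_ord s) tT.
rewrite /arm_loss -(clip_ures z k sT) -/(pipw p k z s) pipwE /observed.
by case: (z s =P k) => [->//|_] /=; rewrite !mul0r.
Qed.

Let umin z t : (t < T)%N -> fminimizer phi
  (\sum_(s < t) arm_loss T x y p true z s) (\sum_(s < t) arm_loss T x y p false z s)
  (ikap T x t) (q ^+ 33) (uu z t).
Proof.
move=> tT; rewrite -!clip_cum_loss ?(ltnW tT)// -eta_ikap//.
exact: (clip_logit_min hphi (fun k => clip_cum_loss_ge0 z k t) (eta0 t) U0).
Qed.

Lemma clip_aipw z : T%:R * (aipw T x y z (p z) (ridge T x y z (p z)) - ate T y) =
  \sum_(t < T) mdiff p (wgt T x y p) z t.
Proof.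
have T0 : T%:R != 0 :> R by rewrite Tq expf_neq0.
rewrite /aipw /ate -mulrBr (mulVKf T0) -sumrB; apply: eq_bigr => t _.
have /andP[r0 r1] := p0 z t.
have h0 : p z t != 0 by rewrite gt_eqF.
have h1 : 1 - p z t != 0 by rewrite gt_eqF// subr_gt0.
rewrite /mdiff /wgt big_bool /= -!clip_ures// /parm /ipw /observed.
by case: (z t) => /=; field; rewrite h0 h1.
Qed.

(** Dividing by the least weight [q ^+ 96] of the regularizer leaves [q ^+ 99], the cube of the
    clipping level: on this event no logit is clipped. *)
Let calm z := 2 * (total_loss T x y p true z + total_loss T x y p false z) <= q ^+ 195.

Let surj z t : exists u, phi u = ftrl_step T phi x y z (p z) t.
Proof.
have [u [e _]] := ftrl_stepP hphi (fun k => clip_cum_loss_ge0 z k t) (eta0 t).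
by exists u.
Qed.

Lemma calm_ftrl z t : calm z -> (t < T)%N -> p z t = ftrl_prob T phi x y z t.
Proof.
move=> hz; apply: clip_prob_ftrl; [|exact: surj|exact: phi_inj hphi].
move=> {}t tT; have := logit_ftrl_step_cube hphi (fun k => clip_cum_loss_ge0 z k t) (eta0 t).
rewrite eta_ikap// !clip_cum_loss ?(ltnW tT)// => h.
have mono k : \sum_(s < t) arm_loss T x y p k z s <= total_loss T x y p k z.
  apply: (@partial_sum_le _ (arm_loss T x y p k z) _ _ _ (ltnW tT)) => s _.
  exact: (arm_loss_ge0 T x y p0 k z s).
set l := `|_|; have l0 : 0 <= l by exact: normr_ge0.
have h1 : q ^+ 96 * l ^+ 3 <= q ^+ 96 * (q ^+ 33) ^+ 3.
  apply: le_trans (_ : ikap T x t * l ^+ 3 <= _).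
    by rewrite ler_wpM2r ?exprn_ge0// (ikap_ge x B2 Bq Tq).
  apply: le_trans h _; have -> : q ^+ 96 * (q ^+ 33) ^+ 3 = q ^+ 195 by ring.
  by apply: le_trans hz; rewrite ler_pM2l// lerD.
rewrite ler_pM2l ?(qX_gt0 B2 Bq)// in h1.
by rewrite -(ler_pXn2r (n := 3))// nnegrE.
Qed.

Lemma pprob_not_calm : pprob p T (fun z => ~~ calm z) <= 4 * closs B W / q ^+ 3.
Proof.
have -> : 4 * closs B W / q ^+ 3 = 2 * (closs B W * q ^+ 192 + closs B W * q ^+ 192) / q ^+ 195.
  by field.
apply: le_trans (_ : pprob p T (fun z => q ^+ 195 <
    2 * (total_loss T x y p true z + total_loss T x y p false z)) <= _).
  by apply: (pprob_le p01) => z; rewrite /calm -ltNge.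
apply: (markov_pexp p01); first exact: (qX_gt0 B2 Bq).
  by move=> z; rewrite mulr_ge0// addr_ge0// (total_loss_ge0 T x y p0).
rewrite pexpZ pexpD ler_pM2l//.
have el := E_total_loss B2 Bq Tq hx3 hx2 W1 hy pa p0 pm pcm (lexx m).
by apply: lerD; exact: el.
Qed.

Lemma ftrl_prob01 z t : 0 < ftrl_prob T phi x y z t < 1.
Proof.
have [n] := ubnP t; elim: n t => // n IH t tn.
rewrite ftrl_probE (hprobE (@ftrl_step_local _ _ _ _ _ _)); set f := hprob _ z.
have fE s : (s < t)%N -> 0 < f s < 1.
  by move=> st; rewrite /f -ftrl_probE IH//; exact: leq_trans st tn.
have cl k : 0 <= cum_loss T x y z f k t.
  apply: sumr_ge0 => s _; apply: mulr_ge0 (sqr_ge0 _).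
  by rewrite /ipw divr_ge0//; have := fE s (ltn_ord s); case: k; lra.
have [u [<- _]] := ftrl_stepP hphi cl (eta0 t).
by rewrite (phi_gt0 hphi) (phi_lt1 hphi).
Qed.

Lemma adapted_ftrl_prob t : adapted t ((ftrl_prob T phi x y)^~ t).
Proof.
by move=> z z' h; rewrite !ftrl_probE; exact: (adapted_hprob (@ftrl_step_local _ _ _ _ _ _) h).
Qed.

Lemma calm_CI z alpha : calm z -> ftrl_CI T phi x y alpha z =
  CI T x y z (p z) (ridge T x y z (p z)) alpha.
Proof.
move=> hz; have pe t : (t < T)%N -> ftrl_prob T phi x y z t = p z t.
  by move=> tT; rewrite calm_ftrl.
apply: eq_CI => // k t tT; apply: ridge_local => s st; split=> //.
by apply: pe; exact: ltn_trans tT.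
Qed.

Variables (gs : bool -> R) (us : R).
Hypothesis gs0 : forall k, 0 < gs k.
Hypothesis gsE : forall k, gs k ^+ 2 = ols_min T x (y k).
Hypothesis gsB : forall k, gs (~~ k) <= B * gs k.
Hypothesis usE : phi us = gs true / (gs true + gs false).
Hypothesis usB : `|us| <= B.

Section Coverage.
Variables (alpha c0 c1 zal a C del r : R).
Hypothesis zalE : zal = normal_quantile (1 - alpha / 2).
Hypothesis zal0 : 0 < zal.
Hypothesis c00 : 0 < c0.
Hypothesis gsc : forall k, c0 * q ^+ 96 <= gs k <= c1 * q ^+ 96.
Hypothesis a0 : 0 < a.
Hypothesis C0 : 0 <= C.
Hypothesis hC : clt_bound a C.
Hypothesis del0 : 0 < del.
Hypothesis dels : 3 * del <= 2 * c0 * zal.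
Hypothesis r0 : 0 < r.
Hypothesis rc : r <= c0 ^+ 2.
Hypothesis rd : zal * (2 * c1) * (r / c0 ^+ 2) <= del.

Let s := 4 * gs true * gs false / q ^+ 192.
(** The three [del] pay for undoing the smoothing in the central limit theorem, for the noise part
    of the weights, and for the error of the estimated width. *)
Let zeta := zal * Num.sqrt s - 3 * del.

Let q96 : 0 < q ^+ 96. Proof. exact: (qX_gt0 B2 Bq). Qed.
Let q192E : q ^+ 192 = q ^+ 96 * q ^+ 96. Proof. by ring. Qed.
Let c10 : 0 < c1.
Proof.
have /andP[h1 h2] := gsc true; have := lt_le_trans (gs0 true) h2.
by rewrite pmulr_lgt0.
Qed.

Let sc : 2 * c0 <= Num.sqrt s <= 2 * c1.
Proof.
have h : 4 * c0 ^+ 2 <= s <= 4 * c1 ^+ 2.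
  have /andP[l1 u1] := gsc true; have /andP[l0 u0] := gsc false.
  rewrite /s ler_pdivlMr ?ler_pdivrMr ?(qX_gt0 B2 Bq)//.
  have -> : 4 * c0 ^+ 2 * q ^+ 192 = 4 * ((c0 * q ^+ 96) * (c0 * q ^+ 96)) by ring.
  have -> : 4 * c1 ^+ 2 * q ^+ 192 = 4 * ((c1 * q ^+ 96) * (c1 * q ^+ 96)) by ring.
  have cq : 0 <= c0 * q ^+ 96 by rewrite mulr_ge0// ltW.
  have -> : 4 * gs true * gs false = 4 * (gs true * gs false) by ring.
  rewrite !ler_pM2l//; apply/andP; split; apply: ler_pM => //; exact: ltW.
have /andP[h0 h1] := h.
have e c : 0 < c -> 2 * c = Num.sqrt (4 * c ^+ 2).
  move=> cp; have -> : 4 * c ^+ 2 = (2 * c) ^+ 2 by ring.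
  by rewrite sqrtr_sqr gtr0_norm// mulr_gt0.
by rewrite !e//; apply/andP; split; exact: ler_wsqrtr.
Qed.

Let zeta0 : 0 <= zeta.
Proof.
have /andP[h _] := sc; have := ler_wpM2l (ltW zal0) h; rewrite /zeta; have := dels; lra.
Qed.

Lemma CI_cover z :
  `|\sum_(t < T) mdiff p (wgt T x y p) z t| <= (zeta + 2 * del) * q ^+ 96 ->
  (forall k, `|Ahat T x y z (p z) k - ols_min T x (y k) / q ^+ 192| <= r) ->
  CI T x y z (p z) (ridge T x y z (p z)) alpha (ate T y).
Proof.
move=> hM hA; rewrite /CI -zalE /= in_itv /=.
set ta := aipw _ _ _ _ _ _; set tau := ate _ _; set v := Num.sqrt _.
suff h : `|ta - tau| <= zal * v.
  by move: h; rewrite ler_norml => /andP[h1 h2]; apply/andP; split; lra.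
have T0 : 0 < T%:R :> R by rewrite Tq (qX_gt0 B2 Bq).
have hd : `|ta - tau| <= (zeta + 2 * del) / q ^+ 96.
  rewrite ler_pdivlMr// -(ler_pM2r q96); apply: le_trans hM.
  rewrite -mulrA -q192E -Tq -(clip_aipw z) normrM (gtr0_norm T0) mulrC.
  by [].
apply: le_trans hd _.
(* A bound on the relative error of the estimated residuals. The width is the root of a product of
   two of them, so it loses the factor [1 - kp] only once. *)
pose kp := r / c0 ^+ 2.
have kp1 : kp <= 1 by rewrite /kp ler_pdivrMr ?exprn_gt0// mul1r.
have kp0 : 0 <= kp by rewrite divr_ge0 ?sqr_ge0// ltW.
have rh k : (1 - kp) * (gs k / q ^+ 96) <= resid_hat T x y z (p z) k.
  have ge : 0 < gs k / q ^+ 96 by rewrite divr_gt0.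
  have m0 : 0 <= Num.max (Ahat T x y z (p z) k) 0 by rewrite le_max lexx orbT.
  apply: le_trans (sqrt_ge_sub m0 ge).
  have -> : (gs k / q ^+ 96) ^+ 2 = ols_min T x (y k) / q ^+ 192 by rewrite -gsE; field.
  set S := ols_min _ _ _ / _; have S0 : 0 <= S.
    by rewrite divr_ge0 ?ols_min_ge0 ?(qX_ge0 B2 Bq).
  have hr : `|Num.max (Ahat T x y z (p z) k) 0 - S| <= r.
    have := hA k; rewrite -/S !ler_norml => /andP[g1 g2].
    case: (leP (Ahat T x y z (p z) k) 0) => g3; apply/andP; split; lra.
  rewrite mulrBl mul1r lerD2l lerN2 ler_pdivrMr//; apply: le_trans hr _.
  have -> : kp * (gs k / q ^+ 96) * (gs k / q ^+ 96) = r * ((gs k / q ^+ 96 / c0) ^+ 2).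
    by rewrite /kp; field; rewrite qn0 gt_eqF.
  rewrite ler_peMr ?(ltW r0)// exprn_ege1//.
  by rewrite !ler_pdivlMr// mul1r; have /andP[] := gsc k.
have vge : (1 - kp) * (Num.sqrt s / q ^+ 96) <= v.
  have k1 : 0 <= 1 - kp by rewrite subr_ge0.
  have -> : (1 - kp) * (Num.sqrt s / q ^+ 96) = Num.sqrt (((1 - kp) / q ^+ 96) ^+ 2 * s).
    rewrite [RHS]sqrtrM ?sqr_ge0// sqrtr_sqr ger0_norm ?divr_ge0 ?(ltW q96)//; ring.
  apply: ler_wsqrtr; rewrite /VB_hat.
  have -> : ((1 - kp) / q ^+ 96) ^+ 2 * s = 4 / T%:R *
     (((1 - kp) * (gs true / q ^+ 96)) * ((1 - kp) * (gs false / q ^+ 96))).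
    by rewrite Tq /s; field.
  have w (j : bool) : 0 <= (1 - kp) * (gs j / q ^+ 96).
    exact: mulr_ge0 k1 (divr_ge0 (ltW (gs0 j)) (ltW q96)).
  rewrite ler_wpM2l ?divr_ge0//.
  exact: ler_pM (w true) (w false) (rh true) (rh false).
apply: le_trans (ler_wpM2l (ltW zal0) vge).
have -> : zal * ((1 - kp) * (Num.sqrt s / q ^+ 96)) =
  (zal * Num.sqrt s - zal * Num.sqrt s * kp) / q ^+ 96 by ring.
rewrite ler_wpM2r ?invr_ge0 ?(ltW q96)//.
have /andP[_ s1] := sc.
have : zal * Num.sqrt s * kp <= zal * (2 * c1) * kp by rewrite ler_wpM2r// ler_pM2l.
by rewrite /zeta; have := rd; rewrite -/kp; lra.
Qed.

(** The event is intersected with [calm] before [pexp_coupling] moves it to the clipped design,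
    where a union bound collects the exceptional events. *)
Lemma coverage : 4 * B * (1 + cres B W) / q ^+ 3 <= 1 ->
  2 * ncdf (zeta / Num.sqrt (s + a)) - 1 - ncdf (- (del / Num.sqrt (2 * a)))
  - C * (4 * B * (1 + cres B W) / q ^+ 3) * (s + a)
  - 2 * (cval B W + 12 * B ^+ 2 * W) / a / q ^+ 2
  - 2 * cmnoise B W / del ^+ 2 / q ^+ 5
  - 2 * (cahat B W / q ^+ 2 / r) - 4 * closs B W / q ^+ 3
  <= pprob (ftrl_prob T phi x y) T (fun z => `[< ftrl_CI T phi x y alpha z (ate T y) >]).
Proof.
move=> e1.
have clt := clt_wgt B2 Bq Tq hx3 hx2 W1 hy pa p0 pm pcm (lexx m) hb1 hb2 hphi b1B b2B
  (fun z t => clip_probE T phi x y (q ^+ 33) z t)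
  (fun t => adapted_clip_u T phi x y (q ^+ 33) (t := t)) umin gs0 gsE gsB usE usB
  a0 C0 hC e1 zeta0 del0.
rewrite /= -/s in clt.
pose good z := `|\sum_(t < T) mdiff p (wgt T x y p) z t| <= (zeta + 2 * del) * q ^+ 96.
pose far k z := r < `|Ahat T x y z (p z) k - ols_min T x (y k) / q ^+ 192|.
pose CIf z := `[< ftrl_CI T phi x y alpha z (ate T y) >].
have hfar k : pprob p T (far k) <= cahat B W / q ^+ 2 / r.
  apply: (markov_pexp p01) => //.
  exact: (E_Ahat_dist B2 Bq Tq hx3 hx2 W1 hy pa p0 pm pcm (lexx m)).
have couple : pprob (ftrl_prob T phi x y) T (fun z => CIf z && calm z) =
    pprob p T (fun z => CIf z && calm z).
  apply: pexp_coupling; [exact: adapted_ftrl_prob|exact: pa|].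
  move=> z [t tT ne]; case hz : (calm z); last by rewrite andbF.
  by rewrite (calm_ftrl hz tT) eqxx in ne.
have pf01 z t : 0 <= ftrl_prob T phi x y z t <= 1.
  by have := ftrl_prob01 z t; lra.
apply: le_trans (_ : pprob (ftrl_prob T phi x y) T (fun z => CIf z && calm z) <= _); last first.
  by apply: (pprob_le pf01) => z /andP[].
rewrite couple.
have split : pprob p T good <= pprob p T (fun z => CIf z && calm z) +
   (pprob p T (fun z => ~~ calm z) + (pprob p T (far true) + pprob p T (far false))).
  apply: le_trans (_ : pprob p T (fun z =>
    (CIf z && calm z) || (~~ calm z || (far true z || far false z))) <= _).
    apply: (pprob_le p01) => z gz; case hz : (calm z) => /=; last by rewrite orbT.
    have [//|/= f1] := boolP (far true z); first by rewrite !orbT.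
    have [//|/= f0] := boolP (far false z); first by rewrite !orbT.
    rewrite andbT orbF; apply/asboolP; rewrite calm_CI//; apply: CI_cover => // k.
    by rewrite leNgt; case: k.
  apply: le_trans (pprobU p01 _ _ _) _; apply: lerD => //.
  apply: le_trans (pprobU p01 _ _ _) _; apply: lerD => //.
  exact: pprobU.
have := pprob_not_calm; have := hfar true; have := hfar false.
rewrite -/good in clt; lra.
Qed.

End Coverage.
End ClippedDesign.

(** * Asymptotics *)

Lemma ncdf_lip (R : realType) (u v : R) : `|ncdf v - ncdf u| <= `|v - u|.
Proof.
rewrite -[leRHS]mul1r; apply: (mean_value_le (df := normal_pdf 0 1)) => r _.
  exact: is_derive_ncdf.
rewrite normal_pdf01E ger0_norm ?mulr_ge0 ?normal_peak_ge0 ?expR_ge0//.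
rewrite -[leRHS]mulr1; apply: ler_pM; rewrite ?normal_peak_ge0 ?expR_ge0//.
  have pi2 : 0 < pi *+ 2 :> R by rewrite pmulrn_lgt0 ?pi_gt0.
  rewrite /normal_peak expr1n mul1r invf_le1 ?sqrtr_gt0//.
  rewrite -[leLHS]sqrtr1; apply: ler_wsqrtr; rewrite -mulr_natl.
  by have := @pi_ge2 R; lra.
by rewrite -[leRHS]expR0 ler_expR oppr_le0 divr_ge0 ?sqr_ge0.
Qed.

Lemma limn_einf_ge (R : realType) (u : nat -> \bar R) (c : R) :
  (forall e, 0 < e -> exists N, forall n, (N <= n)%N -> ((c - e)%:E <= u n)%E) ->
  (c%:E <= limn_einf u)%E.
Proof.
move=> hu; apply/lee_addgt0Pr => e e0; have [N hN] := hu _ e0.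
have : ((c - e)%:E <= limn_einf u)%E.
  rewrite limn_einf_lim; apply: lime_ge; first exact: is_cvg_einfs.
  exists N => // n /= Nn; apply: le_ereal_inf_tmp => _ /= [k nk <-].
  by apply: hN; exact: leq_trans Nn nk.
by rewrite EFinB leeBlDr.
Qed.

Lemma scaled_gram_psd (R : realType) (d n : nat) (x : nat -> 'cV[R]_d) :
  psd (n%:R^-1 *: \sum_(s < n) (x s *m (x s)^T)).
Proof.
split=> [|v].
  rewrite linearZ /= raddf_sum; congr (_ *: _); apply: eq_bigr => s _.
  by rewrite /= trmx_mul trmxK.
rewrite -scalemxAl innerZl mulmx_suml inner_suml.
by rewrite mulr_ge0 ?invr_ge0// sumr_ge0// => s _; rewrite inner_outer -expr2 sqr_ge0.
Qed.

Lemma gram_lower (R : realType) (d n : nat) (x : nat -> 'cV[R]_d) (c : R) (v : 'cV[R]_d) :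
  (0 < n)%N -> c <= sigma_min (n%:R^-1 *: \sum_(s < n) (x s *m (x s)^T)) ->
  n%:R * c * inner v v <= \sum_(s < n) inner (x s) v ^+ 2.
Proof.
move=> n0 hc; have nR : 0 < n%:R :> R by rewrite ltr0n.
have := ler_wpM2l (ltW nR) (le_trans (ler_wpM2r (inner_ge0 v) hc)
  (sigma_min_le v (scaled_gram_psd n x))).
rewrite mulrA -scalemxAl innerZl mulmx_suml inner_suml mulVKf ?gt_eqF//.
by under [X in _ <= X -> _]eq_bigr do rewrite inner_outer -expr2.
Qed.

Section Instance.
Context {R : realType} (T d : nat) (x : nat -> 'cV[R]_d) (y : bool -> nat -> R) (B q : R).
Hypothesis B2 : 2 <= B.
Hypothesis Bq : B <= q.
Hypothesis Tq : T%:R = q ^+ 192.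
Hypothesis hx2 : forall n v, (n <= T)%N -> B * q ^+ 96 <= n%:R ->
  n%:R / B * inner v v <= \sum_(s < n) inner (x s) v ^+ 2.

Lemma resid_ols k : resid T x y k = Num.sqrt (ols_min T x (y k)) / q ^+ 96.
Proof.
have q96 : 0 < q ^+ 96 by exact: (qX_gt0 B2 Bq).
have qi : Num.sqrt (T%:R^-1 : R) = (q ^+ 96)^-1.
  by rewrite sqrtrV ?ler0n// (sqrtT B2 Bq Tq).
have rE v : rmse T x y k v = Num.sqrt (\sum_(t < T) (y k t - inner (x t) v) ^+ 2) / q ^+ 96.
  by rewrite /rmse sqrtrM ?invr_ge0// qi mulrC.
apply/eqP; rewrite eq_le; apply/andP; split.
  apply: ge_inf; last by exists (ols T x (y k)) => //; rewrite rE.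
  by exists 0 => _ [v _ <-]; exact: sqrtr_ge0.
apply: lb_le_inf; first by exists (rmse T x y k 0), 0.
move=> _ [v _ <-]; rewrite rE ler_wpM2r ?invr_ge0 ?(ltW q96)//.
by apply: ler_wsqrtr; exact: ols_min_le B2 Bq Tq hx2 (y k) v.
Qed.

End Instance.

Lemma adapted_ftrl_CI (R : realType) (T d : nat) (phi : R -> R) (x : nat -> 'cV[R]_d)
    (y : bool -> nat -> R) (alpha r : R) :
  adapted T (fun z => `[< ftrl_CI T phi x y alpha z r >]).
Proof.
move=> z z' h; have he t : (t < T)%N -> z t = z' t by exact: h.
have pe t : (t < T)%N -> ftrl_prob T phi x y z t = ftrl_prob T phi x y z' t.
  by move=> tT; apply: adapted_ftrl_prob => s st; apply: h; exact: ltn_trans tT.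
have be k t : (t < T)%N -> ftrl_beta T phi x y z k t = ftrl_beta T phi x y z' k t.
  move=> tT; apply: ridge_local => s st; have sT := ltn_trans st tT.
  by split; [exact: he | exact: pe].
by rewrite /ftrl_CI (eq_CI x y alpha he pe be).
Qed.

Lemma powR_inv_expK (R : realType) (n : nat) (u : R) : (0 < n)%N -> 0 <= u ->
  (u `^ (n%:R^-1)) ^+ n = u.
Proof.
move=> n0 u0; rewrite -powR_mulrn ?powR_ge0// -powRrM mulVf ?powRr1//.
by rewrite pnatr_eq0 -lt0n.
Qed.

Lemma div_pow_le (R : realType) (u q : R) (n : nat) : 1 <= q ->
  u / q ^+ n.+1 <= `|u| / q.
Proof.
move=> q1; have q0 : 0 < q by apply: lt_le_trans q1.
apply: le_trans (_ : `|u| / q ^+ n.+1 <= _).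
  by rewrite ler_wpM2r ?ler_norm// invr_ge0 exprn_ge0// ltW.
by rewrite ler_wpM2l// lef_pV2 ?posrE ?exprn_gt0// exprS ler_peMr ?(ltW q0)// exprn_ege1.
Qed.

Section Array.
Context {R : realType} (T d : nat) (x : nat -> 'cV[R]_d) (y : bool -> nat -> R) (B q : R).
Variables (phi : R -> R) (b1 b2 b3 c0 c1 c2 c3 gamma0 M : R).
Hypothesis hb1 : 0 < b1.
Hypothesis hb2 : 0 < b2.
Hypothesis hphi : sigmoid_condition b1 b2 b3 phi.
Hypothesis hc0 : 0 < c0.
Hypothesis hc01 : c0 <= c1.
Hypothesis hc2 : 0 < c2.
Hypothesis hM : forall u, M <= u -> 1 - c0 / (2 * c1) < phi u.
Hypothesis B2 : 2 <= B.
Hypothesis b1B : b1 <= B.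
Hypothesis b2B : b2 <= B.
Hypothesis c2B : c2 <= B.
Hypothesis c3B : c3 <= B.
Hypothesis gamma0B : gamma0 <= B.
Hypothesis c10B : c1 / c0 <= B.
Hypothesis MB : M <= B.
Hypothesis Bq : B <= q.
Hypothesis Tq : T%:R = q ^+ 192.
Hypothesis hA1 : assumption1 T x y c0 c1.
Hypothesis hA2 : assumption2 T x c2 gamma0.
Hypothesis hA3 : assumption3 T x c3.

Let B0 : 0 < B. Proof. by have := B2; lra. Qed.
Let q0 : 0 < q. Proof. exact: q_gt0 B2 Bq. Qed.
Let q96 : 0 < q ^+ 96. Proof. exact: (qX_gt0 B2 Bq). Qed.
Let qn0 : q != 0. Proof. by rewrite gt_eqF. Qed.
Let hc1 : 0 < c1. Proof. by have := hc0; have := hc01; lra. Qed.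

Lemma array_norm t : (t < T)%N -> enorm (x t) <= B * q ^+ 48.
Proof.
move=> tT; have : enorm (x t) <= c3 * T%:R `^ (4%:R^-1).
  by apply: le_trans hA3; exact: (le_bigmax 0 (fun i : 'I_T => enorm (x i)) (Ordinal tT)).
have -> : T%:R `^ (4%:R^-1) = q ^+ 48 :> R.
  apply/eqP; rewrite -(eqrXn2 (n := 4))// ?powR_ge0 ?(qX_ge0 B2 Bq)//.
  by rewrite powR_inv_expK// Tq; apply/eqP; ring.
by move/le_trans; apply; rewrite ler_wpM2r// (qX_ge0 B2 Bq).
Qed.

Lemma array_gram n v : (n <= T)%N -> B * q ^+ 96 <= n%:R ->
  n%:R / B * inner v v <= \sum_(s < n) inner (x s) v ^+ 2.
Proof.
move=> nT Bn; have n0 : (0 < n)%N.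
  by rewrite -(ltr0n R); apply: lt_le_trans Bn; exact: mulr_gt0.
have := gram_lower v n0 (hA2 (n := n) _ _); rewrite n0 nT => /(_ isT) h.
apply: le_trans (h _).
  rewrite ler_wpM2r ?inner_ge0// ler_wpM2l// div1r lef_pV2 ?posrE//.
rewrite (sqrtT B2 Bq Tq); apply: le_trans Bn; rewrite mulrC ler_wpM2r//.
exact: ltW.
Qed.

Let W := 1 + c1 ^+ 2.
Let W1 : 1 <= W. Proof. by rewrite lerDl sqr_ge0. Qed.

Lemma array_fourth k : \sum_(t < T) y k t ^+ 4 <= W ^+ 2 * q ^+ 192.
Proof.
have [_] := hA1 k; set m := _ * \sum_(t < T) _ => h.
have m0 : 0 <= m.
  by rewrite mulr_ge0 ?invr_ge0// sumr_ge0// => t _; rewrite exprn_even_ge0.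
have T0 : 0 < T%:R :> R by rewrite Tq (qX_gt0 B2 Bq).
have mc : m <= c1 ^+ 4.
  rewrite -(powR_inv_expK (n := 4) _ m0)// ler_pXn2r ?nnegrE ?powR_ge0//.
  exact: ltW.
have -> : \sum_(t < T) y k t ^+ 4 = T%:R * m by rewrite mulVKf// gt_eqF.
rewrite mulrC Tq ler_wpM2r ?(qX_ge0 B2 Bq)//; apply: le_trans mc _.
have -> : W ^+ 2 = c1 ^+ 4 + (1 + 2 * c1 ^+ 2) by rewrite /W; ring.
by rewrite lerDl addr_ge0// mulr_ge0// sqr_ge0.
Qed.

Let gs k := Num.sqrt (ols_min T x (y k)).

Lemma array_resid k : c0 * q ^+ 96 <= gs k <= c1 * q ^+ 96.
Proof.
have [] := hA1 k; rewrite (resid_ols y B2 Bq Tq array_gram) -/(gs k).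
move=> /andP[h1 h2] h3; have h4 := le_trans h2 h3.
by apply/andP; split; [rewrite -ler_pdivlMr | rewrite -ler_pdivrMr].
Qed.

Let gs0 k : 0 < gs k.
Proof. by have /andP[h _] := array_resid k; apply: lt_le_trans h; exact: mulr_gt0. Qed.

Let gsE k : gs k ^+ 2 = ols_min T x (y k).
Proof. by rewrite sqr_sqrtr// ols_min_ge0. Qed.

Let gsB k : gs (~~ k) <= B * gs k.
Proof.
have /andP[_ h1] := array_resid (~~ k); have /andP[h2 _] := array_resid k.
apply: le_trans h1 _; apply: le_trans (_ : B * (c0 * q ^+ 96) <= _); last by rewrite ler_pM2l.
by rewrite mulrA ler_pM2r// -ler_pdivrMr.
Qed.

(** Both optimal probabilities are at least [c0 / (2 * c1)], which confines the logit to
    [[-M, M]]. *)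
Lemma array_logit : exists2 us, phi us = gs true / (gs true + gs false) & `|us| <= B.
Proof.
have g1 := gs0 true; have g0 := gs0 false.
have sg : 0 < gs true + gs false by exact: addr_gt0.
have frac k : c0 / (2 * c1) <= gs k / (gs true + gs false).
  rewrite ler_pdivlMr// mulrAC ler_pdivrMr ?mulr_gt0//.
  have /andP[_ u1] := array_resid true; have /andP[_ u0] := array_resid false.
  have /andP[l _] := array_resid k.
  have h1 := ler_wpM2l (ltW hc0) (lerD u1 u0).
  have h2 := ler_wpM2l (ltW hc1) l; lra.
have eq1 : 1 - gs true / (gs true + gs false) = gs false / (gs true + gs false).
  by field; rewrite gt_eqF.
have [us usE] : exists u, phi u = gs true / (gs true + gs false).
  apply: (phi_surj hphi); rewrite divr_gt0//= ltr_pdivrMr// mul1r ltrDl//.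
exists us => //; apply: le_trans MB; rewrite leNgt; apply/negP; rewrite lter_normr.
move=> /orP[/ltW/hM|/ltW/hM].
  by rewrite usE; have := frac false; rewrite -eq1; lra.
by rewrite -(phi_sym hphi) usE; have := frac true; lra.
Qed.

(** All terms that vanish with the horizon, each a constant over a power of [q]. Absolute values
    allow every power to be replaced by the first without tracking signs. *)
Definition cerr (B c1 C a del r : R) : R :=
  let W := 1 + c1 ^+ 2 in
  `|C * (4 * B * (1 + cres B W)) * (4 * c1 ^+ 2 + a)|
  + `|2 * (cval B W + 12 * B ^+ 2 * W) / a| + `|2 * cmnoise B W / del ^+ 2|
  + 2 * `|cahat B W / r| + `|4 * closs B W|.

(** Of the five [eps], four come from the shift of the normal quantile, counted on both sides, and
    one from the tail of the smoothing. *)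
Lemma array_coverage (alpha eps C t del r : R) :
  let zal := normal_quantile (1 - alpha / 2) in
  0 < zal -> 1 - alpha / 2 <= ncdf zal ->
  0 <= C -> 0 < t -> clt_bound (t ^+ 2) C -> 0 < del -> 0 < r ->
  3 * del <= 2 * c0 * zal -> 3 * del <= 2 * c0 * eps -> zal * t <= 2 * c0 * eps ->
  ncdf (- (del / (2 * t))) <= eps ->
  r <= c0 ^+ 2 -> zal * (2 * c1) * (r / c0 ^+ 2) <= del ->
  4 * B * (1 + cres B W) <= q ->
  1 - alpha - 5 * eps - cerr B c1 C (t ^+ 2) del r / q <=
  pprob (ftrl_prob T phi x y) T (fun z => `[< ftrl_CI T phi x y alpha z (ate T y) >]).
Proof.
move=> zal zal0 hz C0 t0 hC del0 r0 d1 d2 zt tail rc rd qB.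
have q1 : 1 <= q by apply: le_trans Bq; have := B2; lra.
have K0 : 0 <= cres B W by exact: cres_ge0.
have a0 : 0 < t ^+ 2 by exact: exprn_gt0.
have e1 : 4 * B * (1 + cres B W) / q ^+ 3 <= 1.
  rewrite ler_pdivrMr ?exprn_gt0// mul1r; apply: le_trans qB _.
  exact: (qX_le B2 Bq (isT : 1 <= 3)%N).
have [us usE usB] := array_logit.
have := coverage B2 Bq Tq array_norm array_gram W1 array_fourth hb1 hb2 hphi b1B b2B
  gs0 gsE gsB usE usB (erefl zal) zal0 hc0 array_resid a0 C0 hC del0 d1 r0 rc rd e1.
set s := 4 * gs true * gs false / _.
set a := t ^+ 2 in a0 *; apply: le_trans.
have sc : 4 * c0 ^+ 2 <= s <= 4 * c1 ^+ 2.
  have /andP[l1 u1] := array_resid true; have /andP[l0 u0] := array_resid false.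
  rewrite /s ler_pdivlMr ?ler_pdivrMr ?(qX_gt0 B2 Bq)//.
  have -> : 4 * c0 ^+ 2 * q ^+ 192 = 4 * ((c0 * q ^+ 96) * (c0 * q ^+ 96)) by ring.
  have -> : 4 * c1 ^+ 2 * q ^+ 192 = 4 * ((c1 * q ^+ 96) * (c1 * q ^+ 96)) by ring.
  have cq : 0 <= c0 * q ^+ 96 by rewrite mulr_ge0// ltW.
  have -> : 4 * gs true * gs false = 4 * (gs true * gs false) by ring.
  rewrite !ler_pM2l//; apply/andP; split; apply: ler_pM => //; exact: ltW.
have /andP[s0 s1] := sc.
have c02 : 0 < c0 ^+ 2 by exact: exprn_gt0.
have sp : 0 < s by lra.
have rs : 2 * c0 <= Num.sqrt s.
  apply: le_of_sqr; first exact: sqrtr_ge0.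
  rewrite sqr_sqrtr ?(ltW sp)//; apply: le_trans s0.
  by rewrite exprMn; lra.
(* A bound on how far the effective quantile falls below [zal], from [sqrt (s + a) <= sqrt s + t]
   and [sqrt s >= 2 * c0]. *)
pose h := (3 * del + zal * t) / (2 * c0).
have h0 : 0 <= h.
  by rewrite divr_ge0 ?mulr_ge0 ?addr_ge0 ?mulr_ge0 ?ltW.
have hE : h * (2 * c0) = 3 * del + zal * t by rewrite /h divfK// mulf_neq0 ?gt_eqF.
have h2 : h <= 2 * eps by rewrite /h ler_pdivrMr ?mulr_gt0//; lra.
have sa : Num.sqrt (s + a) <= Num.sqrt s + t.
  apply: le_of_sqr; first exact: addr_ge0 (sqrtr_ge0 _) (ltW t0).
  rewrite sqr_sqrtr; last exact: ltW (addr_gt0 sp a0).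
  have -> : (Num.sqrt s + t) ^+ 2 = Num.sqrt s ^+ 2 + t ^+ 2 + 2 * (Num.sqrt s * t) by ring.
  by rewrite sqr_sqrtr ?(ltW sp)// -/a lerDl mulr_ge0// mulr_ge0 ?sqrtr_ge0// ltW.
have sap : 0 < Num.sqrt (s + a) by rewrite sqrtr_gt0 addr_gt0.
have zq : zal - h <= (zal * Num.sqrt s - 3 * del) / Num.sqrt (s + a).
  rewrite ler_pdivlMr//.
  have [zh|zh] := leP 0 (zal - h).
    apply: le_trans (ler_wpM2l zh sa) _.
    have -> : (zal - h) * (Num.sqrt s + t) =
      zal * Num.sqrt s + zal * t - h * Num.sqrt s - h * t by ring.
    have := ler_wpM2l h0 rs; have := mulr_ge0 h0 (ltW t0); lra.
  apply: le_trans (_ : 0 <= _); first by rewrite nmulr_rle0// ltW.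
  by have := ler_wpM2l (ltW zal0) rs; lra.
have main := ncdf_le zq.
have lip : ncdf zal - ncdf (zal - h) <= h.
  apply: le_trans (ler_norm _) _; apply: le_trans (ncdf_lip _ _) _.
  by rewrite (_ : zal - (zal - h) = h) ?ger0_norm//; ring.
have tl : ncdf (- (del / Num.sqrt (2 * a))) <= eps.
  apply: le_trans tail; apply: ncdf_le; rewrite lerN2 ler_wpM2l ?(ltW del0)//.
  rewrite lef_pV2 ?posrE ?sqrtr_gt0 ?mulr_gt0//.
  have -> : 2 * t = Num.sqrt ((2 * t) ^+ 2) by rewrite sqrtr_sqr gtr0_norm// mulr_gt0.
  apply: ler_wsqrtr; have -> : (2 * t) ^+ 2 = 4 * a by rewrite /a; ring.
  lra.
have k1 : C * (4 * B * (1 + cres B W) / q ^+ 3) * (s + a) <=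
   `|C * (4 * B * (1 + cres B W)) * (4 * c1 ^+ 2 + a)| / q.
  apply: le_trans (div_pow_le _ 2 q1).
  rewrite [leRHS]mulrAC mulrA; apply: ler_wpM2l; last by rewrite lerD2r.
  rewrite divr_ge0 ?exprn_ge0 ?(ltW q0)// mulr_ge0// mulr_ge0 ?addr_ge0// mulr_ge0 ?ltW//.
have k2 := div_pow_le (2 * (cval B W + 12 * B ^+ 2 * W) / a) 1 q1.
have k3 := div_pow_le (2 * cmnoise B W / del ^+ 2) 4 q1.
have k4 := div_pow_le (cahat B W / r) 1 q1.
have k5 := div_pow_le (4 * closs B W) 2 q1.
have k4' : cahat B W / q ^+ 2 / r = cahat B W / r / q ^+ 2 by ring.
have -> : cerr B c1 C a del r / q =
    `|C * (4 * B * (1 + cres B W)) * (4 * c1 ^+ 2 + a)| / q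
    + `|2 * (cval B W + 12 * B ^+ 2 * W) / a| / q + `|2 * cmnoise B W / del ^+ 2| / q
    + 2 * (`|cahat B W / r| / q) + `|4 * closs B W| / q by rewrite /cerr -/W; ring.
rewrite k4'; lra.
Qed.

End Array.

Theorem corollary5p9 (R : realType)
  (phi : R -> R) (b1 b2 b3 : R)
  (hb1 : 0 < b1) (hb2 : 0 < b2) (hb3 : 0 < b3)
  (hphi : sigmoid_condition b1 b2 b3 phi)
  (d : nat -> nat)
  (x : forall T : nat, nat -> 'cV[R]_(d T))
  (y : nat -> bool -> nat -> R)
  (c0 c1 c2 c3 gamma0 : R)
  (hc0 : 0 < c0) (hc01 : c0 <= c1) (hc2 : 0 < c2) (hc3 : 0 < c3)
  (hgamma0 : 0 < gamma0)
  (hA1 : forall T : nat, gamma0 ^+ 2 <= T%:R -> assumption1 T (x T) (y T) c0 c1)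
  (hA2 : forall T : nat, gamma0 ^+ 2 <= T%:R -> assumption2 T (x T) c2 gamma0)
  (hA3 : forall T : nat, gamma0 ^+ 2 <= T%:R -> assumption3 T (x T) c3)
  (hA4 : ((-1)%:E < limn_einf (fun T : nat => (rho T (x T) (y T))%:E))%E)
  (disp : nat -> measure_display)
  (Omega : forall T : nat, measurableType (disp T))
  (P : forall T : nat, probability (Omega T) R)
  (Z : forall T : nat, nat -> {RV (P T) >-> bool})
  (hZ : forall T : nat, assigned_with (Z T) T (ftrl_prob T phi (x T) (y T)))
  (alpha : R) (halpha : 0 < alpha < 1) :
  ((1 - alpha)%:E <=
   limn_einf (fun T : nat =>
     P T [set w | ftrl_CI T phi (x T) (y T) alpha (fun t => Z T t w)
                    (ate T (y T))]))%E.
Proof.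
have hc1 : 0 < c1 by lra.
have /(phi_gt hphi)[M M0 hM] : 0 < c0 / (2 * c1) by rewrite divr_gt0 ?mulr_gt0.
have /andP[alpha0 alpha1] := halpha.
set zal := normal_quantile (1 - alpha / 2).
have zal0 : 0 < zal by apply: normal_quantile_gt0; lra.
have hz : 1 - alpha / 2 <= ncdf zal by apply: normal_quantile_ge; lra.
have c10 : 0 < c1 / c0 by rewrite divr_gt0.
have [B [B2 b1B b2B c2B c3B] [gB c10B MB]] : exists2 B, [/\ 2 <= B, b1 <= B, b2 <= B, c2 <= B
    & c3 <= B] & [/\ gamma0 <= B, c1 / c0 <= B & M <= B].
  exists (2 + b1 + b2 + c2 + c3 + gamma0 + c1 / c0 + M); split;
    by move: (c1 / c0) c10 => *; lra.
pose W := 1 + c1 ^+ 2.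
have W1 : 1 <= W by rewrite lerDl sqr_ge0.
have K0 : 0 <= cres B W by apply: cres_ge0.
(* Five parts are spent in [array_coverage], the sixth on the vanishing terms [K / q]. *)
apply: limn_einf_ge => e e0; pose eps := e / 6.
have eps0 : 0 < eps by rewrite divr_gt0.
have [r1 r10 tail] := ncdf_tail eps0.
pose del := Num.min (2 * c0 * zal / 3) (2 * c0 * eps / 3).
have del0 : 0 < del by rewrite lt_min !divr_gt0 ?mulr_gt0.
have d1 : 3 * del <= 2 * c0 * zal.
  by rewrite mulrC -ler_pdivlMr// ge_min lexx.
have d2 : 3 * del <= 2 * c0 * eps.
  by rewrite mulrC -ler_pdivlMr// ge_min lexx orbT.
(* The added variance is [t ^ 2], chosen after [del] so that the smoothing tail beyond [del] is at
   most [eps]; the constant [C] then depends on it, and the horizon comes last. *)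
pose t := Num.min (del / (2 * r1)) (2 * c0 * eps / zal).
have t0 : 0 < t by rewrite lt_min !divr_gt0 ?mulr_gt0.
have t1 : zal * t <= 2 * c0 * eps.
  by rewrite mulrC -ler_pdivlMr// ge_min lexx orbT.
have t2 : ncdf (- (del / (2 * t))) <= eps.
  apply: le_trans (ltW tail); apply: ncdf_le; rewrite lerN2 ler_pdivlMr ?mulr_gt0//.
  have : t <= del / (2 * r1) by rewrite ge_min lexx.
  by rewrite ler_pdivlMr ?mulr_gt0//; lra.
have [C C0 hC] := martingale_clt (exprn_gt0 2 t0).
have c020 : 0 < c0 ^+ 2 by exact: exprn_gt0.
pose r := Num.min (c0 ^+ 2) (del * c0 ^+ 2 / (zal * (2 * c1))).
have r0 : 0 < r by rewrite lt_min c020 divr_gt0 ?mulr_gt0.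
have rc : r <= c0 ^+ 2 by rewrite ge_min lexx.
have rd : zal * (2 * c1) * (r / c0 ^+ 2) <= del.
  have -> : zal * (2 * c1) * (r / c0 ^+ 2) = r * (zal * (2 * c1)) / c0 ^+ 2 by ring.
  rewrite ler_pdivrMr// -ler_pdivlMr ?mulr_gt0//.
  by rewrite ge_min lexx orbT.
pose K := cerr B c1 C (t ^+ 2) del r.
have K1 : 0 <= K by rewrite /K /cerr !addr_ge0// mulr_ge0.
(* The threshold for [q]: its three summands provide [Bq], the smallness of the increments, and
   [K / q <= eps]. *)
pose Q := B + 4 * B * (1 + cres B W) + K / eps.
have Ke : 0 <= K / eps by rewrite divr_ge0// ltW.
have B0 : 0 <= B by lra.
have Kc : 0 <= 4 * B * (1 + cres B W).
  exact: mulr_ge0 (mulr_ge0 (ler0n _ 4) B0) (addr_ge0 ler01 K0).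
have QB : B <= Q by rewrite /Q -addrA lerDl addr_ge0.
have Q0 : 0 < Q by apply: lt_le_trans QB; apply: lt_le_trans B2.
have Qg : 0 <= Q ^+ 192 by rewrite exprn_ge0// ltW.
exists (Num.truncn (Q ^+ 192 + gamma0 ^+ 2)).+1 => T NT.
have TQ : Q ^+ 192 + gamma0 ^+ 2 <= T%:R.
  have := truncnS_gt (Q ^+ 192 + gamma0 ^+ 2).
  by move=> /ltW /le_trans; apply; rewrite ler_nat.
have g0 : 0 <= gamma0 ^+ 2 by exact: sqr_ge0.
have Tg : gamma0 ^+ 2 <= T%:R by apply: le_trans TQ; rewrite lerDr.
pose q : R := T%:R `^ (192%:R^-1).
have Tq : T%:R = q ^+ 192 by rewrite powR_inv_expK.
have Qq : Q <= q.
  rewrite -(ler_pXn2r (n := 192))// ?nnegrE ?powR_ge0 ?(ltW Q0)//.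
  by rewrite -Tq; apply: le_trans TQ; rewrite lerDl.
have q0 : 0 < q by exact: lt_le_trans Qq.
have Bq : B <= q by exact: le_trans Qq.
have qB : 4 * B * (1 + cres B W) <= q.
  by apply: le_trans Qq; rewrite /Q -addrA addrCA lerDl addr_ge0.
have Kq : K / q <= eps.
  by rewrite ler_pdivrMr// mulrC -ler_pdivrMr//; apply: le_trans Qq; rewrite lerDr addr_ge0.
have pa := adapted_ftrl_prob T (x T) (y T) phi.
have -> : [set w | ftrl_CI T phi (x T) (y T) alpha (fun t => Z T t w) (ate T (y T))] =
   [set w | `[< ftrl_CI T phi (x T) (y T) alpha (fun t => Z T t w) (ate T (y T)) >]].
  by apply/seteqP; split => w /= /asboolP.
rewrite (law_pprob pa (hZ T) (@adapted_ftrl_CI _ T _ phi (x T) (y T) alpha (ate T (y T)))) lee_fin.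
have := array_coverage hb1 hb2 hphi hc0 hc01 hc2 hM B2 b1B b2B c2B c3B gB c10B MB Bq Tq
  (hA1 T Tg) (hA2 T Tg) (hA3 T Tg) zal0 hz C0 t0 hC del0 r0 d1 d2 t1 t2 rc rd qB.
apply: le_trans; rewrite -/K; have -> : e = 6 * eps by rewrite /eps; field.
by clear -Kq; lra.
Qed.
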